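(* Let $\bar{C}$ be the algebra of $\mathrm{Sp}_4$-invariant complex polynomial functions of two generic matrices $x,y\in M_4(\mathbb{C})$ under simultaneous conjugation. The traces $\mathrm{tr}\,w$ of the following $136$ matrices $w$ form a minimal set of homogeneous generators (MSG) of $\bar{C}$: Degree 1: $x,\ y$; Degree 2: $x^2,\ xx^*,\ xy,\ xy^*,\ y^2,\ yy^*$; Degree 3: $x^3,\ x^2y,\ x^2y^*,\ xx^*y,\ y^2x,\ y^2x^*,\ yy^*x,\ y^3$; Degree 4: $x^4,\ x^3x^*,\ x^3y,\ x^3y^*,\ x^2x^*y,\ x^*x^2y^*,\ x^2y^2,\ (xy)^2,\ xyxy^*,\ yxyx^*,\ xyx^*y^*,\ x^2yy^*,\ y^2xx^*,\ xx^*yy^*,\ y^3x,\ y^3x^*,\ y^2y^*x,\ y^*y^2x^*,\ y^4,\ y^3y^*$; Degree 5: $x^3x^*y,\ x^2x^*xy,\ xx^*x^2y,\ x^3y^2,\ x^3yy^*,\ x^3y^*y,\ x^2x^*y^2,\ x^*x^2y^2,\ x^2yx^*y^*,\ x^2y^*xy,\ xx^*yx^*y,\ y^3x^2,\ y^3xx^*,\ y^3x^*x,\ y^2y^*x^2,\ y^*y^2x^2,\ y^2xy^*x^*,\ y^2x^*yx,\ yy^*xy^*x,\ y^3y^*x,\ y^2y^*yx,\ yy^*y^2x$; Degree 6: $x^2x^*x^2y,\ x^2(x^* )^2xy,\ x^2(x^* )^2y^2,\ x^*x^2x^*y^2,\ (x^2y)^2,\ x^*x^2yxy^*,\ x^3yxy^*,\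 x^2yx^2y^*,\ x^2yxx^*y,\ x^2yx^*xy,\ x^2yx^*xy^*,\ x^3y^2y^*,\ y^3x^2x^*,\ x^2y^2xy,\ y^2x^2yx,\ x^2y^2xy^*,\ y^2x^2yx^*,\ x^2y^*yxy,\ y^2x^*xyx,\ xx^*(y^* )^2xy,\ yy^*(x^* )^2yx,\ xyx^*yx^*y^*,\ xyx^*y^*xy^*,\ y^2(y^* )^2x^2,\ y^*y^2y^*x^2,\ (y^2x)^2,\ y^*y^2xyx^*,\ y^3xyx^*,\ y^2xy^2x^*,\ y^2xyy^*x,\ y^2xy^*yx,\ y^2xy^*yx^*,\ y^2y^*y^2x,\ y^2(y^* )^2yx$; Degree 7: $x^2x^*x^3y,\ x^3x^*xy^2,\ xx^*xyx^2y,\ x^3yx^*xy^*,\ x^2x^*yx^2y^*,\ x^3y^2xy,\ x^*xx^*y^2xy^*,\ x(x^* )^2y^2x^*y,\ x^2yy^*x^2y,\ xx^*y^2x^2y,\ x^*xy^2x^2y,\ x^*xy^2xx^*y,\ x^2yxyxy^*,\ x^2yxyx^*y,\ y^3x^2yx,\ y^*yy^*x^2yx^*,\ y(y^* )^2x^2y^*x,\ y^2xx^*y^2x,\ yy^*x^2y^2x,\ y^*yx^2y^2x,\ y^*yx^2yy^*x,\ y^2xyxyx^*,\ y^2xyxy^*x,\ y^3y^*yx^2,\ yy^*yxy^2x,\ y^3xy^*yx^*,\ y^2y^*xy^2x^*,\ y^2y^*y^3x$; Degree 8: $x^3yx^2x^*y,\ x^3y^2x^2y,\ x^*x^2y^*yx^2y,\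 xx^*yx^2yxy,\ xx^*xy^3xy,\ yy^*yx^3yx,\ x^3y^3x^*y,\ y^3x^3y^*x,\ y^3x^2y^2x,\ y^*y^2x^*xy^2x,\ yy^*xy^2xyx,\ y^3xy^2y^*x$; Degree 9: $x^3yx^2yxy,\ x^2y^2xyx^2y,\ y^2x^2yxy^2x,\ y^3xy^2xyx$.
   Context: $M_k=M_k(\mathbb{C})$ is the algebra of complex $k\times k$ matrices and $X^T$ is the transpose of $X$. The symplectic group is $\mathrm{Sp}_{2n}=\{A\in \mathrm{GL}_{2n}(\mathbb{C}) : A^TJA=J\}$ with $J=\begin{bmatrix}0&-I_n\\ I_n&0\end{bmatrix}$. The symplectic adjoint of $X\in M_{2n}$ is $X^*=J^{-1}X^TJ$; the map $X\mapsto X^*$ is an involutory anti-automorphism of the algebra $M_{2n}$. Here $n=2$. $\bar{C}$ denotes the algebra of complex (holomorphic) polynomial functions on $M_4\times M_4$ invariant under the action $a\cdot(x,y)=(axa^{-1},aya^{-1})$, $a\in\mathrm{Sp}_4$. It is graded by total degree. A word $w$ in $x,x^*,y,y^*$ defines the homogeneous invariant $(x,y)\mapsto \mathrm{tr}\,w$ whose degree is the length of $w$. A minimal set of homogeneous generators (MSG) of $\bar{C}$ is a set of homogeneous elements that generates $\bar{C}$ as a $\mathbb{C}$-algebra and no proper subset of which generates $\bar{C}$. *)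

(* Defs.v *)
From HB Require Import structures.
From mathcomp Require Import all_boot all_order all_algebra.
From mathcomp Require Import boolp classical_sets functions reals.
From mathcomp Require Import complex mpoly.

Set Implicit Arguments.
Unset Strict Implicit.
Unset Printing Implicit Defensive.

Import Order.TTheory GRing.Theory Num.Theory.

Local Open Scope classical_set_scope.
Local Open Scope ring_scope.

Section SymplecticInvariants.

Variables (K : fieldType) (n : nat).

Definition symp_form : 'M[K]_(n + n) := block_mx 0 (- 1%:M) 1%:M 0.

Definition symp_group : set 'M[K]_(n + n) :=
  [set A | A \in unitmx /\ A^T *m symp_form *m A = symp_form].

Definition symp_adj (X : 'M[K]_(n + n)) : 'M[K]_(n + n) :=
  invmx symp_form *m X^T *m symp_form.

Definition mxpair : Type := ('M[K]_(n + n) * 'M[K]_(n + n))%type.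

Definition conj_pair (a : 'M[K]_(n + n)) (z : mxpair) : mxpair :=
  (a *m z.1 *m invmx a, a *m z.2 *m invmx a).

Definition ncoords : nat := ((n + n) * (n + n) + (n + n) * (n + n))%N.

Definition coords (z : mxpair) : 'I_ncoords -> K :=
  row_mx (mxvec z.1) (mxvec z.2) 0.

Definition polynomial_function (f : mxpair -> K) : Prop :=
  exists p : {mpoly K[ncoords]}, forall z, f z = p.@[coords z].

Definition homogeneous_function (f : mxpair -> K) : Prop :=
  exists (d : nat) (p : {mpoly K[ncoords]}),
    p \is d.-homog /\ forall z, f z = p.@[coords z].

(* The algebra of polynomial invariants, as a set of functions. *)
Definition symp_invariants : set (mxpair -> K) :=
  [set f | polynomial_function f /\
           forall a z, symp_group a -> f (conj_pair a z) = f z].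

End SymplecticInvariants.

Arguments symp_form : clear implicits.
Arguments symp_invariants : clear implicits.

Section Generators.

Variables (K : fieldType) (T : Type).

Definition subalgebra (A : set (T -> K)) : Prop :=
  [/\ forall c : K, A (cst c),
      forall f g, A f -> A g -> A (f \+ g) &
      forall f g, A f -> A g -> A (f \* g)].

Definition generated_subalgebra (S : set (T -> K)) : set (T -> K) :=
  \bigcap_(A in [set A | subalgebra A /\ S `<=` A]) A.

(* [S] is a minimal set of homogeneous generators of the algebra [A] of
   functions, [is_hom] being the predicate of homogeneous functions. *)
Definition minimal_homogeneous_generators (is_hom : (T -> K) -> Prop)
    (A S : set (T -> K)) : Prop :=
  [/\ S `<=` A,
      forall f, S f -> is_hom f,
      generated_subalgebra S = A &
      forall S', S' `<` S -> generated_subalgebra S' <> A].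

End Generators.

(* A letter is a pair of booleans: the first one selects x (false) or y (true),
   the second one tells whether the symplectic adjoint is applied. *)
Definition letter : Type := (bool * bool)%type.

Definition word : Type := seq letter.

Definition eval_letter (K : fieldType) (n : nat) (z : mxpair K n) (l : letter) :
    'M[K]_(n + n) :=
  let m := if l.1 then z.2 else z.1 in if l.2 then symp_adj m else m.

Definition eval_word (K : fieldType) (n : nat) (w : word) (z : mxpair K n) :
    'M[K]_(n + n) :=
  \big[mulmx/1%:M]_(l <- w) eval_letter z l.

Definition trace_word (K : fieldType) (n : nat) (w : word) (z : mxpair K n) :
    K :=
  \tr (eval_word w z).

Declare Scope word_scope.
Delimit Scope word_scope with W.

(* Multiplicative notation for concatenation of words. *)
Notation "u * v" := (@cat letter u v) (only parsing) : word_scope.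
Notation "u ^ k" := (flatten (@nseq word k%N u)) (only parsing) : word_scope.

(* [x'] and [y'] stand for the symplectic adjoints of [x] and [y]. *)
Definition generator_words : seq word :=
  let x : word := [:: (false, false)] in
  let x' : word := [:: (false, true)] in
  let y : word := [:: (true, false)] in
  let y' : word := [:: (true, true)] in
  ([::
    x; y;
    x^2; x * x'; x * y; x * y'; y^2; y * y';
    x^3; x^2 * y; x^2 * y'; x * x' * y; y^2 * x; y^2 * x'; y * y' * x; y^3;
    x^4; x^3 * x'; x^3 * y; x^3 * y'; x^2 * x' * y; x' * x^2 * y'; x^2 * y^2;
    (x * y)^2; x * y * x * y'; y * x * y * x'; x * y * x' * y'; x^2 * y * y';
    y^2 * x * x'; x * x' * y * y'; y^3 * x; y^3 * x'; y^2 * y' * x;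
    y' * y^2 * x'; y^4; y^3 * y';
    x^3 * x' * y; x^2 * x' * x * y; x * x' * x^2 * y; x^3 * y^2; x^3 * y * y';
    x^3 * y' * y; x^2 * x' * y^2; x' * x^2 * y^2; x^2 * y * x' * y';
    x^2 * y' * x * y; x * x' * y * x' * y; y^3 * x^2; y^3 * x * x';
    y^3 * x' * x; y^2 * y' * x^2; y' * y^2 * x^2; y^2 * x * y' * x';
    y^2 * x' * y * x; y * y' * x * y' * x; y^3 * y' * x; y^2 * y' * y * x;
    y * y' * y^2 * x;
    x^2 * x' * x^2 * y; x^2 * x'^2 * x * y; x^2 * x'^2 * y^2;
    x' * x^2 * x' * y^2; (x^2 * y)^2; x' * x^2 * y * x * y'; x^3 * y * x * y';
    x^2 * y * x^2 * y'; x^2 * y * x * x' * y; x^2 * y * x' * x * y;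
    x^2 * y * x' * x * y'; x^3 * y^2 * y'; y^3 * x^2 * x'; x^2 * y^2 * x * y;
    y^2 * x^2 * y * x; x^2 * y^2 * x * y'; y^2 * x^2 * y * x';
    x^2 * y' * y * x * y; y^2 * x' * x * y * x; x * x' * y'^2 * x * y;
    y * y' * x'^2 * y * x; x * y * x' * y * x' * y'; x * y * x' * y' * x * y';
    y^2 * y'^2 * x^2; y' * y^2 * y' * x^2; (y^2 * x)^2; y' * y^2 * x * y * x';
    y^3 * x * y * x'; y^2 * x * y^2 * x'; y^2 * x * y * y' * x;
    y^2 * x * y' * y * x; y^2 * x * y' * y * x'; y^2 * y' * y^2 * x;
    y^2 * y'^2 * y * x;
    x^2 * x' * x^3 * y; x^3 * x' * x * y^2; x * x' * x * y * x^2 * y;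
    x^3 * y * x' * x * y'; x^2 * x' * y * x^2 * y'; x^3 * y^2 * x * y;
    x' * x * x' * y^2 * x * y'; x * x'^2 * y^2 * x' * y;
    x^2 * y * y' * x^2 * y; x * x' * y^2 * x^2 * y; x' * x * y^2 * x^2 * y;
    x' * x * y^2 * x * x' * y; x^2 * y * x * y * x * y';
    x^2 * y * x * y * x' * y; y^3 * x^2 * y * x; y' * y * y' * x^2 * y * x';
    y * y'^2 * x^2 * y' * x; y^2 * x * x' * y^2 * x; y * y' * x^2 * y^2 * x;
    y' * y * x^2 * y^2 * x; y' * y * x^2 * y * y' * x;
    y^2 * x * y * x * y * x'; y^2 * x * y * x * y' * x; y^3 * y' * y * x^2;
    y * y' * y * x * y^2 * x; y^3 * x * y' * y * x'; y^2 * y' * x * y^2 * x';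
    y^2 * y' * y^3 * x;
    x^3 * y * x^2 * x' * y; x^3 * y^2 * x^2 * y; x' * x^2 * y' * y * x^2 * y;
    x * x' * y * x^2 * y * x * y; x * x' * x * y^3 * x * y;
    y * y' * y * x^3 * y * x; x^3 * y^3 * x' * y; y^3 * x^3 * y' * x;
    y^3 * x^2 * y^2 * x; y' * y^2 * x' * x * y^2 * x;
    y * y' * x * y^2 * x * y * x; y^3 * x * y^2 * y' * x;
    x^3 * y * x^2 * y * x * y; x^2 * y^2 * x * y * x^2 * y;
    y^2 * x^2 * y * x * y^2 * x; y^3 * x * y^2 * x * y * x
  ])%W.

Fact size_generator_words : size generator_words = 136%N.
Proof. by []. Qed.

Fact degrees_generator_words :
  [seq count (fun w : word => size w == d) generator_words | d <- iota 1 9]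
  = [:: 2; 6; 8; 20; 22; 34; 28; 12; 4]%N.
Proof. by []. Qed.

(* Main.v *)
(* Write a = m + m* and b = m - m* for m = x, y. If S and T are self-adjoint,
   then ST + TS is a combination of S, T and 1 with coefficients in the algebra
   of traces. Hence, modulo products of traces of shorter words, traces factor
   through a finite-dimensional graded quotient of the free algebra on the four
   letters a, b, which vanishes in degree 9; a computation in this quotient shows
   that the traces of the 136 words generate the algebra of all traces of words.

   First fundamental theorem: evaluate an invariant f on the matrices of x and y in
   a symplectic basis obtained by Gram-Schmidt from four generic vectors v. This
   gives f * gamma^N = P(v), where P is built from pairings (v_k, w v_l) and
   traces, and gamma from the pairings (v_k, v_l). Applying gamma^N(d/dv), which
   turns pairings into traces, one gets f times a nonzero constant.

   Minimality: a linear functional on words which is invariant under cyclic shifts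
   and the involution, and killed by the eight-term Jordan relation, extends to
   polynomials in traces as a functional "linear part" which vanishes on all
   identities satisfied by matrices. Indeed, after polarization and restriction to
   rank one matrices, identities become relations between products of symplectic
   pairings; these are spanned by 6 x 6 Pfaffians, as follows by straightening to
   matchings without 3-nestings. An explicit such functional separates the 136
   words. *)

From Stdlib Require Import ZArith.
Require Import Defs.
From mathcomp Require Import all_boot all_order all_algebra.
From mathcomp Require Import boolp classical_sets functions reals.
From mathcomp Require Import complex mpoly.
From mathcomp Require Import zify ring lra ssrZ.

Set Implicit Arguments.
Unset Strict Implicit.
Unset Printing Implicit Defensive.

Import Order.TTheory GRing.Theory Num.Theory.

Local Open Scope ring_scope.

(** * Matchings and Pfaffian relations *)

(** The quotient dies in degree 9, yet four generators have degree 9. A relation of the quotient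
    holds only against at least one further letter: the scalar term of the Jordan relation
    contributes tr(ST) times the trace of the remaining word, which is a product of shorter traces
    only if that word is nonempty. So the vanishing of words of length 9 makes traces of length at
    least 10 decomposable, while those of length at most 9 need a second table, on words whose first
    letter is left unreduced.

    Both halves use the same tables with different standards. For generation every rule is derived
    from the Jordan identity, by induction on the length of words. For minimality the tables merely
    propose a candidate: cyclicity, the sign under reversal and the eight-term relation are checked
    directly on the finitely many words of nonzero value. The functional is universal, with values
    in the span of the normal forms; composing it with arbitrary linear forms reduces the separation
    of the 136 words to the independence of 136 integer rows. *)

Definition edge : Type := (nat * nat)%type.
Definition points (E : seq edge) : seq nat := flatten [seq [:: e.1; e.2] | e <- E].
Definition oriented (E : seq edge) := all (fun e : edge => (e.1 < e.2)%N) E.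
Definition matching (n : nat) (E : seq edge) :=
  perm_eq (points E) (iota 0 n.*2) && oriented E.
Definition nested (e f : edge) := (e.1 < f.1)%N && (f.2 < e.2)%N.
Definition has_3nesting (E : seq edge) :=
  has (fun e => has (fun f => nested e f && has (nested f) E) E) E.
(** Among all pairings of given points this sum is least for the nested one, as in the rearrangement
    inequality. It orders both the straightening and the proof of independence. *)
Definition stat (E : seq edge) : nat := (\sum_(e <- E) e.1 * e.2)%N.

(** The fifteen terms of a 6 x 6 Pfaffian, the bit being the parity of the number of crossings. The
    triple nesting comes first, so that [behead] leaves the terms that replace it. *)
Definition pf6 (p1 p2 p3 p4 p5 p6 : nat) : seq (bool * seq edge) :=
  [:: (false, [:: (p1, p6); (p2, p5); (p3, p4)]);
      (true,  [:: (p1, p6); (p2, p4); (p3, p5)]);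
      (false, [:: (p1, p6); (p2, p3); (p4, p5)]);
      (true,  [:: (p1, p5); (p2, p6); (p3, p4)]);
      (false, [:: (p1, p5); (p2, p4); (p3, p6)]);
      (true,  [:: (p1, p5); (p2, p3); (p4, p6)]);
      (false, [:: (p1, p4); (p2, p6); (p3, p5)]);
      (true,  [:: (p1, p4); (p2, p5); (p3, p6)]);
      (false, [:: (p1, p4); (p2, p3); (p5, p6)]);
      (true,  [:: (p1, p3); (p2, p6); (p4, p5)]);
      (false, [:: (p1, p3); (p2, p5); (p4, p6)]);
      (true,  [:: (p1, p3); (p2, p4); (p5, p6)]);
      (false, [:: (p1, p2); (p3, p6); (p4, p5)]);
      (true,  [:: (p1, p2); (p3, p5); (p4, p6)]);
      (false, [:: (p1, p2); (p3, p4); (p5, p6)])].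

Section PfaffianClass.
Variable K : comNzRingType.

(** These are the linear forms on matchings modulo the Pfaffian relations; arguing with all of them
    replaces the construction of the quotient module. *)
Definition pfaffian_functional (n : nat) (Psi : seq edge -> K) : Prop :=
  (forall E E', matching n E -> perm_eq E E' -> Psi E = Psi E') /\
  (forall E p1 p2 p3 p4 p5 p6,
     (p1 < p2)%N -> (p2 < p3)%N -> (p3 < p4)%N -> (p4 < p5)%N -> (p5 < p6)%N ->
     matching n ([:: (p1, p6); (p2, p5); (p3, p4)] ++ E) ->
     \sum_(s <- pf6 p1 p2 p3 p4 p5 p6) (-1) ^+ s.1 * Psi (s.2 ++ E) = 0).

Lemma points_cat E F : points (E ++ F) = points E ++ points F.
Proof. by rewrite /points map_cat flatten_cat. Qed.

Lemma perm_points E F : perm_eq E F -> perm_eq (points E) (points F).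
Proof. by move=> h; apply: perm_flatten; apply: perm_map. Qed.

Lemma size_points E : size (points E) = (size E).*2.
Proof. by elim: E => //= e E /= ->. Qed.

Lemma matching_perm n E F : perm_eq E F -> matching n E = matching n F.
Proof.
move=> h; rewrite /matching /oriented (perm_all _ h).
by rewrite (permPl (perm_points h)).
Qed.

Lemma stat_cat E F : stat (E ++ F) = (stat E + stat F)%N.
Proof. by rewrite /stat big_cat. Qed.

Lemma stat_bound n E : matching n E -> (stat E <= n * (n.*2 * n.*2))%N.
Proof.
case/andP => hp _.
have hs : size E = n.
  by move/perm_size: hp; rewrite size_points size_iota => /double_inj.
have : forall e, e \in E -> (e.1 * e.2 <= n.*2 * n.*2)%N.
  move=> e he.
  have hin p : p \in [:: e.1; e.2] -> (p < n.*2)%N.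
    move=> hpe; have : p \in points E by apply/flatten_mapP; exists e.
    by rewrite (perm_mem hp) mem_iota.
  by apply: leq_mul; apply: ltnW; apply: hin; rewrite !inE eqxx ?orbT.
move: (n.*2 * n.*2)%N => B; rewrite -hs /stat; elim: E {hp hs} => [|e E IH] h.
  by rewrite big_nil.
rewrite big_cons /= mulSn; apply: leq_add; first by apply: h; rewrite inE eqxx.
by apply: IH => f hf; apply: h; rewrite inE hf orbT.
Qed.

(* Swapping partners in a 3-nesting increases [stat]: the nested matching pairs large points with small ones. *)
Lemma pf6_tail n E p1 p2 p3 p4 p5 p6 :
  (p1 < p2)%N -> (p2 < p3)%N -> (p3 < p4)%N -> (p4 < p5)%N -> (p5 < p6)%N ->
  matching n ([:: (p1, p6); (p2, p5); (p3, p4)] ++ E) ->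
  forall s, s \in behead (pf6 p1 p2 p3 p4 p5 p6) ->
  matching n (s.2 ++ E) /\
  (stat ([:: (p1, p6); (p2, p5); (p3, p4)] ++ E) < stat (s.2 ++ E))%N.
Proof.
move=> h1 h2 h3 h4 h5 /andP[hp ho] s hs.
have hor : oriented E by move: ho; rewrite /oriented all_cat => /andP[].
split; last first.
  rewrite !stat_cat ltn_add2r.
  have hst a b c d e f : stat [:: (a, b); (c, d); (e, f)] = (a * b + c * d + e * f)%N.
    by rewrite /stat !big_cons big_nil /= addn0 addnA.
  move: hs; rewrite hst /=.
  do 13![rewrite inE => /orP[/eqP-> /=|]; [rewrite hst; nia|]].
  by rewrite inE => /eqP-> /=; rewrite hst; nia.
apply/andP; split; last first.
  rewrite /oriented all_cat -/(oriented E) hor andbT.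
  move: hs; rewrite /=.
  do 13![rewrite inE => /orP[/eqP-> /=|]; [apply/and4P; split=> //; lia|]].
  by rewrite inE => /eqP-> /=; apply/and4P; split=> //; lia.
apply: perm_trans hp; rewrite !points_cat perm_cat2r.
have hpt (a b c d e f : nat) : points [:: (a, b); (c, d); (e, f)] = [:: a; b; c; d; e; f] by [].
apply/permP => P; move: hs; rewrite /=.
do 13![rewrite inE => /orP[/eqP-> /=|]; [lia|]].
by rewrite inE => /eqP-> /=; lia.
Qed.

Lemma nested_triple E : oriented E -> has_3nesting E ->
  exists p1 p2 p3 p4 p5 p6 E',
    [/\ (p1 < p2)%N, (p2 < p3)%N, (p3 < p4)%N, (p4 < p5)%N & (p5 < p6)%N] /\
    perm_eq E ([:: (p1, p6); (p2, p5); (p3, p4)] ++ E').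
Proof.
move=> ho /hasP[[p1 p6] h1 /hasP[[p2 p5] h2 /andP[/andP[/= n1 n2]]]].
move=> /hasP[[p3 p4] h3 /andP[/= n3 n4]].
have hn : (p3 < p4)%N by move/allP: ho => /(_ _ h3).
exists p1, p2, p3, p4, p5, p6, (rem (p3, p4) (rem (p2, p5) (rem (p1, p6) E))).
split=> //=.
apply: (perm_trans (perm_to_rem h1)); rewrite perm_cons.
have h2' : (p2, p5) \in rem (p1, p6) E.
  have := perm_mem (perm_to_rem h1) (p2, p5); rewrite h2 inE => /esym/orP[/eqP[]|//].
  by lia.
apply: (perm_trans (perm_to_rem h2')); rewrite perm_cons.
apply: perm_to_rem.
have := perm_mem (perm_to_rem h1) (p3, p4); rewrite h3 inE => /esym/orP[/eqP[]|]; first lia.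
move=> h3'; have := perm_mem (perm_to_rem h2') (p3, p4).
by rewrite h3' inE => /esym/orP[/eqP[]|//]; lia.
Qed.

(** Solving a Pfaffian relation for its triple nesting leaves fourteen matchings of larger [stat];
    since [stat] is bounded, the rewriting stops. *)
Lemma straightening n E : matching n E ->
  exists F : seq (K * seq edge),
    (forall t, t \in F -> matching n t.2 && ~~ has_3nesting t.2) /\
    forall Psi, pfaffian_functional n Psi -> Psi E = \sum_(t <- F) t.1 * Psi t.2.
Proof.
move: {2}(n * (n.*2 * n.*2) - stat E)%N (leqnn (n * (n.*2 * n.*2) - stat E)%N) => m.
elim: m E => [|m IH] E hm hE.
all: case: (boolP (has_3nesting E)) => [h3|h3]; last first.
1,3: exists [:: (1, E)]; split=> [t|Psi _]; [by rewrite inE => /eqP->; rewrite hE h3 | by rewrite big_seq1 mul1r].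
all: have [p1 [p2 [p3 [p4 [p5 [p6 [E' [[l1 l2 l3 l4 l5] hperm]]]]]]]] :=
  nested_triple (proj2 (andP hE)) h3.
all: have hE' := hE; rewrite (matching_perm _ hperm) in hE'.
all: have htail := pf6_tail l1 l2 l3 l4 l5 hE'.
all: have hstat : stat E = stat ([:: (p1, p6); (p2, p5); (p3, p4)] ++ E') by apply: perm_big.
  (* Base case: [E] already attains the bound on [stat], so a replacing term of larger [stat] cannot
     exist. *)
  have hs : (true, [:: (p1, p6); (p2, p4); (p3, p5)]) \in behead (pf6 p1 p2 p3 p4 p5 p6).
    by rewrite /= inE eqxx.
  have [hs1 hs2] := htail _ hs; have := leq_trans hs2 (stat_bound hs1).
  by rewrite -hstat ltnNge -subn_eq0 -leqn0 hm.
have : forall L : seq (bool * seq edge),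
    {subset L <= behead (pf6 p1 p2 p3 p4 p5 p6)} ->
    exists F : seq (K * seq edge),
    (forall t, t \in F -> matching n t.2 && ~~ has_3nesting t.2) /\
    forall Psi, pfaffian_functional n Psi ->
      \sum_(s <- L) (-1) ^+ s.1 * Psi (s.2 ++ E') = \sum_(t <- F) t.1 * Psi t.2.
  elim=> [|s L IHL] hL.
    by exists [::]; split=> // Psi _; rewrite !big_nil.
  have [|F1 [hF1 hF1']] := IHL; first by move=> t ht; apply: hL; rewrite inE ht orbT.
  have [hs1 hs2] := htail s (hL s (mem_head _ _)).
  have [|F2 [hF2 hF2']] := IH (s.2 ++ E') _ hs1.
    have hb := stat_bound hs1; rewrite hstat in hm; move: hm hb hs2.
    by move: (n * _)%N (stat _) (stat _) => B x y; lia.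
  exists ([seq ((-1) ^+ s.1 * t.1, t.2) | t <- F2] ++ F1); split.
    move=> t; rewrite mem_cat => /orP[/mapP[u hu ->]|]; [exact: (hF2 u hu) | exact: (hF1 t)].
  move=> Psi hPsi; rewrite big_cons big_cat big_map hF1' //; congr (_ + _).
  by rewrite hF2' // mulr_sumr; apply: eq_bigr => t _; rewrite mulrA.
case/(_ (behead (pf6 p1 p2 p3 p4 p5 p6)))=> // F [hF hF'].
exists [seq (- t.1, t.2) | t <- F]; split.
  by move=> t /mapP[u hu ->]; apply: (hF u hu).
move=> Psi hPsi; rewrite big_map (proj1 hPsi _ _ hE hperm).
have := proj2 hPsi E' _ _ _ _ _ _ l1 l2 l3 l4 l5 hE'.
rewrite [pf6 _ _ _ _ _ _](_ : _ = head (false, [::]) (pf6 p1 p2 p3 p4 p5 p6) :: behead (pf6 p1 p2 p3 p4 p5 p6)) //.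
rewrite big_cons hF' // expr0 mul1r => /eqP; rewrite addr_eq0 => /eqP->.
by rewrite -sumrN; apply: eq_bigr => t _; rewrite mulNr.
Qed.

End PfaffianClass.

Lemma stat_perm E F : perm_eq E F -> stat E = stat F.
Proof. by move=> h; apply: perm_big. Qed.

Lemma exchange_lt s s1 t t1 :
  (s < s1)%N -> (t < t1)%N -> (s1 * t + s * t1 < s1 * t1 + s * t)%N.
Proof. by nia. Qed.

(** Induction on the edge with the largest first point [s1]: if [L] lacks it, exchanging the
    partners of [s1] and [t1] increases the sum by [exchange_lt] and produces that edge. This is the
    rearrangement inequality inside each of the two colours [kappa]. *)
Lemma rearrangement (kappa : nat -> bool) (L0 L : seq edge) :
  (forall e f, e \in L0 -> f \in L0 -> kappa e.1 = kappa f.1 ->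
     (e.1 < f.1)%N -> (e.2 < f.2)%N) ->
  (forall e, e \in L0 -> kappa e.1 = kappa e.2) ->
  (forall e, e \in L -> kappa e.1 = kappa e.2) ->
  uniq (unzip1 L0) -> uniq (unzip2 L0) ->
  perm_eq (unzip1 L) (unzip1 L0) -> perm_eq (unzip2 L) (unzip2 L0) ->
  perm_eq L L0 \/ (stat L < stat L0)%N.
Proof.
move: {2}(size L0) (leqnn (size L0)) => m.
elim: m L0 L => [|m IH] L0 L hm mono c0 cL u1 u2 p1 p2.
  left; case: L0 hm p1 {mono c0 u1 u2 p2} => // _ p1.
  by case: L p1 {cL} => // e L /perm_size.
case: (altP (L0 =P [::])) => [L00|hne].
  by left; move: p1; rewrite L00; case: L {cL p2} => // e L /perm_size.
have [[s1 t1] he hmax] : exists2 e, e \in L0 & forall f, f \in L0 -> (f.1 <= e.1)%N.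
  elim: L0 hne {hm mono c0 u1 u2 p1 p2} => // e L0 IHL _.
  case: (altP (L0 =P [::])) => [->|/IHL[f hf hfm]].
    by exists e => [|f]; rewrite inE // => /eqP->.
  case: (leqP e.1 f.1) => h.
    by exists f => [|g]; rewrite inE ?hf ?orbT // => /orP[/eqP->//|/hfm].
  exists e => [|g]; rewrite inE ?eqxx // => /orP[/eqP->//|/hfm hg].
  exact: leq_trans hg (ltnW h).
have q0 := perm_to_rem he; set L0' := rem _ _ in q0.
have in0 e : e \in L0' -> e \in L0 by move=> h; rewrite (perm_mem q0) inE h orbT.
have sz0 : (size L0' <= m)%N by move: hm; rewrite (perm_size q0).
have uu1 : uniq (s1 :: unzip1 L0') by rewrite -(perm_uniq (perm_map fst q0)).
have uu2 : uniq (t1 :: unzip2 L0') by rewrite -(perm_uniq (perm_map snd q0)).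
have pp1 : perm_eq (unzip1 L) (s1 :: unzip1 L0').
  exact: perm_trans p1 (perm_map fst q0).
have pp2 : perm_eq (unzip2 L) (t1 :: unzip2 L0').
  exact: perm_trans p2 (perm_map snd q0).
have hstat0 : stat L0 = (s1 * t1 + stat L0')%N.
  by rewrite (stat_perm q0) /stat big_cons.
case: (boolP ((s1, t1) \in L)) => hL.
  have q := perm_to_rem hL; set L' := rem _ _ in q.
  have inL e : e \in L' -> e \in L by move=> h; rewrite (perm_mem q) inE h orbT.
  have r1 : perm_eq (unzip1 L') (unzip1 L0').
    rewrite -(perm_cons s1); apply: perm_trans pp1.
    by rewrite perm_sym; apply: (perm_map fst q).
  have r2 : perm_eq (unzip2 L') (unzip2 L0').
    rewrite -(perm_cons t1); apply: perm_trans pp2.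
    by rewrite perm_sym; apply: (perm_map snd q).
  case: (IH L0' L') => //.
  - by move=> e f /in0 h1 /in0 h2; apply: mono.
  - by move=> e /in0; apply: c0.
  - by move=> e /inL; apply: cL.
  - by case/andP: uu1.
  - by case/andP: uu2.
  - move=> h; left; apply: (perm_trans q); rewrite perm_sym.
    by apply: (perm_trans q0); rewrite perm_cons perm_sym.
  - move=> h; right; rewrite hstat0 (stat_perm q) /stat big_cons ltn_add2l.
    exact: h.
right.
have /mapP[[s1' t] ht /= es1] : s1 \in unzip1 L by rewrite (perm_mem pp1) mem_head.
subst s1'.
have /mapP[[s t1'] hs /= et1] : t1 \in unzip2 L by rewrite (perm_mem pp2) mem_head.
subst t1'.
have q1 := perm_to_rem ht.
have hs' : (s, t1) \in rem (s1, t) L.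
  have := perm_mem q1 (s, t1); rewrite hs inE => /esym/orP[/eqP[e1 e2]|//].
  by move: hL; rewrite e2 ht.
have q2 := perm_to_rem hs'; set L' := rem _ (rem _ _) in q2.
have q : perm_eq L ((s1, t) :: (s, t1) :: L').
  by apply: (perm_trans q1); rewrite perm_cons.
have inL e : e \in L' -> e \in L by move=> h; rewrite (perm_mem q) !inE h !orbT.
have ss : (s < s1)%N.
  rewrite ltn_neqAle; apply/andP; split.
    have : uniq (unzip1 L) by rewrite (perm_uniq pp1).
    rewrite (perm_uniq (perm_map fst q)) /= inE negb_or => /andP[/andP[h _] _].
    by rewrite eq_sym.
  have : s \in unzip1 L0 by rewrite -(perm_mem p1); apply/mapP; exists (s, t1).
  by case/mapP=> e /hmax h ->.
have tt : (t < t1)%N.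
  have : t \in unzip2 L0 by rewrite -(perm_mem p2); apply/mapP; exists (s1, t).
  case/mapP=> [[s' t'] he' /= et]; subst t'.
  apply: (mono _ _ he' he) => /=.
    by rewrite (c0 _ he') -(cL _ ht).
  rewrite ltn_neqAle (hmax _ he') andbT; apply/eqP => es; subst s'.
  have := perm_mem q0 (s1, t); rewrite he' inE => /esym/orP[/eqP[e]|h].
    by move: hL; rewrite -e ht.
  by case/andP: uu1 => /mapP[]; exists (s1, t).
have r1 : perm_eq (unzip1 ((s, t) :: L')) (unzip1 L0').
  rewrite -(perm_cons s1); apply: perm_trans pp1.
  by rewrite perm_sym; apply: (perm_map fst q).
have r2 : perm_eq (unzip2 ((s, t) :: L')) (unzip2 L0').
  rewrite -(perm_cons t1); apply: perm_trans pp2.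
  rewrite perm_sym; apply: (perm_trans (perm_map snd q)) => /=.
  by rewrite (perm_catCA [:: t] [:: t1]).
have hst : (stat ((s, t) :: L') <= stat L0')%N.
  case: (IH L0' ((s, t) :: L')) => //.
  - by move=> e f /in0 h1 /in0 h2; apply: mono.
  - by move=> e /in0; apply: c0.
  - move=> e; rewrite inE => /orP[/eqP-> /=|/inL]; last exact: cL.
    by rewrite (cL _ hs) /= -(cL _ ht) /= (c0 _ he).
  - by case/andP: uu1.
  - by case/andP: uu2.
  - by move=> h; rewrite (stat_perm h).
  - exact: ltnW.
have hsw := exchange_lt ss tt.
have -> : stat L = (s1 * t + s * t1 + stat L')%N.
  by rewrite (stat_perm q) /stat !big_cons addnA.
have est : stat ((s, t) :: L') = (s * t + stat L')%N by rewrite /stat big_cons.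
rewrite hstat0; apply: leq_trans (_ : (s1 * t1 + s * t + stat L' <= _)%N).
  by rewrite ltn_add2r.
by rewrite -addnA leq_add2l -est.
Qed.

(** * Pairings of vectors in dimension four: all relations come from Pfaffians *)

Section SecondFundamental.
Variable K : comNzRingType.

Definition symp_dot (u w : 'I_4 -> K) : K :=
  u (@Ordinal 4 2 isT) * w (@Ordinal 4 0 isT) + u (@Ordinal 4 3 isT) * w (@Ordinal 4 1 isT)
  - u (@Ordinal 4 0 isT) * w (@Ordinal 4 2 isT) - u (@Ordinal 4 1 isT) * w (@Ordinal 4 3 isT).

Definition eval_matching (v : nat -> 'I_4 -> K) (E : seq edge) : K :=
  \prod_(e <- E) symp_dot (v e.1) (v e.2).

Lemma symp_dotC u w : symp_dot u w = - symp_dot w u.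
Proof. rewrite /symp_dot; ring. Qed.

(* Five vectors in dimension four: Cramer's rule, the determinants being written as Pfaffians. *)
Lemma pfaffian_cramer (a b c d e : 'I_4 -> K) (k : 'I_4) :
  let pf x y z t := symp_dot x y * symp_dot z t - symp_dot x z * symp_dot y t
                    + symp_dot x t * symp_dot y z in
  a k * pf b c d e - b k * pf a c d e + c k * pf a b d e - d k * pf a b c e
  + e k * pf a b c d = 0.
Proof.
case: k => -[|[|[|[|//]]]] hk; rewrite (bool_irrelevance hk isT) /symp_dot; ring.
Qed.

(** Expansion along [a]: the coordinates of [a] weight the four coordinates of the Cramer relation
    between the other five vectors. *)
Lemma symp_dot_pf6 (a b c d e f : 'I_4 -> K) : let s := symp_dot in
  s a f * s b e * s c d - s a f * s b d * s c e + s a f * s b c * s d e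
  - s a e * s b f * s c d + s a e * s b d * s c f - s a e * s b c * s d f
  + s a d * s b f * s c e - s a d * s b e * s c f + s a d * s b c * s e f
  - s a c * s b f * s d e + s a c * s b e * s d f - s a c * s b d * s e f
  + s a b * s c f * s d e - s a b * s c e * s d f + s a b * s c d * s e f = 0.
Proof.
move=> s.
have h k := pfaffian_cramer b c d e f k; cbv zeta in h; rewrite -/s in h.
have hs : forall x, s a x = a (@Ordinal 4 2 isT) * x (@Ordinal 4 0 isT)
  + a (@Ordinal 4 3 isT) * x (@Ordinal 4 1 isT) - a (@Ordinal 4 0 isT) * x (@Ordinal 4 2 isT)
  - a (@Ordinal 4 1 isT) * x (@Ordinal 4 3 isT) by [].
rewrite !hs.
have := h (@Ordinal 4 0 isT); have := h (@Ordinal 4 1 isT).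
have := h (@Ordinal 4 2 isT); have := h (@Ordinal 4 3 isT) => h3 h2 h1 h0.
move: (s b c) (s b d) (s b e) (s b f) (s c d) (s c e) (s c f) (s d e) (s d f) (s e f) h0 h1 h2 h3.
move=> x1 x2 x3 x4 x5 x6 x7 x8 x9 x10 h0 h1 h2 h3.
match type of h0 with ?L0 = _ => match type of h1 with ?L1 = _ =>
match type of h2 with ?L2 = _ => match type of h3 with ?L3 = _ =>
  transitivity (a (@Ordinal 4 2 isT) * L0 + a (@Ordinal 4 3 isT) * L1
    - a (@Ordinal 4 0 isT) * L2 - a (@Ordinal 4 1 isT) * L3) end end end end.
  ring.
by rewrite h0 h1 h2 h3 !mulr0 !subr0 addr0.
Qed.

Lemma eval_matching_pfaffian n v : pfaffian_functional n (eval_matching v).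
Proof.
split=> [E E' _ h|E p1 p2 p3 p4 p5 p6 _ _ _ _ _ _]; first exact: perm_big.
have -> : \sum_(s <- pf6 p1 p2 p3 p4 p5 p6) (-1) ^+ s.1 * eval_matching v (s.2 ++ E)
  = (\sum_(s <- pf6 p1 p2 p3 p4 p5 p6) (-1) ^+ s.1 * eval_matching v s.2) * eval_matching v E.
  rewrite mulr_suml; apply: eq_bigr => s _.
  by rewrite /eval_matching big_cat mulrA.
rewrite [X in X * _](_ : _ = 0) ?mul0r // /pf6 /eval_matching !big_cons !big_nil /=.
rewrite -[RHS](symp_dot_pf6 (v p1) (v p2) (v p3) (v p4) (v p5) (v p6)) /=.
rewrite !expr0 !expr1; ring.
Qed.

Section Extremal.
Variables (n : nat) (E0 : seq edge).
Hypotheses (hE0 : matching n E0) (h3 : ~~ has_3nesting E0).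

(* In a matching without 3-nestings, two nested edges have different values of
   [kappa]; hence [E0] is extremal in the sense of [rearrangement]. *)
Let deep (e : edge) := has (fun f => nested f e) E0.
Let opener p := p \in unzip1 E0.
Let kappa p := has (fun e : edge => ((p == e.1) || (p == e.2)) && deep e) E0.

(** Dimension four consists of two hyperbolic planes, one for each value of [kappa]; in each of them
    openers receive one basis vector and closers the other. A pairing is then nonzero only between
    an opener and a closer of equal [kappa]. *)
Definition extremal_vectors (p : nat) (k : 'I_4) : K :=
  ((k : nat) == (if opener p then 2 else 0) + kappa p)%N%:R.

Let points_unzip E : perm_eq (points E) (unzip1 E ++ unzip2 E).
Proof.
elim: E => //= e E IH; rewrite perm_cons perm_sym.
apply: (perm_trans (y := e.2 :: unzip1 E ++ unzip2 E)); last by rewrite perm_cons perm_sym.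
by rewrite (perm_catCA (unzip1 E) [:: e.2] (unzip2 E)).
Qed.

Let uniq0 : uniq (unzip1 E0 ++ unzip2 E0).
Proof.
rewrite -(perm_uniq (points_unzip E0)); case/andP: hE0 => h _.
by rewrite (perm_uniq h) iota_uniq.
Qed.

Let uniq_fst e f : e \in E0 -> f \in E0 -> e.1 = f.1 -> e = f.
Proof.
have : uniq (unzip1 E0) by move: uniq0; rewrite cat_uniq => /and3P[].
elim: E0 => // g E IH /= /andP[ng u]; rewrite !inE.
move=> /orP[/eqP->|he] /orP[/eqP->|hf] // h.
- by case/negP: ng; apply/mapP; exists f.
- by case/negP: ng; apply/mapP; exists e.
- exact: IH.
Qed.

Let uniq_snd e f : e \in E0 -> f \in E0 -> e.2 = f.2 -> e = f.
Proof.
have : uniq (unzip2 E0) by move: uniq0; rewrite cat_uniq => /and3P[].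
elim: E0 => // g E IH /= /andP[ng u]; rewrite !inE.
move=> /orP[/eqP->|he] /orP[/eqP->|hf] // h.
- by case/negP: ng; apply/mapP; exists f.
- by case/negP: ng; apply/mapP; exists e.
- exact: IH.
Qed.

Let fst_neq_snd e f : e \in E0 -> f \in E0 -> e.1 <> f.2.
Proof.
move=> he hf h; move: uniq0; rewrite cat_uniq => /and3P[_ /hasP[]].
exists f.2; first by apply/mapP; exists f.
by rewrite /= -h; apply/mapP; exists e.
Qed.

Let opener_fst e : e \in E0 -> opener e.1.
Proof. by move=> he; apply/mapP; exists e. Qed.

Let opener_snd e : e \in E0 -> opener e.2 = false.
Proof. by move=> he; apply/negP => /mapP[f hf h]; case: (fst_neq_snd hf he). Qed.

Let kappa_fst e : e \in E0 -> kappa e.1 = deep e.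
Proof.
move=> he; apply/hasP/idP => [[f hf /andP[/orP[/eqP h|/eqP h] hd]]|hd].
- by rewrite (uniq_fst he hf h).
- by case: (fst_neq_snd he hf).
- by exists e => //; rewrite eqxx.
Qed.

Let kappa_snd e : e \in E0 -> kappa e.2 = deep e.
Proof.
move=> he; apply/hasP/idP => [[f hf /andP[/orP[/eqP h|/eqP h] hd]]|hd].
- by case: (fst_neq_snd hf he).
- by rewrite (uniq_snd he hf h).
- by exists e => //; rewrite eqxx orbT.
Qed.

Let dot_extremal p q : symp_dot (extremal_vectors p) (extremal_vectors q) =
  if (opener p != opener q) && (kappa p == kappa q) then (-1) ^+ (~~ opener p) else 0.
Proof.
rewrite /symp_dot /extremal_vectors /=.
case: (opener p); case: (opener q); case: (kappa p); case: (kappa q) => /=; ring.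
Qed.

Lemma eval_extremal_self : eval_matching extremal_vectors E0 = 1.
Proof.
rewrite /eval_matching big_seq big1 // => e he.
by rewrite dot_extremal opener_fst // opener_snd // kappa_fst // kappa_snd // eqxx.
Qed.

(** Triangularity: a matching with nonzero value joins openers of [E0] to closers of [E0] of the
    same [kappa], and [E0] is increasing in each such class, so [rearrangement] applies. *)
Lemma eval_extremal E : matching n E ->
  [\/ eval_matching extremal_vectors E = 0, perm_eq E E0 | (stat E < stat E0)%N].
Proof.
move=> hE.
case: (boolP (all (fun e => (opener e.1 != opener e.2) && (kappa e.1 == kappa e.2)) E)); last first.
  move=> /allPn[e he hn]; apply: Or31; rewrite /eval_matching (perm_big _ (perm_to_rem he)).
  by rewrite big_cons dot_extremal (negbTE hn) /= mul0r.
move=> /allP hall.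
(* Edges of [E] may run from a closer of [E0] to an opener; turning these is harmless because [stat]
   is symmetric in the two ends. *)
pose turn (e : edge) := if opener e.1 then e else (e.2, e.1).
pose L := map turn E.
have hL e : e \in L -> [/\ opener e.1, opener e.2 = false & kappa e.1 = kappa e.2].
  move=> /mapP[f /hall /andP[h1 /eqP h2] ->]; rewrite /turn.
  case ho : (opener f.1) => /=; first by split=> //; move: h1; rewrite ho; case: opener.
  by split=> //; move: h1; rewrite ho; case: opener.
have stL : stat L = stat E.
  rewrite /stat big_map; apply: eq_bigr => e _; rewrite /turn.
  by case: ifP => //= _; rewrite mulnC.
have ptL : perm_eq (points L) (points E).
  rewrite /L; elim: (E) => //= e E' IH; rewrite /turn; case: (opener e.1) => /=.
    by rewrite !perm_cons.
  rewrite (perm_catCA [:: e.2] [:: e.1]) /= !perm_cons; exact: IH.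
have ptE : perm_eq (points E) (points E0).
  by case/andP: hE => h _; case/andP: hE0 => h' _; rewrite (permPl h) perm_sym.
have hp : perm_eq (unzip1 L ++ unzip2 L) (unzip1 E0 ++ unzip2 E0).
  rewrite perm_sym; apply: perm_trans (points_unzip L).
  rewrite perm_sym; apply: perm_trans (points_unzip E0).
  exact: perm_trans ptL ptE.
have f1 : [seq p <- unzip1 L | opener p] = unzip1 L.
  by apply/all_filterP/allP => p /mapP[e /hL[h _ _] ->].
have f2 : [seq p <- unzip2 L | opener p] = [::].
  rewrite -(filter_pred0 (unzip2 L)); apply: eq_in_filter => p /mapP[e /hL[_ h _] ->].
  by rewrite h.
have f3 : [seq p <- unzip1 E0 | opener p] = unzip1 E0.
  by apply/all_filterP/allP => p.
have f4 : [seq p <- unzip2 E0 | opener p] = [::].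
  rewrite -(filter_pred0 (unzip2 E0)); apply: eq_in_filter => p /mapP[e he ->].
  by rewrite opener_snd.
have hp1 : perm_eq (unzip1 L) (unzip1 E0).
  by have := perm_filter opener hp; rewrite !filter_cat f1 f2 f3 f4 !cats0.
have hp2 : perm_eq (unzip2 L) (unzip2 E0).
  by rewrite -(perm_cat2l (unzip1 L)) (permPl hp) perm_cat2r perm_sym.
have [||e /hL[]|||hperm|] := @rearrangement kappa E0 L _ _ _ _ _ hp1 hp2 => //.
- move=> e f he hf; rewrite !kappa_fst // => hk hlt.
  rewrite ltnNge leq_eqVlt; apply/negP => /orP[/eqP hh|hh].
    by have := uniq_snd hf he hh => ee; move: hlt; rewrite ee ltnn.
  have nef : nested e f by rewrite /nested hlt hh.
  have : deep e by rewrite hk; apply/hasP; exists e.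
  case/hasP=> g hg nge; case/negP: h3.
  by apply/hasP; exists g => //; apply/hasP; exists e => //; rewrite nge; apply/hasP; exists f.
- by move=> e he; rewrite kappa_fst ?kappa_snd.
- by move: uniq0; rewrite cat_uniq => /and3P[].
- by move: uniq0; rewrite cat_uniq => /and3P[].
(* Both [E] and [E0] are oriented, so no edge can have been turned. *)
- apply: Or32; suff <- : L = E by [].
  rewrite /L -[RHS]map_id; apply/eq_in_map => e he; rewrite /turn; case: ifP => // ho.
  have he1 : (e.1 < e.2)%N by case/andP: hE => _ /allP /(_ _ he).
  have : turn e \in E0 by rewrite -(perm_mem hperm); apply: map_f.
  rewrite /turn ho => hee.
  have /= : ((e.2, e.1).1 < (e.2, e.1).2)%N by case/andP: hE0 => _ /allP /(_ _ hee).
  by move=> h; have := ltn_trans he1 h; rewrite ltnn.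
- by rewrite stL; apply: Or33.
Qed.

End Extremal.

(** At the extremal vectors of a matching of least [stat], every other matching of the sum vanishes.
    Copies of that matching up to the order of edges are grouped first, and their total coefficient
    is then 0. *)
Lemma nonnesting_independent n (F : seq (K * seq edge)) :
  (forall t, t \in F -> matching n t.2 && ~~ has_3nesting t.2) ->
  (forall v, \sum_(t <- F) t.1 * eval_matching v t.2 = 0) ->
  forall Psi : seq edge -> K, pfaffian_functional n Psi ->
  \sum_(t <- F) t.1 * Psi t.2 = 0.
Proof.
move=> hF hv Psi hPsi; have [hinv _] := hPsi.
move: {2}(size F) (leqnn (size F)) => m; elim: m F hF hv => [|m IH] F hF hv hm.
  by case: F hm {hF hv} => // _; rewrite big_nil.
case: (altP (F =P [::])) => [->|hne]; first by rewrite big_nil.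
have [t0 ht0 hmin] : exists2 t0, t0 \in F & forall t, t \in F -> (stat t0.2 <= stat t.2)%N.
  elim: F hne {hm hF hv} => // e F IHF _.
  case: (altP (F =P [::])) => [->|/IHF[f hf hfm]].
    by exists e => [|f]; rewrite inE // => /eqP->.
  case: (leqP (stat f.2) (stat e.2)) => h.
    by exists f => [|g]; rewrite inE ?hf ?orbT // => /orP[/eqP->//|/hfm].
  exists e => [|g]; rewrite inE ?eqxx // => /orP[/eqP->//|/hfm hg].
  exact: leq_trans (ltnW h) hg.
have /andP[m0 n0] := hF _ ht0.
have split_sum (G : seq edge -> K) :
    (forall E, matching n E -> perm_eq E t0.2 -> G E = G t0.2) ->
    \sum_(t <- F) t.1 * G t.2 = (\sum_(t <- F | perm_eq t.2 t0.2) t.1) * G t0.2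
      + \sum_(t <- [seq t <- F | ~~ perm_eq t.2 t0.2]) t.1 * G t.2.
  move=> hG; rewrite (bigID (fun t => perm_eq t.2 t0.2)) /= big_filter; congr (_ + _).
  rewrite mulr_suml big_seq_cond [RHS]big_seq_cond; apply: eq_bigr => t /andP[ht hp].
  by rewrite hG //; case/andP: (hF _ ht).
have ev_inv v E : perm_eq E t0.2 -> eval_matching v E = eval_matching v t0.2.
  by move=> h; apply: perm_big.
have c0 : \sum_(t <- F | perm_eq t.2 t0.2) t.1 = 0.
  have := hv (extremal_vectors t0.2).
  rewrite split_sum; last by move=> E _; apply: ev_inv.
  have -> : \sum_(t <- [seq t <- F | ~~ perm_eq t.2 t0.2])
      t.1 * eval_matching (extremal_vectors t0.2) t.2 = 0.
    rewrite big_seq big1 // => t; rewrite mem_filter => /andP[hp ht].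
    have /andP[mt _] := hF _ ht.
    have [->|h|h] := eval_extremal m0 n0 mt; first by rewrite mulr0.
      by rewrite h in hp.
    by have := hmin _ ht; rewrite leqNgt h.
  by rewrite (eval_extremal_self m0) mulr1 addr0.
rewrite split_sum ?c0 ?mul0r ?add0r; last by move=> E hE hp; apply: (hinv _ _ hE).
apply: IH.
- by move=> t; rewrite mem_filter => /andP[_]; apply: hF.
- by move=> v; have := hv v; rewrite split_sum ?c0 ?mul0r ?add0r // => E _; apply: ev_inv.
- rewrite size_filter -ltnS; apply: leq_trans hm.
  rewrite -(count_predC (fun t => perm_eq t.2 t0.2) F) addnC -addn1 leq_add2l.
  by rewrite -has_count; apply/hasP; exists t0.
Qed.

(** Straightening reduces every combination to independent matchings, so the Pfaffian relations span
    all relations between products of pairings. *)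
Theorem matching_sft n (F : seq (K * seq edge)) :
  (forall t, t \in F -> matching n t.2) ->
  (forall v, \sum_(t <- F) t.1 * eval_matching v t.2 = 0) ->
  forall Psi : seq edge -> K, pfaffian_functional n Psi ->
  \sum_(t <- F) t.1 * Psi t.2 = 0.
Proof.
move=> hF hv Psi hPsi.
have [G [hG hG']] : exists G : seq (K * seq edge),
    (forall t, t \in G -> matching n t.2 && ~~ has_3nesting t.2) /\
    forall Psi, pfaffian_functional n Psi ->
      \sum_(t <- F) t.1 * Psi t.2 = \sum_(t <- G) t.1 * Psi t.2.
  elim: F hF {hv} => [|t F IH] hF.
    by exists [::]; split=> // P _; rewrite !big_nil.
  have [|G [h1 h2]] := IH; first by move=> u hu; apply: hF; rewrite inE hu orbT.
  have [G' [h1' h2']] := straightening K (hF t (mem_head _ _)).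
  exists ([seq (t.1 * u.1, u.2) | u <- G'] ++ G); split.
    move=> u; rewrite mem_cat => /orP[/mapP[w hw ->]|]; [exact: (h1' w hw)|exact: (h1 u)].
  move=> P hP; rewrite big_cons big_cat big_map h2 // h2' //; congr (_ + _).
  by rewrite mulr_sumr; apply: eq_bigr => u _; rewrite mulrA.
rewrite hG' //; apply: nonnesting_independent hG _ _ hPsi => v.
by rewrite -hG' //; apply: eval_matching_pfaffian.
Qed.

End SecondFundamental.

(** * The functional on matchings attached to a functional on words *)

Definition star_letter (l : letter) : letter := (l.1, ~~ l.2).
Definition star (w : seq letter) : seq letter := rev (map star_letter w).

Lemma star_cat u v : star (u ++ v) = star v ++ star u.
Proof. by rewrite /star map_cat rev_cat. Qed.

Lemma star_letterK : involutive star_letter.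
Proof. by case=> a b; rewrite /star_letter /= negbK. Qed.

Lemma starK : involutive star.
Proof. by move=> w; rewrite /star map_rev revK -map_comp map_id_in // => l _; apply: star_letterK. Qed.

Definition sword : Type := (bool * seq letter)%type.
Definition smul (a b : sword) : sword := (a.1 (+) b.1, a.2 ++ b.2).
Definition sopp (a : sword) : sword := (~~ a.1, a.2).
Definition sstar (a : sword) : sword := (a.1, star a.2).

Lemma smulA a b c : smul a (smul b c) = smul (smul a b) c.
Proof. by rewrite /smul /= addbA catA. Qed.
Lemma smulN a b : smul a (sopp b) = sopp (smul a b).
Proof. by rewrite /smul /sopp /= addbN. Qed.
Lemma sNmul a b : smul (sopp a) b = sopp (smul a b).
Proof. by rewrite /smul /sopp /= addNb. Qed.
Lemma soppK : involutive sopp.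
Proof. by case=> a b; rewrite /sopp /= negbK. Qed.
Lemma sstarK : involutive sstar.
Proof. by case=> a b; rewrite /sstar /= starK. Qed.
Lemma sstarM a b : sstar (smul a b) = smul (sstar b) (sstar a).
Proof. by rewrite /sstar /smul /= star_cat addbC. Qed.
Lemma sstarN a : sstar (sopp a) = sopp (sstar a).
Proof. by []. Qed.

(* A state records, for each free point, the other end of its string and the signed word read along it. *)
Definition state := nat -> nat * sword.

(** Contracting [p] with [q] splices their strings: one reads up to [p], crosses to [q] and goes on.
    The opposite reading crosses from [q] to [p], and the antisymmetry of the form gives the
    [sopp]. *)
Definition join (p q : nat) (st : state) : state := fun a =>
  if a == (st p).1 then ((st q).1, smul (st a).2 (st q).2)
  else if a == (st q).1 then ((st p).1, sopp (smul (st a).2 (st p).2))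
  else st a.

Definition flip (a : nat) (st : state) : state := fun b =>
  if (b == a) || (b == (st a).1) then ((st b).1, sopp (st b).2) else st b.

(** A string read from its other end is starred and changes sign, because the adjoint of the
    rank-one matrix u v^T J is minus v u^T J. *)
Definition wf_state (st : state) (E : seq edge) : Prop :=
  uniq (points E) /\
  forall a, a \in points E ->
    [/\ (st a).1 \in points E, (st a).1 <> a, (st (st a).1).1 = a,
        (st (st a).1).2 = sopp (sstar (st a).2) & (st a).2.2 != [::]].

Lemma points_cons p q E : points ((p, q) :: E) = [:: p, q & points E].
Proof. by []. Qed.

Lemma wf_join st p q E : wf_state st ((p, q) :: E) -> (st p).1 <> q ->
  wf_state (join p q st) E.
Proof.
move=> [u h] hpq; rewrite points_cons in u h; have /and3P[np nq uE] := u.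
have [p1 p2 p3 p4 p5] := h p (mem_head _ _).
have [|q1 q2 q3 q4 q5] := h q; first by rewrite !inE eqxx orbT.
have neq : p <> q by move=> e; move: np; rewrite e mem_head.
have epE : (st p).1 \in points E.
  by move: p1; rewrite !inE => /or3P[/eqP|/eqP|].
have eqE : (st q).1 \in points E.
  by move: q1; rewrite !inE => /or3P[/eqP e|/eqP|] //; move: hpq; rewrite -e q3.
split=> // a ha.
have [|a1 a2 a3 a4 a5] := h a; first by rewrite !inE ha !orbT.
have nap : a <> p by move=> e; move: np; rewrite -e inE ha orbT.
have naq : a <> q by move=> e; move: nq; rewrite -e ha.
have nee : (st q).1 <> (st p).1 by move=> e; apply: neq; rewrite -p3 -q3 e.
rewrite /join; case: (altP (a =P (st p).1)) => [ea|ha1].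
  subst a; split=> //=.
  - by rewrite (negbTE (introN eqP nee)) eqxx.
  - rewrite (negbTE (introN eqP nee)) eqxx /= sstarM q4 p4 sNmul.
    by rewrite sstarN sstarK smulN.
  - by rewrite /smul /= ; case: (st (st p).1).2.2 a5.
case: (altP (a =P (st q).1)) => [ea|ha2].
  subst a; split=> //=.
  - by move/esym.
  - by rewrite eqxx.
  - rewrite eqxx /= sstarN soppK sstarM p4 q4 sNmul.
    by rewrite sstarN sstarK smulN.
  - by rewrite /smul /=; case: (st (st q).1).2.2 a5.
have nap' : (st a).1 <> p by move=> e; move: ha1; rewrite -e a3 eqxx.
have naq' : (st a).1 <> q by move=> e; move: ha2; rewrite -e a3 eqxx.
have e1 : ((st a).1 == (st p).1) = false.
  by apply/eqP => e; apply: nap; rewrite -a3 e p3.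
have e2 : ((st a).1 == (st q).1) = false.
  by apply/eqP => e; apply: naq; rewrite -a3 e q3.
split=> //; rewrite ?e1 ?e2 //.
by move: a1; rewrite !inE => /or3P[/eqP|/eqP|].
Qed.

(** * The value of a matching: gluing strings into one cycle *)

Section CycleFunctional.
Variables (K : comNzRingType) (Lam : seq letter -> K).
Hypothesis Lam_cyc : forall u v, Lam (u ++ v) = Lam (v ++ u).
Hypothesis Lam_star : forall w, Lam (star w) = Lam w.
Hypothesis Lam_sym3 : forall u v w, u != [::] -> v != [::] -> w != [::] ->
  Lam (u ++ v ++ w) + Lam (u ++ v ++ star w) + Lam (u ++ star v ++ w)
  + Lam (u ++ star v ++ star w) + Lam (star u ++ v ++ w) + Lam (star u ++ v ++ star w)
  + Lam (star u ++ star v ++ w) + Lam (star u ++ star v ++ star w) = 0.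

Definition slam (a : sword) : K := (-1) ^+ a.1 * Lam a.2.

(** Only the linear part of a product of traces counts: a cycle closed before the last edge signals
    a second trace and gives 0. *)
Fixpoint cycle_value (st : state) (E : seq edge) : K :=
  if E is (p, q) :: E' then
    if (st p).1 == q then (if E' is [::] then slam (st q).2 else 0)
    else cycle_value (join p q st) E'
  else 0.

Lemma slamN a : slam (sopp a) = - slam a.
Proof. by rewrite /slam /= signrN mulNr. Qed.
Lemma slamC a b : slam (smul a b) = slam (smul b a).
Proof. by rewrite /slam /= addbC Lam_cyc. Qed.
Lemma slam_star a : slam (sstar a) = slam a.
Proof. by rewrite /slam /= Lam_star. Qed.

Lemma cycle_value_ext st st' E : {in points E, st =1 st'} ->
  cycle_value st E = cycle_value st' E.
Proof.
elim: E st st' => [//|[p q] E IH] st st' h /=.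
have hp : st p = st' p by apply: h; rewrite inE eqxx.
have hq : st q = st' q by apply: h; rewrite !inE eqxx orbT.
rewrite hp hq; case: ifP => // _; apply: IH => a ha.
by rewrite /join hp hq h // !inE ha !orbT.
Qed.

(** The final cycle traverses each string exactly once, so the sign of one string passes to the
    value. *)
Lemma cycle_value_flip st E a : wf_state st E -> a \in points E ->
  cycle_value (flip a st) E = - cycle_value st E.
Proof.
elim: E st a => [//|[p q] E IH] st a hw ha /=.
have [u h] := hw; rewrite ?points_cons in u h; have /and3P[np nq uE] := u.
have [p1 p2 p3 p4 p5] := h p (mem_head _ _).
have [|q1 q2 q3 q4 q5] := h q; first by rewrite !inE eqxx orbT.
have [a1 a2 a3 a4 a5] := h a ha.
have f1 x : (flip a st x).1 = (st x).1 by rewrite /flip; case: ifP.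
rewrite f1; case: (altP ((st p).1 =P q)) => hpq.
  case: E {IH} hw ha u h np nq uE p1 q1 a1 => [|e E] hw ha u h np nq uE p1 q1 a1;
    last by rewrite oppr0.
  rewrite -slamN; congr slam; rewrite /flip ifT //.
  move: ha; rewrite !inE => /orP[]/eqP->; last by rewrite eqxx.
  by rewrite hpq eqxx orbT.
have hwj := wf_join hw (elimN eqP hpq).
have epE : (st p).1 \in points E.
  by move: p1; rewrite !inE => /or3P[/eqP|/eqP e|] //; rewrite e eqxx in hpq.
have eqE : (st q).1 \in points E.
  move: q1; rewrite !inE => /or3P[/eqP e|/eqP|] //.
  by move: hpq; rewrite -e q3 eqxx.
have nee : (st q).1 <> (st p).1.
  by move=> e; move: np; rewrite -p3 -e q3 mem_head.
have nee' : ((st q).1 == (st p).1) = false by apply/eqP.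
have nee'' : ((st p).1 == (st q).1) = false by apply/eqP => /esym.
have nbE b : b \in points E -> b <> p /\ b <> q.
  by move=> hb; split=> e; [move: np | move: nq]; rewrite -e ?inE hb ?orbT.
have eqa b x : b \in points E -> x \in [:: p, q & points E] ->
    ((st b).1 == x) = (b == (st x).1).
  move=> hb hx; have [|_ _ b3 _ _] := h b; first by rewrite /= !inE hb !orbT.
  have [_ _ x3 _ _] := h x hx.
  by apply/eqP/eqP => [<-|->].
have hpin : p \in [:: p, q & points E] by rewrite mem_head.
have hqin : q \in [:: p, q & points E] by rewrite !inE eqxx orbT.
have hpa : (p == (st a).1) = ((st p).1 == a).
  by apply/eqP/eqP => [->|<-].
have hqa : (q == (st a).1) = ((st q).1 == a).
  by apply/eqP/eqP => [->|<-].
case hp : ((p == a) || (p == (st a).1)).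
  have hq : (q == a) || (q == (st a).1) = false.
    apply/negP; rewrite hqa; move: hp; rewrite hpa => /orP[]/eqP e; subst a => /orP[]/eqP e.
    - by move: np; rewrite -e mem_head.
    - by move: hpq; rewrite -e q3 eqxx.
    - by move: hpq; rewrite e eqxx.
    - by apply: nee.
  rewrite -(IH _ (st p).1 hwj) //; apply: cycle_value_ext => b hb.
  have [nbp nbq] := nbE b hb.
  have hba : (b == a) || (b == (st a).1) = (b == (st p).1).
    move: hp => /orP[/eqP <-|]; first by rewrite (negbTE (introN eqP nbp)).
    rewrite hpa => /eqP e; rewrite -e p3 (negbTE (introN eqP nbp)) orbF.
    by [].
  rewrite /join /flip /= hp hq /= hba eqxx /=.
  case: (altP (b =P (st p).1)) => [->|hb1] /=; first by rewrite ?eqxx /= ?sNmul.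
  case: (altP (b =P (st q).1)) => [->|hb2] /=; first by rewrite ?eqxx ?orbT /= ?smulN.
  by rewrite ?(negbTE hb2).
case hq : ((q == a) || (q == (st a).1)).
  rewrite -(IH _ (st p).1 hwj) //; apply: cycle_value_ext => b hb.
  have [nbp nbq] := nbE b hb.
  have hba : (b == a) || (b == (st a).1) = (b == (st q).1).
    move: hq => /orP[/eqP <-|]; first by rewrite (negbTE (introN eqP nbq)).
    rewrite hqa => /eqP e; rewrite -e q3 (negbTE (introN eqP nbq)) orbF.
    by [].
  rewrite /join /flip /= hp hq /= hba eqxx /=.
  case: (altP (b =P (st p).1)) => [->|hb1] /=.
    by rewrite ?nee'' ?eqxx /= ?smulN.
  case: (altP (b =P (st q).1)) => [->|hb2] /=; first by rewrite ?eqxx ?orbT /= ?sNmul.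
  by rewrite ?(negbTE hb2).
move/negbT: hp; rewrite negb_or hpa => /andP[hp1 hp2].
move/negbT: hq; rewrite negb_or hqa => /andP[hq1 hq2].
have haE : a \in points E.
  by move: ha; rewrite /= !inE => /or3P[/eqP e|/eqP e|] //;
     [move: hp1 | move: hq1]; rewrite e eqxx.
rewrite -(IH _ a hwj) //; apply: cycle_value_ext => b hb.
rewrite /join /flip /= hpa hqa (negbTE hp1) (negbTE hp2) (negbTE hq1) (negbTE hq2) /=.
rewrite ![a == _]eq_sym (negbTE hp2) (negbTE hq2).
case: (altP (b =P (st p).1)) => [->|hb1] /=.
  rewrite (negbTE hp2) /=.
  case: (altP ((st p).1 =P (st a).1)) => // e.
  by move: hp1; rewrite -p3 e a3 eqxx.
case: (altP (b =P (st q).1)) => [->|hb2] /=; last by [].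
rewrite (negbTE hq2) /=.
case: (altP ((st q).1 =P (st a).1)) => // e.
by move: hq1; rewrite -q3 e a3 eqxx.
Qed.

(** An edge that closes nothing creates a string, which turning negates, so [cycle_value_flip]
    applies; for the closing edge the cycle is read backwards and invariance of [Lam] under [star]
    is used. *)
Lemma cycle_value_turn st p q E : wf_state st ((p, q) :: E) ->
  cycle_value st ((q, p) :: E) = - cycle_value st ((p, q) :: E).
Proof.
move=> hw /=; have [u h] := hw; rewrite ?points_cons in u h; have /and3P[np nq uE] := u.
have [p1 p2 p3 p4 p5] := h p (mem_head _ _).
have [|q1 q2 q3 q4 q5] := h q; first by rewrite !inE eqxx orbT.
case: (altP ((st p).1 =P q)) => hpq.
  rewrite -hpq p3 eqxx; case: E {hw u h np nq uE p1 q1} => [|_ _]; last by rewrite oppr0.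
  by rewrite p4 slamN slam_star opprK.
case: (altP ((st q).1 =P p)) => hqp; first by move: hpq; rewrite -hqp q3 eqxx.
have epE : (st p).1 \in points E.
  by move: p1; rewrite !inE => /or3P[/eqP|/eqP e|] //; rewrite e eqxx in hpq.
rewrite -(cycle_value_flip (wf_join hw (elimN eqP hpq)) epE).
apply: cycle_value_ext => b hb; rewrite /flip /join eqxx /=.
have nee : ((st p).1 == (st q).1) = false.
  by apply/eqP => e; move: np; rewrite -p3 e q3 mem_head.
case: (altP (b =P (st p).1)) => [->|hb1] /=; first by rewrite nee.
by case: (altP (b =P (st q).1)) => [_|hb2] //=; rewrite soppK.
Qed.

Lemma cycle_value_swap st e f E : wf_state st (e :: f :: E) ->
  cycle_value st (e :: f :: E) = cycle_value st (f :: e :: E).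
Proof.
case: e f => p q [r s] hw; have [/= u h] := hw.
have inP x : x \in [:: p; q; r; s] -> x \in [:: p, q, r, s & points E].
  by rewrite !inE => /or4P[]/eqP->; rewrite eqxx ?orbT.
have [p1 p2 p3 p4 p5] := h p (inP p (mem_head _ _)).
have [|q1 q2 q3 q4 q5] := h q; first by apply: inP; rewrite !inE eqxx orbT.
have [|r1 r2 r3 r4 r5] := h r; first by apply: inP; rewrite !inE eqxx !orbT.
have [|s1 s2 s3 s4 s5] := h s; first by apply: inP; rewrite !inE eqxx !orbT.
move: (u) => /= /and5P[]; rewrite !inE !negb_or => /and4P[npq npr nps npE].
move=> /and3P[nqr nqs nqE] /andP[nrs nrE] nsE uE.
have inj x y : x \in [:: p; q; r; s] -> y \in [:: p, q, r, s & points E] -> x != y ->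
    ((st x).1 == (st y).1) = false.
  move=> hx hy hxy; apply/eqP => e.
  have [_ _ x3 _ _] := h x (inP x hx); have [_ _ y3 _ _] := h y hy.
  by move: hxy; rewrite -x3 e y3 eqxx.
have swp x y : x \in [:: p, q, r, s & points E] -> y \in [:: p, q, r, s & points E] ->
    (y == (st x).1) = ((st y).1 == x).
  move=> hx hy; have [_ _ x3 _ _] := h x hx; have [_ _ y3 _ _] := h y hy.
  by apply/eqP/eqP => [->|<-].
have hE x : x \in points E -> x \in [:: p, q, r, s & points E].
  by move=> hx; rewrite !inE hx !orbT.
have hp := inP p (mem_head _ _).
have hq : q \in [:: p, q, r, s & points E] by rewrite !inE eqxx !orbT.
have hr : r \in [:: p, q, r, s & points E] by rewrite !inE eqxx !orbT.
have hs : s \in [:: p, q, r, s & points E] by rewrite !inE eqxx !orbT.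
have nqp : q != p by rewrite eq_sym. have nrp : r != p by rewrite eq_sym.
have nsp : s != p by rewrite eq_sym. have nrq : r != q by rewrite eq_sym.
have nsq : s != q by rewrite eq_sym. have nsr : s != r by rewrite eq_sym.
have ipq := inj p q (mem_head _ _) hq npq.
have ipr := inj p r (mem_head _ _) hr npr.
have ips := inj p s (mem_head _ _) hs nps.
have iqr : ((st q).1 == (st r).1) = false by apply: inj => //; rewrite !inE eqxx orbT.
have iqs : ((st q).1 == (st s).1) = false by apply: inj => //; rewrite !inE eqxx orbT.
have irs : ((st r).1 == (st s).1) = false by apply: inj => //; rewrite !inE eqxx !orbT.
case: (altP ((st p).1 =P q)) => hpq; case: (altP ((st r).1 =P s)) => hrs //.
- have -> : (join r s st p).1 = q.
    rewrite /join (swp r p) // hpq; rewrite (negbTE nqr) (swp s p) // hpq (negbTE nqs).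
    by rewrite hpq.
  rewrite eqxx; case: E {h inP inj swp hE u uE nsE nrE nqE npE hp hq hr hs} p1 q1 r1 s1 hw => // _ _.
  rewrite !inE (negbTE (introN eqP r2)) (negbTE hrs) orbF /= orbF.
  move=> /orP[]/eqP e; first by move: nrq; rewrite -hpq -e r3 eqxx.
  by move: npr; rewrite -p3 hpq -e r3 eqxx.
- have -> : (join p q st r).1 = s.
    rewrite /join (swp p r) // hrs (negbTE nsp) (swp q r) // hrs (negbTE nsq).
    by rewrite hrs.
  rewrite eqxx; case: E {h inP inj swp hE u uE nsE nrE nqE npE hp hq hr hs} p1 q1 r1 s1 hw => // + _ _ _ _.
  rewrite !inE (negbTE (introN eqP p2)) (negbTE hpq) /=.
  move=> /orP[]/eqP e; first by move: nps; rewrite -p3 e hrs eqxx.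
  by move: npr; rewrite -r3 hrs -e p3 eqxx.
have hqp : ((st q).1 == p) = false.
  by apply/eqP => e; move: hpq; rewrite -e q3 eqxx.
have hsr : ((st s).1 == r) = false.
  by apply/eqP => e; move: hrs; rewrite -e s3 eqxx.
have jr : (join p q st r).1 = if (st p).1 == r then (st q).1
    else if (st q).1 == r then (st p).1 else (st r).1.
  by rewrite /join ![r == _]eq_sym; case: ifP => // _; case: ifP.
have jp : (join r s st p).1 = if (st p).1 == r then (st s).1
    else if (st p).1 == s then (st r).1 else (st p).1.
  by rewrite /join (swp r p) // (swp s p) //; case: ifP => // _; case: ifP.
have cl1 : ((join p q st r).1 == s) =
    ((st p).1 == r) && ((st q).1 == s) || ((st q).1 == r) && ((st p).1 == s).
  rewrite jr; case: (altP ((st p).1 =P r)) => e1 /=.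
    by case: (altP ((st q).1 =P r)) => e2 /=; [move: ipq; rewrite e1 e2 eqxx | rewrite orbF].
  by case: (altP ((st q).1 =P r)) => e2 //=; rewrite (negbTE hrs).
have cl2 : ((join r s st p).1 == q) =
    ((st p).1 == r) && ((st q).1 == s) || ((st q).1 == r) && ((st p).1 == s).
  rewrite jp; case: (altP ((st p).1 =P r)) => e1 /=.
    rewrite -(swp q s) // [s == _]eq_sym; case: (altP ((st q).1 =P r)) => e2 /=.
      by move: ipq; rewrite e1 e2 eqxx.
    by rewrite orbF.
  case: (altP ((st p).1 =P s)) => e2 /=; last by rewrite (negbTE hpq) andbF.
  by rewrite andbT -(swp q r) // eq_sym.
(* If the two edges together close a cycle, both values are 0 unless no edge is left, and then the
   two readings differ by a rotation or a star. Otherwise the spliced strings themselves agree. *)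
rewrite cl1 cl2; case: ifP => hcl.
  case: E {h inP inj swp hE u uE nsE nrE nqE npE hp hq hr hs jr jp cl1 cl2} p1 q1 r1 s1 hw => // _ _ _ _ _.
  case/orP: hcl => /andP[/eqP e1 /eqP e2].
    rewrite /join -e1 p3 -e2 q3 eq_sym ipq eqxx eq_sym (negbTE npq) eqxx /=.
    by rewrite p4 q4 sNmul smulN !soppK -slam_star sstarM sstarK slamC.
  rewrite /join -e1 q3 -e2 p3 eqxx eqxx /=.
  by rewrite slamC.
apply: cycle_value_ext => b hb.
have nbp : b != p by apply/eqP => e; move: npE; rewrite -e hb.
have nbq : b != q by apply/eqP => e; move: nqE; rewrite -e hb.
have nbr : b != r by apply/eqP => e; move: nrE; rewrite -e hb.
have nbs : b != s by apply/eqP => e; move: nsE; rewrite -e hb.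
move: hcl.
have d1 : (r == (st p).1) = ((st p).1 == r) by rewrite eq_sym.
have d2 : (s == (st p).1) = ((st p).1 == s) by rewrite eq_sym.
have d3 : (r == (st q).1) = ((st q).1 == r) by rewrite eq_sym.
have d4 : (s == (st q).1) = ((st q).1 == s) by rewrite eq_sym.
have d5 : (p == (st r).1) = ((st p).1 == r) by rewrite swp.
have d6 : (p == (st s).1) = ((st p).1 == s) by rewrite swp.
have d7 : (q == (st r).1) = ((st q).1 == r) by rewrite swp.
have d8 : (q == (st s).1) = ((st q).1 == s) by rewrite swp.
(* Five cases survive: exactly one of the strings at [p] and [q] ends at [r] or [s] (four ways), or
   none does. *)
case c1 : ((st p).1 == r); case c2 : ((st p).1 == s); case c3 : ((st q).1 == r);
  case c4 : ((st q).1 == s) => //= _;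
  rewrite /join d1 d2 d3 d4 d5 d6 d7 d8 c1 c2 c3 c4 /=.
all: try by move: nrs; rewrite -(eqP c1) -(eqP c2) eqxx.
all: try by move: nrs; rewrite -(eqP c3) -(eqP c4) eqxx.
all: try by move: ipq; rewrite (eqP c1) (eqP c3) eqxx.
all: try by move: ipq; rewrite (eqP c2) (eqP c4) eqxx.
{ have x1 : (st r).1 = p by rewrite -(eqP c1) p3.
  rewrite (eqP c1) x1 (negbTE nbp) (negbTE nbr).
  case e2 : (b == (st q).1); case e4 : (b == (st s).1) => //=.
    by move: iqs; rewrite -(eqP e2) -(eqP e4) eqxx.
  all: by rewrite ?smulA ?sNmul ?smulN ?soppK ?smulA ?sNmul ?smulN ?soppK. }
{ have x1 : (st s).1 = p by rewrite -(eqP c2) p3.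
  rewrite (eqP c2) x1 (negbTE nbp) (negbTE nbs).
  case e2 : (b == (st q).1); case e3 : (b == (st r).1) => //=.
    by move: iqr; rewrite -(eqP e2) -(eqP e3) eqxx.
  all: by rewrite ?smulA ?sNmul ?smulN ?soppK ?smulA ?sNmul ?smulN ?soppK. }
{ have x1 : (st r).1 = q by rewrite -(eqP c3) q3.
  rewrite (eqP c3) x1 (negbTE nbq) (negbTE nbr).
  case e1 : (b == (st p).1); case e4 : (b == (st s).1) => //=.
    by move: ips; rewrite -(eqP e1) -(eqP e4) eqxx.
  all: by rewrite ?smulA ?sNmul ?smulN ?soppK ?smulA ?sNmul ?smulN ?soppK. }
{ have x1 : (st s).1 = q by rewrite -(eqP c4) q3.
  rewrite (eqP c4) x1 (negbTE nbq) (negbTE nbs).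
  case e1 : (b == (st p).1); case e3 : (b == (st r).1) => //=.
    by move: ipr; rewrite -(eqP e1) -(eqP e3) eqxx.
  all: by rewrite ?smulA ?sNmul ?smulN ?soppK ?smulA ?sNmul ?smulN ?soppK. }
{ case e1 : (b == (st p).1); case e2 : (b == (st q).1);
    case e3 : (b == (st r).1); case e4 : (b == (st s).1) => //=.
  all: try by move: ipq; rewrite -(eqP e1) -(eqP e2) eqxx.
  all: try by move: ipr; rewrite -(eqP e1) -(eqP e3) eqxx.
  all: try by move: ips; rewrite -(eqP e1) -(eqP e4) eqxx.
  all: try by move: iqr; rewrite -(eqP e2) -(eqP e3) eqxx.
  all: try by move: iqs; rewrite -(eqP e2) -(eqP e4) eqxx.
  all: by move: irs; rewrite -(eqP e3) -(eqP e4) eqxx. }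
Qed.

Lemma wf_perm st E F : perm_eq E F -> wf_state st E -> wf_state st F.
Proof.
move=> h [u hE]; have hp := perm_points h.
split=> [|a]; first by rewrite -(perm_uniq hp).
by rewrite -!(perm_mem hp) => /hE; rewrite (perm_mem hp).
Qed.

Lemma cycle_value_perm st E F : wf_state st E -> perm_eq E F ->
  cycle_value st E = cycle_value st F.
Proof.
have front e E1 E2 st' : wf_state st' (E1 ++ e :: E2) ->
    cycle_value st' (E1 ++ e :: E2) = cycle_value st' (e :: E1 ++ E2).
  elim: E1 st' => [//|[p q] E1 IH] st' hw.
  have hw' : wf_state st' ((p, q) :: e :: E1 ++ E2).
    by apply: wf_perm hw; rewrite perm_cons perm_catC /= perm_cons perm_catC.
  rewrite [RHS](_ : _ = cycle_value st' [:: e, (p, q) & E1 ++ E2]) //.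
  rewrite -(cycle_value_swap hw') /=.
  case: (altP ((st' p).1 =P q)) => hpq; first by case: E1 {IH hw hw'}.
  by apply: IH; apply: wf_join (elimN eqP hpq).
elim: E F st => [|[p q] E IH] F st hw hp.
  by move/perm_size: hp; case: F.
have hin : (p, q) \in F by rewrite -(perm_mem hp) mem_head.
case/splitPr: hin hp => F1 F2 hp.
rewrite front; last exact: wf_perm hp hw.
have hp' : perm_eq E (F1 ++ F2).
  by rewrite -(perm_cons (p, q)); apply: (perm_trans hp); rewrite perm_catC /= perm_cons perm_catC.
rewrite /=; case: (altP ((st p).1 =P q)) => hpq.
  by case: E (F1 ++ F2) hp' {IH hw hp} => [|? ?] [|? ?] // /perm_size.
by apply: IH hp'; apply: wf_join (elimN eqP hpq).
Qed.

(** The terms of [pf6] for arguments in any order. The sum is alternating, so the points may be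
    permuted until the two ends of each string stand side by side. *)
Definition pf_sum (g : nat -> nat -> nat -> nat -> nat -> nat -> K) a b c d e f : K :=
  g a f b e c d - g a f b d c e + g a f b c d e - g a e b f c d + g a e b d c f
  - g a e b c d f + g a d b f c e - g a d b e c f + g a d b c e f - g a c b f d e
  + g a c b e d f - g a c b d e f + g a b c f d e - g a b c e d f + g a b c d e f.

Section PfaffianSum.
Variable g : nat -> nat -> nat -> nat -> nat -> nat -> K.
Hypothesis gN : forall a b c d e f, g b a c d e f = - g a b c d e f.
Hypothesis gS : forall a b c d e f, g c d a b e f = g a b c d e f.
Hypothesis gT : forall a b c d e f, g a b e f c d = g a b c d e f.

Let gN2 a b c d e f : g a b d c e f = - g a b c d e f.
Proof. by rewrite -gS gN gS. Qed.
Let gN3 a b c d e f : g a b c d f e = - g a b c d e f.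
Proof. by rewrite -gT gN2 gT. Qed.
Lemma pf_sum_swap1 a b c d e f : pf_sum g b a c d e f = - pf_sum g a b c d e f.
Proof.
rewrite /pf_sum.
rewrite (gS a e b f c d) (gS a d b f c e) (gS a c b f d e) (gS a f b e c d) (gS a d b e c f)
  (gS a c b e d f) (gS a f b d c e) (gS a e b d c f) (gS a c b d e f) (gS a f b c d e)
  (gS a e b c d f) (gS a d b c e f) (gN a b c f d e) (gN a b c e d f) (gN a b c d e f).
ring.
Qed.
Lemma pf_sum_swap2 a b c d e f : pf_sum g a c b d e f = - pf_sum g a b c d e f.
Proof.
rewrite /pf_sum.
rewrite (gT a f b d c e) (gT a f b e c d) (gN2 a f b c d e) (gT a e b d c f) (gT a e b f c d)
  (gN2 a e b c d f) (gT a d b e c f) (gT a d b f c e) (gN2 a d b c e f).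
ring.
Qed.
Lemma pf_sum_swap3 a b c d e f : pf_sum g a b d c e f = - pf_sum g a b c d e f.
Proof.
rewrite /pf_sum.
rewrite (gN3 a f b e c d) (gN3 a e b f c d) (gT a b c e d f) (gT a b c f d e) (gN2 a b c d e f).
ring.
Qed.
Lemma pf_sum_swap4 a b c d e f : pf_sum g a b c e d f = - pf_sum g a b c d e f.
Proof.
rewrite /pf_sum.
rewrite (gN3 a f b c d e) (gN3 a c b f d e) (gN3 a b c f d e).
ring.
Qed.
Lemma pf_sum_swap5 a b c d e f : pf_sum g a b c d f e = - pf_sum g a b c d e f.
Proof.
rewrite /pf_sum.
rewrite (gN3 a d b c e f) (gN3 a c b d e f) (gN3 a b c d e f).
ring.
Qed.
End PfaffianSum.

Lemma perm_adjacent_swaps (T : eqType) (P : seq T -> Prop) :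
  (forall s1 s2 x y, P (s1 ++ x :: y :: s2) -> P (s1 ++ y :: x :: s2)) ->
  forall s t, perm_eq s t -> P s -> P t.
Proof.
move=> hP.
have front r u x v : P (r ++ u ++ x :: v) -> P (r ++ x :: u ++ v).
  elim/last_ind: u v => [//|u y IH] v; rewrite cat_rcons => h.
  by rewrite -cats1 -catA /=; apply: IH; move: h; rewrite !catA => /hP.
have H : forall t r s, perm_eq s t -> P (r ++ s) -> P (r ++ t).
  elim=> [|x t IH] r s hp; first by move/perm_size/size0nil: hp => ->.
  have hin : x \in s by rewrite (perm_mem hp) mem_head.
  case/splitPr: hin hp => u v hp /front.
  rewrite -!cat_rcons; apply: IH.
  rewrite -(perm_cons x); apply: perm_trans hp.
  by rewrite perm_sym perm_catC /= perm_cons perm_catC.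
by move=> s t; apply: (H t [::] s).
Qed.

Lemma perm_pairs (T : eqType) (c d e f : T) :
  [/\ perm_eq [:: c; d; e; f] [:: c; d; e; f],
     perm_eq [:: c; d; f; e] [:: c; d; e; f],
     perm_eq [:: d; c; e; f] [:: c; d; e; f],
     perm_eq [:: d; c; f; e] [:: c; d; e; f] &
     [/\ perm_eq [:: e; f; c; d] [:: c; d; e; f],
     perm_eq [:: e; f; d; c] [:: c; d; e; f],
     perm_eq [:: f; e; c; d] [:: c; d; e; f] &
     perm_eq [:: f; e; d; c] [:: c; d; e; f]]].
Proof. by split; [| | | |split]; apply/permP => x /=; lia. Qed.

(** Reading a cycle of three strings backwards exchanges its two cyclic orders. *)
Lemma slam_rev3 a b c :
  slam (smul (smul a b) c) = slam (smul (smul (sstar a) (sstar c)) (sstar b)).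
Proof. by rewrite -slam_star !sstarM smulA slamC smulA. Qed.

Lemma slam_sym3 a b c : a.2 != [::] -> b.2 != [::] -> c.2 != [::] ->
  let s x y z := slam (smul (smul x y) z) in
  s a b c + s a b (sstar c) + s a (sstar b) c + s a (sstar b) (sstar c)
  + s (sstar a) b c + s (sstar a) b (sstar c) + s (sstar a) (sstar b) c
  + s (sstar a) (sstar b) (sstar c) = 0.
Proof.
move=> ha hb hc s; rewrite /s /slam /sstar /smul /= -!catA -!mulrDr.
by rewrite Lam_sym3 ?mulr0.
Qed.

Section SixPoints.
Variables (st : state) (P : seq nat).
Hypothesis hst : forall E, perm_eq (points E) P -> wf_state st E.

(** The guard makes the symmetries of [g] hold for all arguments, including those for which [st] is
    not well formed. *)
Let g a b c d e f :=
  if perm_eq [:: a; b; c; d; e; f] P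
  then cycle_value st [:: (a, b); (c, d); (e, f)] else 0.

Let gN a b c d e f : g b a c d e f = - g a b c d e f.
Proof.
rewrite /g -(permPl (_ : perm_eq [:: a; b; c; d; e; f] _)).
  by case: ifP => h; rewrite ?oppr0 //; apply: cycle_value_turn; apply: hst.
by apply/permP => x /=; lia.
Qed.
Let gS a b c d e f : g c d a b e f = g a b c d e f.
Proof.
rewrite /g -(permPl (_ : perm_eq [:: a; b; c; d; e; f] _)).
  by case: ifP => h //; apply/esym/cycle_value_swap; apply: hst.
by apply/permP => x /=; lia.
Qed.
Let gT a b c d e f : g a b e f c d = g a b c d e f.
Proof.
rewrite /g -(permPl (_ : perm_eq [:: a; b; c; d; e; f] _)).
  case: ifP => h //; apply/esym/cycle_value_perm; first exact: hst.
  by rewrite perm_cons (perm_catC [:: (c, d)] [:: (e, f)]).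
by apply/permP => x /=; lia.
Qed.

Let vanishes (s : seq nat) : Prop :=
  if s is [:: a; b; c; d; e; f] then pf_sum g a b c d e f = 0 else True.

Let vanishes_perm s t : perm_eq s t -> vanishes s -> vanishes t.
Proof.
apply: perm_adjacent_swaps => {}s {}t x y; rewrite /vanishes.
case: s => [|a [|b [|c [|d [|e s]]]]] /=.
- case: t => [|c [|d [|e [|f [|? ?]]]]] // h.
  by rewrite pf_sum_swap1 // h oppr0.
- case: t => [|d [|e [|f [|? ?]]]] // h.
  by rewrite pf_sum_swap2 // h oppr0.
- case: t => [|e [|f [|? ?]]] // h.
  by rewrite pf_sum_swap3 // h oppr0.
- case: t => [|f [|? ?]] // h.
  by rewrite pf_sum_swap4 // h oppr0.
- case: t => [|? ?] // h.
  by rewrite pf_sum_swap5 // h oppr0.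
- by case: s => [|? [|? ?]].
Qed.

Lemma cycle_value_path3 x y z :
  perm_eq [:: x; (st x).1; y; (st y).1; z; (st z).1] P ->
  cycle_value st [:: ((st x).1, y); ((st y).1, z); ((st z).1, x)]
  = slam (smul (smul (st x).2 (st y).2) (st z).2).
Proof.
move=> hP; have [u h] := hst (E := [:: (x, (st x).1); (y, (st y).1); (z, (st z).1)]) hP.
rewrite !points_cons in u h.
have [|_ _ x3 _ _] := h x; first by rewrite !inE eqxx.
have [|_ _ y3 _ _] := h y; first by rewrite !inE eqxx !orbT.
have [|_ _ z3 _ _] := h z; first by rewrite !inE eqxx !orbT.
move: u; rewrite /= !inE !negb_or -!andbA.
move=> /and5P[/negbTE n1 /negbTE n2 /negbTE n3 /negbTE n4 /andP[/negbTE n5]].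
move=> /and5P[/negbTE m1 /negbTE m2 /negbTE m3 /negbTE m4 /and5P[/negbTE k1 /negbTE k2 /negbTE k3 /negbTE k4]].
move=> /andP[/negbTE k5 k6].
have sy (a b : nat) : (a == b) = false -> (b == a) = false by rewrite eq_sym.
have E := (n1, n2, n3, n4, n5, m1, m2, m3, m4, (k1, k2, k3, k4, k5), sy _ _ n2, sy _ _ n3,
  sy _ _ n4, sy _ _ n5, sy _ _ k2, sy _ _ k3, sy _ _ k4, sy _ _ k5).
rewrite /= ?x3 n2 /join ?x3.
by do 8![rewrite ?E ?eqxx ?x3 ?z3 /=].
Qed.

(** Seven of the fifteen matchings join the two ends of some string and vanish. The other eight
    thread the three strings into one cycle, in two cyclic orders and with either direction of the
    second and third string; [slam_rev3] turns them into the eight terms of [Lam_sym3]. *)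
Lemma cycle_value_strings a c e :
  perm_eq [:: a; (st a).1; c; (st c).1; e; (st e).1] P ->
  pf_sum g a (st a).1 c (st c).1 e (st e).1 = 0.
Proof.
move=> hP; have [u h] := hst (E := [:: (a, (st a).1); (c, (st c).1); (e, (st e).1)]) hP.
rewrite !points_cons in u h.
have [|_ _ a3 a4 a5] := h a; first by rewrite !inE eqxx.
have [|_ _ c3 c4 c5] := h c; first by rewrite !inE eqxx !orbT.
have [|_ _ e3 e4 e5] := h e; first by rewrite !inE eqxx !orbT.
set b := (st a).1 in hP a3 a4 *; set d := (st c).1 in hP c3 c4 *; set f := (st e).1 in hP e3 e4 *.
have gN2 x y z t v w : g x y t z v w = - g x y z t v w by rewrite -gS gN gS.
have gN3 x y z t v w : g x y z t w v = - g x y z t v w by rewrite -gT gN2 gT.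
have z1 x y z t : g a b x y z t = 0 by rewrite /g /= -/b eqxx; case: ifP.
have z2 x y z t : g x y c d z t = 0 by rewrite -gS /g /= -/d eqxx; case: ifP.
have z3 x y z t : g x y z t e f = 0 by rewrite -gT -gS /g /= -/f eqxx; case: ifP.
have p3 y y' z z' : (st y).1 = y' -> (st z).1 = z' ->
    perm_eq [:: y; y'; z; z'] [:: c; d; e; f] ->
    g b y y' z z' a = slam (smul (smul (st a).2 (st y).2) (st z).2).
  move=> <- <- h'.
  have h'' : perm_eq [:: a; b; y; (st y).1; z; (st z).1] P.
    by rewrite -(permPr hP) !perm_cons.
  rewrite /g ifT; first exact: cycle_value_path3.
  by apply: perm_trans h''; rewrite perm_sym (perm_catC [:: a]).
have [q1 q2 q3 q4 [q5 q6 q7 q8]] := perm_pairs c d e f.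
have E1 : g b c d e f a = _ := p3 c d e f erefl erefl q1.
rewrite (gN3 b c d e a f) (gT b c a f d e) (gS a f b c d e) in E1.
have E2 : g b c d f e a = _ := p3 c d f e erefl e3 q2.
rewrite (gN3 b c d f a e) (gT b c a e d f) (gS a e b c d f) in E2.
have E3 : g b d c e f a = _ := p3 d c e f c3 erefl q3.
rewrite (gN3 b d c e a f) (gT b d a f c e) (gS a f b d c e) in E3.
have E4 : g b d c f e a = _ := p3 d c f e c3 e3 q4.
rewrite (gN3 b d c f a e) (gT b d a e c f) (gS a e b d c f) in E4.
have E5 : g b e f c d a = _ := p3 e f c d erefl erefl q5.
rewrite (gN2 b e c f d a) (gN3 b e c f a d) (gT b e a d c f) (gS a d b e c f) in E5.
have E6 : g b e f d c a = _ := p3 e f d c erefl c3 q6.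
rewrite (gN2 b e d f c a) (gN3 b e d f a c) (gT b e a c d f) (gS a c b e d f) in E6.
have E7 : g b f e c d a = _ := p3 f e c d e3 erefl q7.
rewrite (gN2 b f c e d a) (gN3 b f c e a d) (gT b f a d c e) (gS a d b f c e) in E7.
have E8 : g b f e d c a = _ := p3 f e d c e3 c3 q8.
rewrite (gN2 b f d e c a) (gN3 b f d e a c) (gT b f a c d e) (gS a c b f d e) in E8.
have z4 x y z t : g x y z t c d = 0 by rewrite -gT z2.
rewrite /pf_sum ?z1 ?z2 ?z3 ?z4; move: E1 E2 E3 E4 E5 E6 E7 E8.
rewrite !c4 !e4; have := slam_sym3 a5 c5 e5; cbv zeta beta.
move: (st a).2 (st c).2 (st e).2 => A B C; rewrite !(smulN, sNmul, slamN).
rewrite (slam_rev3 A C B) (slam_rev3 A C (sstar B)) (slam_rev3 A (sstar C) B).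
rewrite (slam_rev3 A (sstar C) (sstar B)) !sstarK.
move: (slam _) (slam _) (slam _) (slam _) (slam _) (slam _) (slam _) (slam _).
move=> s1 s2 s3 s4 s5 s6 s7 s8 hs.
move=> /eqP; rewrite eqr_oppLR => /eqP-> /eqP; rewrite eqr_oppLR => /eqP->.
move=> /eqP; rewrite eqr_oppLR => /eqP-> /eqP; rewrite eqr_oppLR => /eqP->.
rewrite !opprK => -> -> -> ->.
rewrite -[RHS]oppr0 -[in RHS]hs; ring.
Qed.

Lemma pf_sum_eq0 a b c d e f : perm_eq [:: a; b; c; d; e; f] P ->
  pf_sum g a b c d e f = 0.
Proof.
move=> hP.
(* Six points carry three strings, which [step] splits off one at a time. *)
have [x [y [z hxyz]]] : exists x y z,
    perm_eq [:: x; (st x).1; y; (st y).1; z; (st z).1] P.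
  have hP' : perm_eq (points [:: (a, b); (c, d); (e, f)]) P by [].
  have [u h] := hst hP'; rewrite (perm_uniq hP') in u.
  have {}h x : x \in P -> [/\ (st x).1 \in P, (st x).1 <> x & (st (st x).1).1 = x].
    by move=> hx; case: (h x); rewrite ?(perm_mem hP').
  have sP : size P = 6 by rewrite -(perm_size hP).
  have step (Q R : seq nat) n : size Q = n.+2 -> uniq (R ++ Q) ->
      (forall x, x \in Q -> [/\ (st x).1 \in Q, (st x).1 <> x & (st (st x).1).1 = x]) ->
      exists x Q', [/\ perm_eq (x :: (st x).1 :: Q') Q, size Q' = n &
        forall x, x \in Q' -> [/\ (st x).1 \in Q', (st x).1 <> x & (st (st x).1).1 = x]].
    case: Q => [|x Q] // [sQ]; rewrite cat_uniq => /and3P[_ _ /= /andP[nx uQ]] hQ.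
    have [x1 x2 x3] := hQ x (mem_head _ _).
    have xQ : (st x).1 \in Q by move: x1; rewrite inE => /orP[/eqP|].
    exists x, (rem (st x).1 Q); split.
    - by rewrite perm_cons perm_sym perm_to_rem.
    - by rewrite size_rem // sQ.
    move=> w; rewrite !mem_rem_uniq // !inE => /andP[w1 w2].
    have [|w3 w4 w5] := hQ w; first by rewrite inE w2 orbT.
    split=> //; apply/andP; split.
      by apply/eqP => e'; move: nx; rewrite -x3 -e' w5 w2.
    by move: w3; rewrite inE => /orP[/eqP e'|//]; move: w1; rewrite -e' w5 eqxx.
  have [x [Q1 [p1 s1 h1]]] := step P [::] 4 sP u h.
  have u1 : uniq ([:: x; (st x).1] ++ Q1) by rewrite (perm_uniq p1).
  have [y [Q2 [p2 s2 h2]]] := step Q1 _ 2 s1 u1 h1.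
  have u2 : uniq ([::] ++ Q2).
    by move: u1; rewrite cat_uniq => /and3P[_ _]; rewrite -(perm_uniq p2) => /= /and3P[].
  have [z [Q3 [p3 /size0nil s3 h3]]] := step Q2 _ 0 s2 u2 h2.
  exists x, y, z; apply: perm_trans p1; rewrite !perm_cons.
  by apply: perm_trans p2; rewrite !perm_cons -s3.
have hv : vanishes [:: x; (st x).1; y; (st y).1; z; (st z).1].
  exact: cycle_value_strings.
have hp := hP; rewrite -(permPr hxyz) perm_sym in hp.
exact: (vanishes_perm hp hv).
Qed.

End SixPoints.

(** The edges outside the six points can be joined first, which leaves three strings; if one of
    these edges closes a cycle, all fifteen terms are 0. *)
Lemma cycle_value_pf6 st E p1 p2 p3 p4 p5 p6 :
  (forall F, perm_eq (points F) ([:: p1; p2; p3; p4; p5; p6] ++ points E) -> wf_state st F) ->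
  \sum_(s <- pf6 p1 p2 p3 p4 p5 p6) (-1) ^+ s.1 * cycle_value st (s.2 ++ E) = 0.
Proof.
have hpt s : s \in pf6 p1 p2 p3 p4 p5 p6 ->
    perm_eq (points s.2) [:: p1; p2; p3; p4; p5; p6].
  move=> hs; apply/permP => x; move: hs; rewrite /pf6.
  do 14![rewrite inE => /orP[/eqP-> /=|]; [clear; lia|]].
  by rewrite inE => /eqP-> /=; clear; lia.
elim: E st => [|[p q] E IH] st hst.
  have h := @pf_sum_eq0 st [:: p1; p2; p3; p4; p5; p6] hst p1 p2 p3 p4 p5 p6 (perm_refl _).
  rewrite -[RHS]h /pf_sum.
  have hg : {in pf6 p1 p2 p3 p4 p5 p6, forall s, perm_eq (points s.2) [:: p1; p2; p3; p4; p5; p6]}.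
    exact: hpt.
  have on (b : bool) x y z t v w : (b, [:: (x, y); (z, t); (v, w)]) \in pf6 p1 p2 p3 p4 p5 p6 ->
    (if perm_eq [:: x; y; z; t; v; w] [:: p1; p2; p3; p4; p5; p6]
     then cycle_value st [:: (x, y); (z, t); (v, w)] else 0)
    = cycle_value st [:: (x, y); (z, t); (v, w)].
    by move=> /hpt /= ->.
  rewrite !(on false p1 p6 p2 p5 p3 p4, on true p1 p6 p2 p4 p3 p5, on false p1 p6 p2 p3 p4 p5,
    on true p1 p5 p2 p6 p3 p4, on false p1 p5 p2 p4 p3 p6, on true p1 p5 p2 p3 p4 p6).
  rewrite !(on false p1 p4 p2 p6 p3 p5, on true p1 p4 p2 p5 p3 p6, on false p1 p4 p2 p3 p5 p6,
    on true p1 p3 p2 p6 p4 p5, on false p1 p3 p2 p5 p4 p6, on true p1 p3 p2 p4 p5 p6).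
  rewrite !(on false p1 p2 p3 p6 p4 p5, on true p1 p2 p3 p5 p4 p6, on false p1 p2 p3 p4 p5 p6).
  all: rewrite ?inE ?eqxx ?orbT //.
  rewrite /pf6 !big_cons big_nil [(_, _).1]/= ; cbn [fst snd cat].
  rewrite !expr0 !expr1; ring.
have hmove s : s \in pf6 p1 p2 p3 p4 p5 p6 ->
    cycle_value st (s.2 ++ (p, q) :: E) = cycle_value st ((p, q) :: s.2 ++ E).
  move=> hs; apply: cycle_value_perm.
    by apply: hst; rewrite points_cat perm_cat2r hpt.
  by rewrite perm_catC /= perm_cons perm_catC.
rewrite big_seq; under eq_bigr do rewrite hmove //.
rewrite -big_seq /=; case: (altP ((st p).1 =P q)) => hpq.
  rewrite big_seq big1 // => s hs.
  by case: s hs => b [|e s] hs; [have := perm_size (hpt _ hs) | rewrite /= mulr0].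
apply: IH => F hF; apply: wf_join (elimN eqP hpq); apply: hst.
have hc : perm_eq ([:: p; q] ++ [:: p1; p2; p3; p4; p5; p6] ++ points E)
  ([:: p1; p2; p3; p4; p5; p6] ++ [:: p; q] ++ points E) by rewrite (perm_catCA [:: p; q]).
by apply: perm_trans hc; rewrite /= !perm_cons.
Qed.

Lemma cycle_value_pfaffian n st :
  (forall F, perm_eq (points F) (iota 0 n.*2) -> wf_state st F) ->
  pfaffian_functional n (cycle_value st).
Proof.
move=> hst; split=> [E F /andP[hE _] hp|E p1 p2 p3 p4 p5 p6 _ _ _ _ _ /andP[hE _]].
  by apply: cycle_value_perm hp; apply: hst.
apply: cycle_value_pf6 => F hF; apply: hst; apply: perm_trans hF _.
apply: perm_trans hE; rewrite points_cat perm_cat2r.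
by apply/permP => x /=; clear; lia.
Qed.
End CycleFunctional.

(** * The second fundamental theorem *)

Section SymplecticAdjoint.
Variable K : fieldType.
Variable n : nat.
Local Notation J := (symp_form K n).
Implicit Types X Y : 'M[K]_(n + n).

Lemma symp_formT : J^T = - J.
Proof. by rewrite /symp_form tr_block_mx !trmx0 linearN /= trmx1 opp_block_mx !oppr0 opprK. Qed.

Lemma symp_form_sqr : J *m J = - 1%:M.
Proof.
rewrite /symp_form mulmx_block !(mul0mx, mulmx0, mulNmx, mulmxN, mul1mx) !add0r !addr0.
by rewrite scalar_mx_block opp_block_mx !oppr0.
Qed.

Lemma symp_form_unit : J \in unitmx.
Proof. by case: (mulmx1_unit (_ : J *m (- J) = 1%:M)); rewrite // mulmxN symp_form_sqr opprK. Qed.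

Lemma invmx_symp_form : invmx J = - J.
Proof.
by rewrite -[RHS](mulKmx symp_form_unit) mulmxN symp_form_sqr opprK mulmx1.
Qed.

Lemma symp_adjE X : symp_adj X = - (J *m X^T *m J).
Proof. by rewrite /symp_adj invmx_symp_form !mulNmx. Qed.

Lemma symp_adjM X Y : symp_adj (X *m Y) = symp_adj Y *m symp_adj X.
Proof.
by rewrite /symp_adj trmx_mul !mulmxA mulmxK // symp_form_unit.
Qed.

Lemma symp_adj1 : symp_adj (1%:M : 'M[K]_(n + n)) = 1%:M.
Proof. by rewrite /symp_adj trmx1 mulmx1 mulVmx // symp_form_unit. Qed.

Lemma symp_adjD X Y : symp_adj (X + Y) = symp_adj X + symp_adj Y.
Proof. by rewrite /symp_adj linearD mulmxDr mulmxDl. Qed.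

Lemma symp_adjZ a X : symp_adj (a *: X) = a *: symp_adj X.
Proof. by rewrite /symp_adj linearZ /= -scalemxAr -scalemxAl. Qed.

Lemma symp_adjN X : symp_adj (- X) = - symp_adj X.
Proof. by rewrite -scaleN1r symp_adjZ scaleN1r. Qed.

Lemma symp_adj0 : symp_adj (0 : 'M[K]_(n + n)) = 0.
Proof. by have := symp_adjZ 0 0; rewrite !scale0r. Qed.

Lemma symp_adjK X : symp_adj (symp_adj X) = X.
Proof.
rewrite !symp_adjE linearN /= !trmx_mul trmxK symp_formT.
rewrite !(mulNmx, mulmxN) ?opprK !mulmxA symp_form_sqr !mulNmx mul1mx -mulmxA.
by rewrite symp_form_sqr mulmxN mulmx1 ?opprK.
Qed.

Lemma tr_symp_adj X : \tr (symp_adj X) = \tr X.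
Proof. by rewrite /symp_adj mxtrace_mulC !mulmxA mulmxV ?mul1mx ?mxtrace_tr // symp_form_unit. Qed.


Section Words.
Variables (L : Type) (e : L -> 'M[K]_(n + n)).
Definition mxword (w : seq L) : 'M[K]_(n + n) := \big[mulmx/1%:M]_(l <- w) e l.

Lemma mxword_nil : mxword [::] = 1%:M. Proof. by rewrite /mxword big_nil. Qed.
Lemma mxword_cons l w : mxword (l :: w) = e l *m mxword w.
Proof. by rewrite /mxword big_cons. Qed.
Lemma mxword_cat u w : mxword (u ++ w) = mxword u *m mxword w.
Proof.
elim: u => [|l u IH]; first by rewrite mxword_nil mul1mx.
by rewrite cat_cons !mxword_cons IH mulmxA.
Qed.
End Words.

End SymplecticAdjoint.

(** * Traces of words in rank-one matrices as products of pairings *)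

Section RankOne.
Variable K : fieldType.
Local Notation J := (symp_form K 2).

Definition lletter : Type := (letter * nat)%type.
(** Label i owns the points 2(i-1) and 2(i-1)+1, and its matrix is u v^T J for the vectors placed
    there; the adjoint exchanges the two points. Label 0 is reserved for generic matrices, whence
    the predecessor. *)
Definition entry (a : lletter) : nat := (a.2.-1).*2 + a.1.2.
Definition exit (a : lletter) : nat := (a.2.-1).*2 + ~~ a.1.2.
Definition col_of (u : 'I_4 -> K) : 'cV[K]_(2 + 2) := \col_i u i.
Definition rank_one (v : nat -> 'I_4 -> K) (i : nat) : 'M[K]_(2 + 2) :=
  col_of (v (i.-1).*2) *m (col_of (v (i.-1).*2.+1))^T *m J.
Definition rank_one_letter v (a : lletter) : 'M[K]_(2 + 2) :=
  if a.1.2 then symp_adj (rank_one v a.2) else rank_one v a.2.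
Definition stars (w : seq lletter) : bool := odd (count (fun a => a.1.2) w).


Lemma symp_form4E (i j : 'I_(2 + 2)) :
  J i j = ((i : nat) == j + 2)%N%:R - ((j : nat) == i + 2)%N%:R.
Proof.
rewrite /symp_form !mxE; case: splitP => i' ei; rewrite !mxE; case: splitP => j' ej.
all: rewrite !mxE ei ej -?val_eqE /=.
all: case: i' {ei} => [[|[|//]] hi]; case: j' {ej} => [[|[|//]] hj] /=.
all: by rewrite ?mulr0n ?mulr1n ?subrr ?subr0 ?sub0r ?oppr0.
Qed.

Lemma dot_col u w : (col_of u)^T *m J *m col_of w = (symp_dot u w)%:M.
Proof.
have := symp_form4E; move: J => J0 hJ.
apply/matrixP => i j; rewrite !ord1 mxE [RHS]mxE eqxx mulr1n /symp_dot.
rewrite !big_ord_recl !big_ord0 !mxE !big_ord_recl !big_ord0 !mxE !hJ /=.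
have e3 : lift ord0 (lift ord0 (lift ord0 ord0)) = @Ordinal 4 3 isT by apply: val_inj.
have e2 : lift ord0 (lift ord0 ord0) = @Ordinal 4 2 isT by apply: val_inj.
have e1 : lift ord0 ord0 = @Ordinal 4 1 isT by apply: val_inj.
have e0 : ord0 = @Ordinal 4 0 isT by apply: val_inj.
have -> : u ord0 = u (@Ordinal 4 0 isT) by rewrite e0.
have -> : w ord0 = w (@Ordinal 4 0 isT) by rewrite e0.
rewrite e3 e2 e1.
ring.
Qed.

Lemma rank_one_letterE v a : rank_one_letter v a =
  (-1) ^+ a.1.2 *: (col_of (v (entry a)) *m (col_of (v (exit a)))^T *m J).
Proof.
rewrite /rank_one_letter /rank_one /entry /exit; case: a.1.2 => /=; last first.
  by rewrite addn0 addn1 expr0 scale1r.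
rewrite addn0 addn1 expr1 scaleN1r symp_adjE !trmx_mul trmxK symp_formT.
by rewrite !(mulNmx, mulmxN, opprK) !mulmxA symp_form_sqr !mulNmx mul1mx.
Qed.

Fixpoint path_edges (a : lletter) (s : seq lletter) (y : nat) : seq edge :=
  if s is b :: s' then (exit a, entry b) :: path_edges b s' y else [:: (exit a, y)].
Definition cycle_edges (w : seq lletter) : seq edge :=
  if w is a :: s then path_edges a s (entry a) else [::].

(** Between consecutive factors stands a scalar v^T J u, the pairing of an exit with the next entry;
    the trace supplies the last one, and each adjoint a sign. *)
Lemma trace_rank_one v w : w != [::] ->
  \tr (mxword (rank_one_letter v) w)
  = (-1) ^+ stars w * eval_matching v (cycle_edges w).
Proof.
case: w => // a s _; rewrite /cycle_edges.
have H y : forall s a, mxword (rank_one_letter v) (a :: s) *m col_of (v y) =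
    ((-1) ^+ stars (a :: s) * eval_matching v (path_edges a s y)) *: col_of (v (entry a)).
  elim=> [|b t IH] c.
    rewrite mxword_cons mxword_nil mulmx1 rank_one_letterE -scalemxAl -!mulmxA.
    rewrite [_ *m (J *m _)]mulmxA dot_col mul_mx_scalar scalerA.
    by rewrite /eval_matching big_seq1 /stars /= addn0; case: c.1.2.
  rewrite mxword_cons -mulmxA IH -scalemxAr rank_one_letterE -scalemxAl -!mulmxA.
  rewrite [_ *m (J *m _)]mulmxA dot_col mul_mx_scalar !scalerA.
  rewrite /eval_matching big_cons; congr (_ *: _).
  have -> : stars (c :: b :: t) = c.1.2 (+) stars (b :: t) by rewrite /stars /= oddD; case: c.1.2.
  by rewrite signr_addb; move: (symp_dot _ _) (\prod_(_ <- _) _) => x z; ring.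
have -> : \tr (mxword (rank_one_letter v) (a :: s)) = \tr (mxword (rank_one_letter v) s *m
   ((-1) ^+ a.1.2 *: (col_of (v (entry a)) *m (col_of (v (exit a)))^T *m J))).
  by rewrite mxword_cons rank_one_letterE mxtrace_mulC.
rewrite mxtrace_mulC -scalemxAl mxtraceZ -!mulmxA mxtrace_mulC -!mulmxA.
case: s => [|b t].
  rewrite mxword_nil mul1mx mulmxA dot_col mxtrace_scalar mulr1n /stars /= addn0.
  by rewrite /eval_matching big_seq1; case: a.1.2.
rewrite H -!scalemxAr mulmxA dot_col mxtraceZ mxtrace_scalar mulr1n.
have -> : stars (a :: b :: t) = a.1.2 (+) stars (b :: t) by rewrite /stars /= oddD; case: a.1.2.
rewrite /eval_matching big_cons signr_addb.
by move: (symp_dot _ _) (\prod_(_ <- _) _) => x z; ring.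
Qed.

End RankOne.

Section CycleOfWord.
Variables (K : comNzRingType) (Lam : seq letter -> K) (g : nat -> bool).

(** Before any contraction each matrix is a string of one letter; from its second point it reads as
    the adjoint, with a minus sign. *)
Definition init_state (p : nat) : nat * sword :=
  if odd p then (p.-1, (true, [:: (g p./2.+1, true)]))
  else (p.+1, (false, [:: (g p./2.+1, false)])).

Definition well_labelled (a : lletter) := (0 < a.2)%N && (a.1.1 == g a.2).


Lemma init_even m : init_state m.*2 = (m.*2.+1, (false, [:: (g m.+1, false)])).
Proof. by rewrite /init_state odd_double doubleK. Qed.
Lemma init_odd m : init_state m.*2.+1 = (m.*2, (true, [:: (g m.+1, true)])).
Proof. by rewrite /init_state /= odd_double /= uphalf_double. Qed.

Lemma init_entry a : well_labelled a ->
  init_state (entry a) = (exit a, (a.1.2, [:: a.1])).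
Proof.
case: a => [[x s] [|m]] // /andP[_ /eqP /= ->]; rewrite /entry /exit /=.
by case: s; rewrite ?addn0 ?addn1 ?init_even ?init_odd.
Qed.

Lemma init_exit a : well_labelled a -> (init_state (exit a)).1 = entry a.
Proof.
case: a => [[x s] [|m]] // /andP[_ /eqP /= ->]; rewrite /entry /exit /=.
by case: s; rewrite ?addn0 ?addn1 ?init_even ?init_odd.
Qed.

Lemma init_state_wf n F : perm_eq (points F) (iota 0 n.*2) -> wf_state init_state F.
Proof.
move=> hp; split=> [|p]; first by rewrite (perm_uniq hp) iota_uniq.
rewrite !(perm_mem hp) !mem_iota /= !add0n.
rewrite -(odd_double_half p); case: (odd p); move: p./2 => m; rewrite ?add0n ?add1n => hm.
  by rewrite init_odd /= init_even; split=> //=; lia.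
by rewrite init_even /= init_odd; split=> //=; lia.
Qed.

Local Notation cycle_value := (cycle_value Lam).

Lemma exit_neq a b : a.2 != b.2 -> well_labelled a -> well_labelled b ->
  [/\ entry a != entry b, entry a != exit b, exit a != entry b & exit a != exit b].
Proof.
case: a b => [[x s] [|i]] [[y t] [|j]] //=; rewrite eqSS => hij _ _.
rewrite /entry /exit /=; move: hij; case: s; case: t => /= h; split; lia.
Qed.

Lemma cycle_value_path (st : state) a s y w E :
  all well_labelled (a :: s) -> uniq (map snd (a :: s)) ->
  st y = (exit a, w) -> (st (exit a)).1 = y ->
  (forall b, b \in s -> [/\ st (entry b) = init_state (entry b),
     st (exit b) = init_state (exit b), y != entry b & y != exit b]) ->
  cycle_value st (path_edges a s y ++ E)
  = if E is [::] then slam Lam (w.1 (+) stars s, w.2 ++ map fst s) else 0.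
Proof.
elim: s st a w => [|b s IH] st a w hl hu h1 h2 hs /=.
  by rewrite h2 eqxx h1 /stars /= addbF cats0; case: w {h1}.
have [/andP[la lb] ls] : (well_labelled a && well_labelled b) /\ all well_labelled s.
  by case/and3P: hl => -> ->.
have [hb1 hb2 hb3 hb4] := hs b (mem_head _ _).
have heb := init_entry lb.
rewrite h2 (negbTE hb3).
rewrite (IH _ b (smul w (b.1.2, [:: b.1]))).
- suff -> : stars (b :: s) = b.1.2 (+) stars s by rewrite /smul /= addbA -catA.
  by rewrite /stars /= oddD; case: b.1.2.
- by rewrite /= lb.
- by case/andP: hu.
- by rewrite /join h2 eqxx hb1 heb h1.
- rewrite /join h2 hb1 heb eq_sym (negbTE hb4) /= eqxx /= ?h2 //.
move=> c hc; have [hc1 hc2 hc3 hc4] := hs c (mem_behead (s := b :: s) hc).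
have lc : well_labelled c by move/allP: ls; apply.
have hbc : b.2 != c.2.
  move: hu => /= /and3P[_ hbs _]; apply: contra hbs => /eqP ->.
  exact: map_f.
have [e1 e2 e3 e4] := exit_neq hbc lb lc.
rewrite /join h2 hb1 heb /= ![_ == y]eq_sym (negbTE hc3) (negbTE hc4).
by rewrite ![_ == exit b]eq_sym (negbTE e3) (negbTE e4).
Qed.

Lemma cycle_value_word w E : w != [::] -> all well_labelled w -> uniq (map snd w) ->
  cycle_value init_state (cycle_edges w ++ E)
  = if E is [::] then (-1) ^+ stars w * Lam (map fst w) else 0.
Proof.
case: w => // a s _ hl hu; rewrite /cycle_edges.
have la : well_labelled a by case/andP: hl.
rewrite (@cycle_value_path _ _ _ _ (a.1.2, [:: a.1])) //.
- case: E => //; rewrite /slam /=; congr ((-1) ^+ _ * _).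
  by rewrite /stars /= oddD; case: a.1.2.
- exact: init_entry.
- exact: init_exit.
move=> b hb; split=> //.
all: have lb : well_labelled b by move/allP: hl; apply; rewrite inE hb orbT.
all: have hab : a.2 != b.2
  by move: hu => /= /andP[has _]; apply: contra has => /eqP ->; apply: map_f.
all: by have [e1 e2 e3 e4] := exit_neq hab la lb.
Qed.
End CycleOfWord.

Definition orient (e : edge) : edge := if (e.1 < e.2)%N then e else (e.2, e.1).
Definition flips (E : seq edge) : bool := odd (count (fun e : edge => ~~ (e.1 < e.2)%N) E).

Lemma flips_cons e E : flips (e :: E) = ~~ (e.1 < e.2)%N (+) flips E.
Proof. by rewrite /flips /= oddD; case: (_ < _)%N. Qed.

Lemma points_orient E : perm_eq (points (map orient E)) (points E).
Proof.
elim: E => //= -[p q] E IH; rewrite /orient /=; case: ifP => _ /=.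
  by rewrite !perm_cons.
by rewrite (perm_catCA [:: q] [:: p]) /= !perm_cons.
Qed.

Section Multilinear.
Variables (K : fieldType) (Lam : seq letter -> K).
Hypothesis Lam_cyc : forall u v, Lam (u ++ v) = Lam (v ++ u).
Hypothesis Lam_star : forall w, Lam (star w) = Lam w.
Hypothesis Lam_sym3 : forall u v w, u != [::] -> v != [::] -> w != [::] ->
  Lam (u ++ v ++ w) + Lam (u ++ v ++ star w) + Lam (u ++ star v ++ w)
  + Lam (u ++ star v ++ star w) + Lam (star u ++ v ++ w) + Lam (star u ++ v ++ star w)
  + Lam (star u ++ star v ++ w) + Lam (star u ++ star v ++ star w) = 0.

Lemma eval_orient v E :
  eval_matching v (map orient E) = (-1) ^+ flips E * eval_matching (K := K) v E.
Proof.
elim: E => [|[p q] E IH]; first by rewrite /eval_matching !big_nil mulr1.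
rewrite /eval_matching map_cons !big_cons -/(eval_matching v (map orient E)) IH flips_cons /orient.
case: ltnP => _ /=; first by rewrite mulrCA.
by rewrite signrN symp_dotC -/(eval_matching v E) !mulNr mulrCA.
Qed.

Lemma cycle_value_orient st E : wf_state st E ->
  cycle_value Lam st (map orient E) = (-1) ^+ flips E * cycle_value Lam st E.
Proof.
elim: E st => [|[p q] E IH] st hw; first by rewrite mulr0.
have hw' : wf_state st ((p, q) :: map orient E).
  case: hw => u h; have hp : perm_eq (points ((p, q) :: E)) (points ((p, q) :: map orient E)).
    by rewrite /= !perm_cons perm_sym points_orient.
  split=> [|a]; first by rewrite -(perm_uniq hp).
  by rewrite -!(perm_mem hp) => /h; rewrite (perm_mem hp).
have step : cycle_value Lam st ((p, q) :: map orient E) =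
    (-1) ^+ flips E * cycle_value Lam st ((p, q) :: E).
  rewrite /=; case: (altP ((st p).1 =P q)) => hpq.
    by case: E {IH hw hw'} => [|e E] /=; rewrite ?mulr0 // /flips /= expr0 mul1r.
  by apply: IH; apply: wf_join hw (elimN eqP hpq).
rewrite map_cons flips_cons /orient [(p, q).1]/= [(p, q).2]/=; case: ltnP => _.
  exact: step.
by rewrite (cycle_value_turn Lam_star hw') step addTb signrN mulNr.
Qed.

Definition linear_part (ws : seq (seq lletter)) : K :=
  if ws is [:: w] then Lam (map fst w) else 0.

Let label_points (s : seq nat) := flatten [seq [:: i.-1.*2; i.-1.*2.+1] | i <- s].

Lemma points_path a s y : perm_eq (points (path_edges a s y))
  (exit a :: flatten [seq [:: entry b; exit b] | b <- s] ++ [:: y]).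
Proof.
elim: s a => [|b s IH] a //=.
by rewrite !perm_cons; apply: IH.
Qed.

Lemma points_cycle w : perm_eq (points (cycle_edges w)) (label_points (map snd w)).
Proof.
have he a : perm_eq [:: entry a; exit a] [:: a.2.-1.*2; a.2.-1.*2.+1].
  case: a => [[x s] i]; rewrite /entry /exit /=; case: s; rewrite addn0 addn1 //.
  by rewrite (perm_catC [:: _] [:: _]).
case: w => // a s; rewrite /cycle_edges; apply: (perm_trans (points_path _ _ _)).
have -> : label_points (map snd (a :: s)) =
  [:: a.2.-1.*2; a.2.-1.*2.+1] ++ label_points (map snd s) by [].
apply: (@perm_trans _ ([:: entry a; exit a] ++ flatten [seq [:: entry b; exit b] | b <- s])).
  by rewrite -[exit a :: _ ++ _]/((exit a :: _) ++ [:: entry a]) perm_catC.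
apply: perm_cat => //; elim: s => // b s IH.
exact: (perm_cat (he b) IH).
Qed.

Lemma label_points_perm s t : perm_eq s t -> perm_eq (label_points s) (label_points t).
Proof. by move=> h; apply: perm_flatten; apply: perm_map. Qed.

Lemma label_points_iota n : label_points (iota 1 n) = iota 0 n.*2.
Proof.
elim: n => // n IH.
rewrite -{1}[n.+1]addn1 iotaD /label_points map_cat flatten_cat -/(label_points _) IH.
by rewrite doubleS -addn2 iotaD /= ?add1n ?add0n.
Qed.

Definition edges (ws : seq (seq lletter)) := flatten (map cycle_edges ws).

Lemma points_edges ws : perm_eq (points (edges ws)) (label_points (map snd (flatten ws))).
Proof.
elim: ws => // w ws IH; rewrite /edges /= points_cat map_cat /label_points map_cat flatten_cat.
exact: perm_cat (points_cycle w) IH.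
Qed.

Lemma cycle_value_edges g ws : all (fun w => w != [::]) ws ->
  all (well_labelled g) (flatten ws) -> uniq (map snd (flatten ws)) ->
  cycle_value Lam (init_state g) (edges ws) = (-1) ^+ stars (flatten ws) * linear_part ws.
Proof.
case: ws => [|w ws] /=; first by rewrite mulr0.
move=> /andP[hw hws]; rewrite all_cat map_cat cat_uniq => /andP[hl _] /and3P[hu _ _].
rewrite /edges /= cycle_value_word //; case: ws hws => [|w' ws] /=; first by rewrite cats0.
by case/andP => hw' _; case: w' hw' => // a [|b s] _ /=; rewrite mulr0.
Qed.

Lemma trace_edges v ws : all (fun w => w != [::]) ws ->
  \prod_(w <- ws) \tr (mxword (rank_one_letter v) w)
  = (-1) ^+ stars (flatten ws) * eval_matching (K := K) v (edges ws).
Proof.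
elim: ws => [|w ws IH] /=; first by rewrite big_nil /eval_matching big_nil mulr1.
move=> /andP[hw hws]; rewrite big_cons IH // trace_rank_one // /edges /=.
have -> : stars (w ++ flatten ws) = stars w (+) stars (flatten ws).
  by rewrite /stars count_cat oddD.
by rewrite signr_addb /eval_matching big_cat /= mulrACA.
Qed.

(** On rank-one matrices a product of traces is, up to sign, the value of a matching, and
    [cycle_value] sends that matching to the linear part of the product with the same sign. Hence
    [matching_sft] transfers the relation. *)
Theorem multilinear_sft n g (F : seq (K * seq (seq lletter))) :
  (forall t, t \in F -> [/\ all (fun w => w != [::]) t.2,
     all (well_labelled g) (flatten t.2) & perm_eq (map snd (flatten t.2)) (iota 1 n)]) ->
  (forall v, \sum_(t <- F) t.1 * \prod_(w <- t.2) \tr (mxword (rank_one_letter v) w) = 0) ->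
  \sum_(t <- F) t.1 * linear_part t.2 = 0.
Proof.
move=> hF hv.
(* The coefficients absorb the signs of the adjoints and of the orientation of edges; each occurs
   twice in the end and cancels. *)
pose G := [seq (t.1 * (-1) ^+ stars (flatten t.2) * (-1) ^+ flips (edges t.2),
                map orient (edges t.2)) | t <- F].
have sq (b : bool) : (-1) ^+ b * (-1) ^+ b = 1 :> K by rewrite -expr2 sqrr_sign.
have hpts t : t \in F -> perm_eq (points (edges t.2)) (iota 0 n.*2).
  move=> /hF[_ _ hp]; rewrite -label_points_iota.
  exact: perm_trans (points_edges _) (label_points_perm hp).
have hG t : t \in G -> matching n t.2.
  move=> /mapP[u hu ->] /=; apply/andP; split.
    exact: perm_trans (points_orient _) (hpts _ hu).
  have := hpts _ hu; move: (edges u.2) => E hE.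
  have uE : uniq (points E) by rewrite (perm_uniq hE) iota_uniq.
  elim: E uE {hE} => //= -[p q] E IH /= /and3P[]; rewrite inE negb_or => /andP[hpq _] _ uE.
  have := IH uE; rewrite /oriented /= => ->; rewrite andbT /orient /=.
  by case: (ltnP p q) => //= h; rewrite ltn_neqAle eq_sym hpq.
have wf0 : forall E, perm_eq (points E) (iota 0 n.*2) -> wf_state (init_state g) E.
  exact: init_state_wf.
have hz v : \sum_(t <- G) t.1 * eval_matching v t.2 = 0.
  rewrite big_map -[RHS](hv v) big_seq [RHS]big_seq; apply: eq_bigr => t ht.
  have [h1 _ _] := hF _ ht; rewrite trace_edges // eval_orient /= -!mulrA.
  by congr (_ * (_ * _)); rewrite mulrA sq mul1r.
rewrite -[RHS](matching_sft hG hz (cycle_value_pfaffian Lam_cyc Lam_star Lam_sym3 wf0)).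
rewrite big_map big_seq [RHS]big_seq; apply: eq_bigr => t ht; have [h1 h2 h3] := hF _ ht.
rewrite cycle_value_orient; last by apply: wf0; apply: hpts.
rewrite (cycle_value_edges h1 h2); last by rewrite (perm_uniq h3) iota_uniq.
by rewrite -!mulrA; congr (_ * _); rewrite [X in _ * X]mulrA sq mul1r mulrA sq mul1r.
Qed.

End Multilinear.

(* Label 0 marks a letter still standing for a generic matrix; [polarize g i] replaces one such letter of type [g] by the fresh matrix i.+1. *)
Fixpoint polarize (g : bool) (i : nat) (w : seq lletter) : seq (seq lletter) :=
  if w is a :: w' then
    (if (a.1.1 == g) && (a.2 == 0%N) then [:: (a.1, i.+1) :: w'] else [::])
    ++ map (cons a) (polarize g i w')
  else [::].

Fixpoint polarize_words g i (ws : seq (seq lletter)) : seq (seq (seq lletter)) :=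
  if ws is w :: ws' then
    map (fun u => u :: ws') (polarize g i w) ++ map (cons w) (polarize_words g i ws')
  else [::].

(** * Polarization: from arbitrary identities to multilinear ones *)

Section Polarization.
Variable K : numFieldType.
Local Notation term := (K * seq (seq lletter))%type.

Definition polarize_terms g i (F : seq term) : seq term :=
  flatten [seq [seq (t.1, ws) | ws <- polarize_words g i t.2] | t <- F].

Section Taylor.
(* The value at 0 and the derivative at 0 of a polynomial function. *)
Definition taylor1 (h : K -> K) (a b : K) :=
  exists c : {poly K}, forall s, h s = a + b * s + s ^+ 2 * c.[s].

Lemma taylor1_cst a : taylor1 (fun=> a) a 0.
Proof. by exists 0 => s; rewrite horner0 mulr0 mul0r !addr0. Qed.

Lemma taylor1D h1 h2 a1 b1 a2 b2 : taylor1 h1 a1 b1 -> taylor1 h2 a2 b2 ->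
  taylor1 (fun s => h1 s + h2 s) (a1 + a2) (b1 + b2).
Proof. by move=> [c1 e1] [c2 e2]; exists (c1 + c2) => s; rewrite hornerD e1 e2; ring. Qed.

Lemma taylor1M h1 h2 a1 b1 a2 b2 : taylor1 h1 a1 b1 -> taylor1 h2 a2 b2 ->
  taylor1 (fun s => h1 s * h2 s) (a1 * a2) (b1 * a2 + a1 * b2).
Proof.
move=> [c1 e1] [c2 e2].
exists ((b1 * b2)%:P + c1 * (a2%:P + b2 *: 'X) + c2 * (a1%:P + b1 *: 'X) + 'X^2 * c1 * c2) => s.
by rewrite e1 e2 !hornerE; ring.
Qed.

Lemma taylor1_sum I (r : seq I) h a b : (forall i, taylor1 (h i) (a i) (b i)) ->
  taylor1 (fun s => \sum_(i <- r) h i s) (\sum_(i <- r) a i) (\sum_(i <- r) b i).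
Proof.
move=> H; elim: r => [|i r IH].
  by exists 0 => s; rewrite !big_nil horner0 mulr0 mul0r !addr0.
have [c e] := taylor1D (H i) IH; exists c => s.
by rewrite !big_cons -e.
Qed.

Lemma taylor1_eq0 h a b : taylor1 h a b -> (forall s, h s = 0) -> b = 0.
Proof.
move=> [c e] h0.
have a0 : a = 0 by have := h0 0; rewrite e expr0n /= mulr0 mul0r !addr0.
pose q := b%:P + 'X * c.
have hq s : s != 0 -> q.[s] = 0.
  move=> s0; have := h0 s; rewrite e a0 add0r /q !hornerE => hs.
  apply: (mulfI s0); rewrite mulr0 -[RHS]hs; ring.
have q0 : q = 0.
  apply/eqP; apply: contraT => qn0.
  have := @max_poly_roots _ q [seq i.+1%:R | i <- iota 0 (size q)] qn0.
  rewrite size_map size_iota ltnn; apply.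
    by apply/allP => x /mapP[i _ ->]; rewrite rootE hq // pnatr_eq0.
  by rewrite map_inj_uniq ?iota_uniq // => i j /eqP; rewrite eqr_nat => /eqP[].
by have := congr1 (horner^~ 0) q0; rewrite /q /= !hornerE.
Qed.
End Taylor.

Definition env_letter (rho : bool -> nat -> 'M[K]_(2 + 2)) (a : lletter) : 'M[K]_(2 + 2) :=
  if a.1.2 then symp_adj (rho a.1.1 a.2) else rho a.1.1 a.2.

Definition eval_term rho (t : term) : K :=
  t.1 * \prod_(w <- t.2) \tr (mxword (env_letter rho) w).

Definition eval_terms rho (F : seq term) : K := \sum_(t <- F) eval_term rho t.

Definition shift_env g i (rho : bool -> nat -> 'M[K]_(2 + 2)) (s : K) h (j : nat) :=
  if (h == g) && (j == 0%N) then rho h j + s *: rho g i.+1 else rho h j.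

Lemma env_letter_shift g i rho s a : env_letter (shift_env g i rho s) a =
  if (a.1.1 == g) && (a.2 == 0%N) then env_letter rho a + s *: env_letter rho (a.1, i.+1)
  else env_letter rho a.
Proof.
rewrite /env_letter /shift_env /=; case hc: (_ && _) => //; have /andP[/eqP -> _] := hc.
by case: a.1.2 => //; rewrite symp_adjD symp_adjZ.
Qed.

Lemma taylor1_word g i rho w (p q : 'I_(2 + 2)) :
  taylor1 (fun s => mxword (env_letter (shift_env g i rho s)) w p q)
    (mxword (env_letter rho) w p q)
    (\sum_(u <- polarize g i w) mxword (env_letter rho) u p q).
Proof.
elim: w p q => [|a w IH] p q.
  by rewrite /= big_nil mxword_nil; exists 0 => s; rewrite mxword_nil horner0 mulr0 mul0r !addr0.
have H1 k : taylor1 (fun s => env_letter (shift_env g i rho s) a p k) (env_letter rho a p k)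
    (if (a.1.1 == g) && (a.2 == 0%N) then env_letter rho (a.1, i.+1) p k else 0).
  exists 0 => s; rewrite env_letter_shift horner0 mulr0 addr0.
  by case: ifP => _; rewrite ?mul0r ?addr0 // !mxE mulrC.
have := taylor1_sum (index_enum _) (fun k => taylor1M (H1 k) (IH k q)).
case=> c e; exists c => s; rewrite mxword_cons mxE e; congr (_ + _ * _ + _).
  by rewrite mxword_cons mxE.
rewrite big_split /= big_cat big_map /=; congr (_ + _).
  case: ifP => _; last by rewrite big_nil big1 // => k _; rewrite mul0r.
  by rewrite big_seq1 mxword_cons mxE.
under eq_bigr do rewrite mulr_sumr.
rewrite exchange_big /=; apply: eq_bigr => u _.
by rewrite mxword_cons mxE.
Qed.

Lemma taylor1_words g i rho ws :
  taylor1 (fun s => \prod_(w <- ws) \tr (mxword (env_letter (shift_env g i rho s)) w))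
    (\prod_(w <- ws) \tr (mxword (env_letter rho) w))
    (\sum_(us <- polarize_words g i ws) \prod_(w <- us) \tr (mxword (env_letter rho) w)).
Proof.
elim: ws => [|w ws IH].
  by rewrite /= !big_nil; exists 0 => s; rewrite !big_nil horner0 mulr0 mul0r !addr0.
have H := taylor1_sum (index_enum _) (fun k => taylor1_word g i rho w k k).
have [c e] := taylor1M H IH; exists c => s.
rewrite !big_cons e; congr (_ + _ * _ + _).
rewrite big_cat !big_map; congr (_ + _).
  rewrite exchange_big mulr_suml; apply: eq_bigr => u _.
  by rewrite big_cons.
by rewrite mulr_sumr; apply: eq_bigr => us _; rewrite big_cons.
Qed.

Lemma polarize_eq0 g i F : (forall rho, eval_terms rho F = 0) ->
  forall rho, eval_terms rho (polarize_terms g i F) = 0.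
Proof.
move=> h rho.
have ht t : taylor1 (fun s => eval_term (shift_env g i rho s) t) (eval_term rho t)
    (eval_terms rho [seq (t.1, ws) | ws <- polarize_words g i t.2]).
  have [c e] := taylor1M (taylor1_cst t.1) (taylor1_words g i rho t.2).
  exists c => s; rewrite /eval_term e mul0r add0r; congr (_ + _ * _ + _).
  by rewrite /eval_terms big_map mulr_sumr.
have := taylor1_eq0 (taylor1_sum F ht) (fun s => h (shift_env g i rho s)).
by rewrite /eval_terms /polarize_terms big_flatten big_map.
Qed.

Definition generic g (w : seq lletter) : nat :=
  count (fun a : lletter => (a.1.1 == g) && (a.2 == 0%N)) w.

Lemma polarizeP g i w u : u \in polarize g i w ->
  [/\ map fst u = map fst w, (generic g u).+1 = generic g w,
      generic (~~ g) u = generic (~~ g) w &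
      perm_eq (map snd (filter (fun a : lletter => a.2 != 0%N) u))
              (i.+1 :: map snd (filter (fun a : lletter => a.2 != 0%N) w))].
Proof.
elim: w u => //= a w IH u; rewrite mem_cat => /orP[|/mapP[v /IH[h1 h2 h3 h4] ->]].
  case: ifP => // /andP[/eqP ha1 /eqP ha2]; rewrite inE => /eqP->.
  have hg : (g == ~~ g) = false by case: (g).
  by split; rewrite //= /generic /= ?ha1 ?ha2 /= ?eqxx ?hg ?add1n.
split; rewrite /generic /= -/(generic _ _) -/(generic _ _) ?h1 ?h3 //.
  by rewrite -/(generic g v) -/(generic g w) -h2 addnS.
case: ifP => // ha /=; apply: (@perm_trans _ (a.2 :: i.+1 :: [seq x.2 | x <- w & x.2 != 0%N])).
  by rewrite perm_cons.
by rewrite (perm_catCA [:: a.2] [:: i.+1]).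
Qed.

Lemma size_polarize g i w : size (polarize g i w) = generic g w.
Proof.
elim: w => //= a w IH; rewrite size_cat size_map IH /generic /=.
by case: (_ && _).
Qed.

Lemma polarize_wordsP g i ws us : us \in polarize_words g i ws ->
  [/\ size us = size ws,
      all (fun w => w != [::]) ws -> all (fun w => w != [::]) us,
      perm_eq (map snd (filter (fun a : lletter => a.2 != 0%N) (flatten us)))
        (i.+1 :: map snd (filter (fun a : lletter => a.2 != 0%N) (flatten ws))) &
      forall a, a \in flatten us -> a \in flatten ws \/ a.1.1 = g /\ a.2 = i.+1].
Proof.
elim: ws us => //= w ws IH us; rewrite mem_cat => /orP[] /mapP[u hu ->].
  have [h1 h2 h3 h4] := polarizeP hu; split=> //=.
  - move=> /andP[hw ->]; rewrite andbT -size_eq0 -(size_map fst u) h1 size_map size_eq0.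
    exact: hw.
  - by rewrite !filter_cat !map_cat -cat_cons perm_cat2r.
  - move=> a; rewrite !mem_cat => /orP[|->]; last by left; rewrite orbT.
    move: hu {h1 h2 h3 h4}; elim: w u => //= b w IHw u; rewrite mem_cat => /orP[].
      case: ifP => // /andP[/eqP hb _]; rewrite inE => /eqP->; rewrite !inE => /orP[/eqP->|->].
        by right.
      by left; rewrite orbT.
    move=> /mapP[x hx ->]; rewrite !inE => /orP[->|ha]; first by left.
    have [h|h] := IHw _ hx ha; last by right.
    by left; move: h => /orP[]->; rewrite ?orbT.
have [h1 h2 h3 h4] := IH _ hu; split=> /=.
- by rewrite h1.
- by move=> /andP[-> /h2].
- rewrite !filter_cat !map_cat; apply: perm_trans (perm_cat (perm_refl _) h3) _.
  by rewrite (perm_catCA _ [:: i.+1]).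
- move=> a; rewrite !mem_cat => /orP[->|/h4[->|]]; first by left.
    by left; rewrite orbT.
  by right.
Qed.

Fixpoint polarize_iter g k i (F : seq term) : seq term :=
  if k is k'.+1 then polarize_iter g k' i.+1 (polarize_terms g i F) else F.

Lemma polarize_iter_eq0 g k i F : (forall rho, eval_terms rho F = 0) ->
  forall rho, eval_terms rho (polarize_iter g k i F) = 0.
Proof. by elim: k i F => //= k IH i F h; apply: IH; apply: polarize_eq0. Qed.

Definition polarized (gl : nat -> bool) m (t : term) :=
  [/\ all (fun w => w != [::]) t.2,
      perm_eq (map snd (filter (fun a : lletter => a.2 != 0%N) (flatten t.2))) (iota 1 m) &
      forall a, a \in flatten t.2 -> a.2 != 0%N -> well_labelled gl a].

Lemma polarize_iter_polarized gl g k i F :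
  (forall j, (i < j <= i + k)%N -> gl j = g) ->
  (forall t, t \in F -> polarized gl i t) ->
  forall t, t \in polarize_iter g k i F -> polarized gl (i + k)%N t.
Proof.
elim: k i F => [|k IH] i F hg hF; first by rewrite addn0.
rewrite -addSnnS; apply: IH => [j /andP[h1 h2]|t].
  by apply: hg; rewrite -addSnnS h2 andbT; apply: ltnW.
move=> /flatten_mapP[u /hF[h1 h2 h3] /mapP[us hus ->]].
have [k1 k2 k3 k4] := polarize_wordsP hus; split.
- exact: k2.
- apply: (perm_trans k3); have -> : iota 1 i.+1 = iota 1 i ++ [:: i.+1].
    by rewrite -[i.+1]addn1 iotaD add1n addn1.
  by rewrite perm_sym perm_catC /= perm_cons perm_sym.
- move=> a /k4[/h3//|[ha1 ha2] _]; rewrite /well_labelled ha2 ha1 hg ?eqxx //.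
  by rewrite ltnSn /= -addSnnS leq_addr.
Qed.

Section LinearPart.
Variable Lam : seq letter -> K.

(** A polarization multiplies a term by the number of its generic letters of that type. Different
    bidegrees are therefore scaled differently and have to be kept apart. *)
Definition linear_part_at g a b (ws : seq (seq lletter)) : K :=
  if ws is [:: w] then
    if (generic g w == a) && (generic (~~ g) w == b) then Lam (map fst w) else 0
  else 0.

Definition sum_linear_part g a b (F : seq term) := \sum_(t <- F) t.1 * linear_part_at g a b t.2.

Lemma sum_linear_part_polarize g a b i F :
  sum_linear_part g a b (polarize_terms g i F) = a.+1%:R * sum_linear_part g a.+1 b F.
Proof.
rewrite /sum_linear_part /polarize_terms big_flatten big_map mulr_sumr.
apply: eq_bigr => -[c ws] _; rewrite big_map -mulr_sumr /= mulrCA; congr (_ * _).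
case: ws => [|w [|w' ws]] /=.
- by rewrite big_nil mulr0.
- rewrite cats0 big_map.
  transitivity (\sum_(u <- polarize g i w)
      (if (generic g w == a.+1) && (generic (~~ g) w == b) then Lam (map fst w) else 0)).
    rewrite big_seq [RHS]big_seq; apply: eq_bigr => u /polarizeP[h1 h2 h3 _].
    by rewrite /= -h2 eqSS h3 h1.
  rewrite big_const_seq count_predT size_polarize iter_addr_0.
  by case: ifP => [/andP[/eqP -> _]|_]; rewrite ?mul0rn ?mulr0 // mulr_natl.
- rewrite mulr0 big_seq big1 // => us; rewrite mem_cat => /orP[/mapP[u _ ->] //|].
  by move=> /mapP[x]; rewrite mem_cat => /orP[]/mapP[y _ ->] ->.
Qed.

Lemma sum_linear_part_iter g a b k i F : exists2 c : nat, (0 < c)%N &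
  sum_linear_part g a b (polarize_iter g k i F) = c%:R * sum_linear_part g (a + k)%N b F.
Proof.
elim: k i F => [|k IH] i F; first by exists 1%N; rewrite // addn0 mul1r.
have [c c0 e] := IH i.+1 (polarize_terms g i F).
exists (c * (a + k).+1)%N; first by rewrite muln_gt0 c0.
by rewrite /= e sum_linear_part_polarize natrM addnS mulrA.
Qed.

Lemma sum_linear_part_negb g a b F : sum_linear_part (~~ g) a b F = sum_linear_part g b a F.
Proof.
apply: eq_bigr => -[c [|w [|w' ws]]] _ //=.
by rewrite negbK andbC.
Qed.

Hypothesis Lam_cyc : forall u v, Lam (u ++ v) = Lam (v ++ u).
Hypothesis Lam_star : forall w, Lam (star w) = Lam w.
Hypothesis Lam_sym3 : forall u v w, u != [::] -> v != [::] -> w != [::] ->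
  Lam (u ++ v ++ w) + Lam (u ++ v ++ star w) + Lam (u ++ star v ++ w)
  + Lam (u ++ star v ++ star w) + Lam (star u ++ v ++ w) + Lam (star u ++ v ++ star w)
  + Lam (star u ++ star v ++ w) + Lam (star u ++ star v ++ star w) = 0.

Definition generic_word (w : seq letter) : seq lletter := [seq (l, 0%N) | l <- w].

Lemma sum_linear_part_eq0 (F : seq (K * seq (seq letter))) :
  (forall t, t \in F -> all (fun w => w != [::]) t.2) ->
  (forall z : mxpair K 2, \sum_(t <- F) t.1 * \prod_(w <- t.2) trace_word w z = 0) ->
  forall p q, sum_linear_part false p q [seq (t.1, map generic_word t.2) | t <- F] = 0.
Proof.
move=> hF hz p q; set F0 := map _ F.
have h0 rho : eval_terms rho F0 = 0.
  rewrite /eval_terms big_map -[RHS](hz (rho false 0%N, rho true 0%N)).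
  apply: eq_bigr => t _; rewrite /eval_term /= big_map; congr (_ * _).
  apply: eq_bigr => w _; congr (\tr _); rewrite /mxword big_map.
  by apply: eq_bigr => -[[] []].
pose gl j := (p < j)%N.
have inv0 t : t \in F0 -> polarized gl 0 t.
  move=> /mapP[u hu ->]; split=> /=.
  - by rewrite all_map; apply: sub_all (hF _ hu) => -[].
  - rewrite (_ : filter _ _ = [::]) //; elim: (u.2) => //= w ws IH.
    by rewrite filter_cat IH cats0 /generic_word; elim: w.
  - move=> a /flattenP[x /mapP[y _ ->] /mapP[l _ ->]] //.
pose F1 := polarize_iter false p 0 F0; pose F2 := polarize_iter true q p F1.
have inv1 : forall t, t \in F1 -> polarized gl p t.
  by apply: polarize_iter_polarized inv0 => j /andP[_]; rewrite add0n /gl ltnNge => ->.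
have inv2 : forall t, t \in F2 -> polarized gl (p + q)%N t.
  by apply: polarize_iter_polarized inv1 => j /andP[].
have h2 : forall rho, eval_terms rho F2 = 0.
  by do 2!apply: polarize_iter_eq0.
pose pure (t : term) := all (fun a : lletter => a.2 != 0%N) (flatten t.2).
have hpure t : t \in filter pure F2 -> [/\ all (fun w => w != [::]) t.2,
     all (well_labelled gl) (flatten t.2) & perm_eq (map snd (flatten t.2)) (iota 1 (p + q)%N)].
  rewrite mem_filter => /andP[/allP pt /inv2[k1 k2 k3]]; split=> //.
    by apply/allP => a ha; apply: k3 => //; apply: pt.
  by move: k2; rewrite (_ : filter _ _ = flatten t.2) //; apply/all_filterP/allP.
have hv v : \sum_(t <- filter pure F2) t.1 * \prod_(w <- t.2) \tr (mxword (rank_one_letter v) w) = 0.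
  (* Sending the remaining generic matrices to 0 leaves exactly the completely polarized terms,
     those of bidegree ([p], [q]). *)
  pose rho (h : bool) (j : nat) := if j == 0%N then 0 else rank_one (K := K) v j.
  rewrite -[RHS](h2 rho) /eval_terms [RHS](bigID pure) /= [X in _ = _ + X]big1 ?addr0.
    rewrite big_filter; apply: eq_bigr => t pt; congr (_ * _).
    rewrite big_seq [RHS]big_seq; apply: eq_bigr => w hw; congr (\tr _).
    rewrite /mxword big_seq [RHS]big_seq; apply: eq_bigr => a ha.
    have a0 : (a.2 == 0%N) = false.
      by apply/negbTE; move/allP: pt; apply; apply/flattenP; exists w.
    by rewrite /rank_one_letter /env_letter /rho a0.
  move=> t /allPn[a /flattenP[w hw ha]]; rewrite negbK => a0.
  rewrite /eval_term (perm_big _ (perm_to_rem hw)) big_cons /= (_ : mxword _ w = 0).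
    by rewrite mxtrace0 mul0r mulr0.
  case/splitPr: ha => u u'; rewrite mxword_cat mxword_cons /env_letter /rho a0.
  by case: a.1.2; rewrite ?symp_adj0 mul0mx mulmx0.
have := multilinear_sft Lam_cyc Lam_star Lam_sym3 hpure hv.
have -> : \sum_(t <- filter pure F2) t.1 * linear_part Lam t.2 = sum_linear_part false 0 0 F2.
  rewrite /sum_linear_part [RHS](bigID pure) /= big_filter [X in _ = _ + X]big1 ?addr0.
    apply: eq_bigr => -[c [|w [|w' ws]]] //= pt; congr (_ * _).
    rewrite /pure /= cats0 in pt.
    have hg h : generic h w = 0%N.
      apply/eqP; rewrite -leqn0 leqNgt -has_count; apply/hasPn => a ha.
      by move/allP: pt => /(_ _ ha) /negbTE ->; rewrite andbF.
    by rewrite !hg.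
  move=> -[c [|w [|w' ws]]]; rewrite /= ?mulr0 //.
  move=> /allPn[a]; rewrite /= cats0 => ha; rewrite negbK => a0.
  case: ifP; rewrite ?mulr0 // => /andP[/eqP g1 /eqP g2].
  have : (0 < generic a.1.1 w)%N by rewrite -has_count; apply/hasP; exists a; rewrite ?eqxx.
  by case: (a.1.1); rewrite ?g1 ?g2.
have [c1 c10 e1] := sum_linear_part_iter true 0 0 q p F1.
have [c2 c20 e2] := sum_linear_part_iter false 0 q p 0 F0.
rewrite -[false]/(~~ true) sum_linear_part_negb e1 -[true]/(~~ false) sum_linear_part_negb add0n e2.
move=> /eqP; rewrite !mulf_eq0 !pnatr_eq0 !eqn0Ngt c10 c20 /= => /eqP.
by rewrite add0n.
Qed.

(** Summing over all bidegrees recovers the whole linear part. Minimality rests on this: [Lam] of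
    the linear part depends only on the function, not on its expression as a polynomial in
    traces. *)
Theorem trace_sft (F : seq (K * seq (seq letter))) :
  (forall t, t \in F -> all (fun w => w != [::]) t.2) ->
  (forall z : mxpair K 2, \sum_(t <- F) t.1 * \prod_(w <- t.2) trace_word w z = 0) ->
  \sum_(t <- F) t.1 * (if t.2 is [:: w] then Lam w else 0) = 0.
Proof.
move=> hF hz; have h := sum_linear_part_eq0 hF hz.
pose N := (\max_(t <- F) \max_(w <- t.2) size w).+1.
transitivity (\sum_(p < N) \sum_(q < N)
    sum_linear_part false p q [seq (t.1, map generic_word t.2) | t <- F]); last first.
  by rewrite big1 // => p _; rewrite big1.
under [RHS]eq_bigr do under eq_bigr do rewrite /sum_linear_part big_map /=.
under [RHS]eq_bigr do rewrite exchange_big.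
rewrite exchange_big /= big_seq [RHS]big_seq; apply: eq_bigr => t ht.
under [RHS]eq_bigr do rewrite -mulr_sumr.
rewrite -mulr_sumr; congr (_ * _).
have hb : (\max_(w <- t.2) size w < N)%N.
  by rewrite ltnS (big_rem t) //= leq_max leqnn.
case: t.2 hb => [|w [|w' ws]] hb /=; first by rewrite big1 // => p _; rewrite big1.
  have hg g : (generic g (generic_word w) < N)%N.
    apply: leq_ltn_trans hb; rewrite big_seq1; apply: leq_trans (count_size _ _) _.
    by rewrite /generic_word size_map.
  rewrite (bigD1 (Ordinal (hg false))) //= [X in _ = _ + X]big1 ?addr0.
    rewrite (bigD1 (Ordinal (hg true))) //= [X in _ = _ + X]big1 ?addr0.
      rewrite !eqxx /= /generic_word -map_comp map_id_in //.
    by move=> q hq; rewrite eqxx /= ifF //; apply: contraNF hq => /eqP e; apply/eqP/val_inj.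
  move=> p hp; rewrite big1 // => q _; rewrite ifF //.
  by apply: contraNF hp => /andP[/eqP e _]; apply/eqP/val_inj.
by rewrite big1 // => p _; rewrite big1.
Qed.

End LinearPart.
End Polarization.

(** * The first fundamental theorem *)

Section ApolarPairing.
Variables (K : numFieldType) (n : nat).
Implicit Types (P Q F : {mpoly K[n]}) (m : 'X_{1..n}).

Definition mfact m : nat := (\prod_i (m i)`!)%N.

(** The value at 0 of P(d/dv) applied to F. Multiplication by a variable is adjoint to
    differentiation, and positivity on real polynomials makes the final constant [apolar Q Q]
    nonzero. *)
Definition apolar P F : K := \sum_(m <- msupp P) P@_m * (F@_m *+ mfact m).

Lemma apolarE (d : seq 'X_{1..n}) P F : uniq d -> {subset msupp P <= d} ->
  apolar P F = \sum_(m <- d) P@_m * (F@_m *+ mfact m).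
Proof.
move=> ud hd; rewrite /apolar.
have hp : perm_eq (msupp P) (filter (mem (msupp P)) d).
  apply: uniq_perm; rewrite ?msupp_uniq ?filter_uniq // => m.
  by rewrite mem_filter /=; case: (boolP (m \in msupp P)) => // /hd ->.
rewrite (perm_big _ hp) big_filter [RHS](bigID (mem (msupp P))) /= [X in _ + X]big1 ?addr0 //.
by move=> m hm; rewrite (memN_msupp_eq0 hm) mul0r.
Qed.

Lemma apolarDl P Q F : apolar (P + Q) F = apolar P F + apolar Q F.
Proof.
pose d := undup (msupp P ++ msupp Q).
have ud : uniq d by apply: undup_uniq.
rewrite !(@apolarE d) //.
- by rewrite -big_split; apply: eq_bigr => m _; rewrite mcoeffD mulrDl.
- by move=> m hm; rewrite mem_undup mem_cat hm orbT.
- by move=> m hm; rewrite mem_undup mem_cat hm.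
- by move=> m /msuppD_le; rewrite mem_undup.
Qed.

Lemma apolarZl c P F : apolar (c *: P) F = c * apolar P F.
Proof.
rewrite (@apolarE (msupp P)) ?msupp_uniq //; last exact: msuppZ_le.
by rewrite mulr_sumr; apply: eq_bigr => m _; rewrite mcoeffZ mulrA.
Qed.

Lemma apolarDr P F G : apolar P (F + G) = apolar P F + apolar P G.
Proof. by rewrite -big_split; apply: eq_bigr => m _; rewrite mcoeffD mulrnDl mulrDr. Qed.

Lemma apolarZr c P F : apolar P (c *: F) = c * apolar P F.
Proof.
rewrite mulr_sumr; apply: eq_bigr => m _.
by rewrite mcoeffZ -mulrnAr mulrCA.
Qed.

Lemma apolar0r P : apolar P 0 = 0.
Proof. by rewrite /apolar big1 // => m _; rewrite mcoeff0 mul0rn mulr0. Qed.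

Lemma apolar1 F : apolar 1 F = F@_0%MM.
Proof.
rewrite /apolar msupp1 big_seq1 mcoeff1 eqxx mul1r /mfact big1 // => i _.
by rewrite mnm0E.
Qed.

Lemma mfactS m k : mfact (m + U_(k))%MM = ((m k).+1 * mfact m)%N.
Proof.
rewrite /mfact (bigD1 k) //= [in RHS](bigD1 k) //= mnmDE mnmE eqxx addn1 factS -!mulnA.
congr (_ * (_ * _))%N; apply: eq_bigr => i hi.
by rewrite mnmDE mnmE eq_sym (negbTE hi) addn0.
Qed.

Lemma apolar_mulX k P F : apolar ('X_k * P) F = apolar P F^`M(k).
Proof.
rewrite mulrC /apolar (perm_big _ (msuppMX _ _)) big_map.
apply: eq_bigr => m _; rewrite mcoeffMX mcoeff_deriv.
by rewrite addmC mfactS mulrnA.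
Qed.

Definition real_coefs Q := forall m, Q@_m \is Num.real.

Lemma apolar_gt0 Q : Q != 0 -> real_coefs Q -> 0 < apolar Q Q.
Proof.
move=> Q0 hQ; rewrite /apolar.
have hpos m : 0 <= Q@_m * (Q@_m *+ mfact m).
  by rewrite mulrnAr mulrn_wge0 // -expr2 real_exprn_even_ge0.
have [m hm] : exists m, m \in msupp Q.
  by case: (msupp Q) (msupp_eq0 Q) => [|m s] h; [move: Q0; rewrite -h | exists m; rewrite mem_head].
rewrite (big_rem m) //=; apply: ltr_wpDr; first by apply: sumr_ge0.
rewrite lt_neqAle hpos andbT eq_sym mulf_neq0 -?mcoeff_msupp //.
rewrite -mulr_natr mulf_neq0 -?mcoeff_msupp //.
by rewrite pnatr_eq0 -lt0n /mfact prodn_gt0 // => i; apply: fact_gt0.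
Qed.

Lemma real_coefsD P Q : real_coefs P -> real_coefs Q -> real_coefs (P + Q).
Proof. by move=> h1 h2 m; rewrite mcoeffD rpredD. Qed.

Lemma real_coefsM P Q : real_coefs P -> real_coefs Q -> real_coefs (P * Q).
Proof. by move=> h1 h2 m; rewrite mcoeffM rpred_sum // => i _; rewrite rpredM. Qed.

Lemma real_coefsC c : c \is Num.real -> real_coefs c%:MP.
Proof. by move=> hc m; rewrite mcoeffC rpredM // realn. Qed.

Lemma real_coefs_mnm k : real_coefs 'X_k.
Proof. by move=> m; rewrite mcoeffX realn. Qed.

Lemma real_coefs_sum I (r : seq I) (Q : I -> {mpoly K[n]}) :
  (forall i, real_coefs (Q i)) -> real_coefs (\sum_(i <- r) Q i).
Proof.
move=> h; elim: r => [|i r IH]; first by move=> m; rewrite big_nil mcoeff0 real0.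
by rewrite big_cons; apply: real_coefsD.
Qed.

Definition adjoint Q (T : {mpoly K[n]} -> {mpoly K[n]}) :=
  forall P F, apolar (Q * P) F = apolar P (T F).

Lemma adjointD Q1 Q2 T1 T2 : adjoint Q1 T1 -> adjoint Q2 T2 ->
  adjoint (Q1 + Q2) (fun F => T1 F + T2 F).
Proof. by move=> h1 h2 P F; rewrite mulrDl apolarDl h1 h2 apolarDr. Qed.

Lemma adjointZ c Q T : adjoint Q T -> adjoint (c *: Q) (fun F => c *: T F).
Proof. by move=> h P F; rewrite -scalerAl apolarZl h apolarZr. Qed.

Lemma adjointM Q1 Q2 T1 T2 : adjoint Q1 T1 -> adjoint Q2 T2 ->
  adjoint (Q1 * Q2) (fun F => T2 (T1 F)).
Proof. by move=> h1 h2 P F; rewrite -mulrA h1 h2. Qed.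

Lemma adjoint0 : adjoint 0 (fun=> 0).
Proof. by move=> P F; rewrite mul0r apolar0r /apolar msupp0 big_nil. Qed.

Lemma adjoint_sum I (r : seq I) (Q : I -> {mpoly K[n]}) T : (forall i, adjoint (Q i) (T i)) ->
  adjoint (\sum_(i <- r) Q i) (fun F => \sum_(i <- r) T i F).
Proof.
move=> h; elim: r => [|i r IH] P F; first by rewrite !big_nil adjoint0.
by rewrite !big_cons (adjointD (h i) IH).
Qed.

End ApolarPairing.

Section InfiniteField.
Variable K : numFieldType.

(** Kronecker substitution: [B] exceeds all exponents, so t^(B^i) in place of the i-th variable
    sends distinct monomials to distinct powers of t, by uniqueness of digits in base [B]. *)
Lemma mpoly_eq0_eval n (p : {mpoly K[n]}) : (forall v, p.@[v] = 0) -> p = 0.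
Proof.
move=> hp; apply/eqP; apply: contraT => p0.
pose B := msize p.
pose w (m : 'X_{1..n}) : nat := (\sum_(i < n) m i * B ^ i)%N.
pose h (t : K) (i : 'I_n) := t ^+ (B ^ i).
pose q : {poly K} := \sum_(m <- msupp p) p@_m *: 'X^(w m).
have hq t : q.[t] = 0.
  rewrite -[RHS](hp (h t)) mevalE horner_sum; apply: eq_bigr => m _.
  rewrite !hornerE; congr (_ * _); rewrite /h /w -prodrXr.
  by apply: eq_bigr => i _; rewrite -exprM mulnC.
have q0 : q = 0.
  apply/eqP; apply: contraT => qn0.
  have := @max_poly_roots _ q [seq i%:R | i <- iota 0 (size q)] qn0.
  rewrite size_map size_iota ltnn; apply.
    by apply/allP => x /mapP[i _ ->]; rewrite rootE hq.
  by rewrite map_inj_uniq ?iota_uniq // => i j /eqP; rewrite eqr_nat => /eqP.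
have winj m m' : m \in msupp p -> m' \in msupp p -> w m = w m' -> m = m'.
  move=> hm hm' /eqP hw.
  have hlt (x : 'X_{1..n}) i : x \in msupp p -> (x i < B)%N.
    move=> hx; apply: leq_ltn_trans (msize_mdeg_lt hx).
    by rewrite mdegE (bigD1 i) //= leq_addr.
  apply/mnmP => i.
  have key : forall k (a b : 'I_k -> nat), (forall i, a i < B)%N -> (forall i, b i < B)%N ->
     (\sum_(i < k) a i * B ^ i = \sum_(i < k) b i * B ^ i)%N -> forall i, a i = b i.
    elim=> [|k IH] a b ha hb; first by move=> _ [].
    rewrite !big_ord_recl /= expn0 !muln1.
    have E (c : 'I_k.+1 -> nat) : (\sum_(i < k) c (lift ord0 i) * B ^ bump 0 i
      = (\sum_(i < k) c (lift ord0 i) * B ^ i) * B)%N.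
      by rewrite big_distrl; apply: eq_bigr => j _; rewrite /bump leq0n add1n expnSr mulnA.
    rewrite !E => e.
    have B0 : (0 < B)%N by apply: leq_ltn_trans (ha ord0).
    have e0 : a ord0 = b ord0.
      by have := congr1 (modn^~ B) e; rewrite ![(_ + _ * B)%N]addnC !modnMDl !modn_small.
    have e1 := congr1 (divn^~ B) e; rewrite !divnDMl // !divn_small ?add0n // in e1.
    move=> j; case: (unliftP ord0 j) => [j' ->|-> //].
    exact: (IH _ _ (fun i => ha _) (fun i => hb _) e1).
  by apply: (key n (fun i => m i) (fun i => m' i)) => [j|j|]; [exact: hlt|exact: hlt|exact/eqP].
have [m hm] : exists m, m \in msupp p.
  by case: (msupp p) (msupp_eq0 p) => [|m s] h'; [move: p0; rewrite -h' | exists m; rewrite mem_head].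
have := congr1 (fun q : {poly K} => q`_(w m)) q0; rewrite coef0 coef_sum (big_rem m) //=.
rewrite coefZ coefXn eqxx mulr1 big_seq big1 ?addr0 => [/eqP|m' hm'].
  by move: hm; rewrite mcoeff_msupp => /negbTE ->.
move: hm'; rewrite mem_rem_uniq ?msupp_uniq // inE => /andP[hne hm'].
rewrite coefZ coefXn; case: eqP => e; last by rewrite mulr0.
by rewrite (winj _ _ hm' hm (esym e)) eqxx in hne.
Qed.
End InfiniteField.

Section WordEvaluation.
Variables (K : fieldType) (n : nat).
Implicit Types (z : mxpair K n) (w : word).

Lemma eval_wordE w z : eval_word w z = mxword (eval_letter z) w.
Proof. by []. Qed.

Lemma eval_word_cat u w z : eval_word (u ++ w) z = eval_word u z *m eval_word w z.
Proof. by rewrite !eval_wordE mxword_cat. Qed.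

Lemma eval_letter_star z l : eval_letter z (star_letter l) = symp_adj (eval_letter z l).
Proof. by case: l => a [] //; rewrite /eval_letter /= symp_adjK. Qed.

Lemma eval_word_star w z : eval_word (star w) z = symp_adj (eval_word w z).
Proof.
elim: w => [|l w IH]; first by rewrite !eval_wordE mxword_nil symp_adj1.
rewrite -cat1s star_cat !eval_word_cat IH symp_adjM; congr (_ *m _).
by rewrite /star /= !eval_wordE !mxword_cons !mxword_nil !mulmx1 eval_letter_star.
Qed.

End WordEvaluation.

(** * Pairings of four generic vectors and their contraction *)

Section Contractions.
Variable K : numFieldType.
Local Notation J := (symp_form K 2).
Local Notation B := {mpoly K[(2 + 2) * (2 + 2)]}.
Implicit Types W : 'M[K]_(2 + 2).

Definition coord_index (a i : 'I_(2 + 2)) : 'I_((2 + 2) * (2 + 2)) := mxvec_index a i.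
(** The columns are the generic vectors v_i. Then [frame_form W k l] is the pairing (v_k, W v_l),
    and column l of [frame_grad W] is its gradient in the left argument. *)
Definition frame : 'M[B]_(2 + 2) := \matrix_(a, i) 'X_(coord_index a i).
Definition cst_mx (W : 'M[K]_(2 + 2)) : 'M[B]_(2 + 2) := map_mx (@mpolyC _ K) W.
Definition frame_form W : 'M[B]_(2 + 2) := frame^T *m cst_mx (J *m W) *m frame.
Definition frame_grad W : 'M[B]_(2 + 2) := cst_mx (J *m W) *m frame.

Lemma cst_mxM W W' : cst_mx (W *m W') = cst_mx W *m cst_mx W'.
Proof. exact: map_mxM. Qed.

Lemma frame_deriv a i b j : (frame b j)^`M(coord_index a i) = ((a == b) && (i == j))%:R.
Proof.
rewrite mxE mderivX mnmE.
have -> : (coord_index b j == coord_index a i) = ((a == b) && (i == j)).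
  apply/eqP/andP => [e|[/eqP-> /eqP->] //].
  have : enum_val (cast_ord (esym (mxvec_cast _ _)) (coord_index b j))
       = enum_val (cast_ord (esym (mxvec_cast _ _)) (coord_index a i)) by rewrite e.
  by rewrite /coord_index /mxvec_index !cast_ordK !enum_rankK => -[-> ->].
case: andP => [[/eqP-> /eqP->]|_]; last by rewrite scale0r.
rewrite scale1r (_ : (U_(_) - U_(_))%MM = 0%MM) ?mpolyX0 //.
by apply/mnmP => q; rewrite mnmBE mnm0E subnn.
Qed.

Lemma adj_transpose W : W^T *m J = J *m symp_adj W.
Proof. by rewrite /symp_adj !mulmxA mulmxV ?mul1mx // symp_form_unit. Qed.

Lemma frame_form_grad W k l : frame_form W k l = \sum_b frame b k * frame_grad W b l.
Proof. by rewrite /frame_form -mulmxA mxE; apply: eq_bigr => b _; rewrite mxE. Qed.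

Lemma grad_deriv W a i b l :
  (frame_grad W b l)^`M(coord_index a i) = ((J *m W) b a)%:MP *+ (i == l).
Proof.
rewrite mxE linear_sum /= (bigD1 a) //= big1 ?addr0 => [|c hc]; rewrite [cst_mx _ _ _]mxE.
  rewrite mderiv_mulC frame_deriv eqxx /=.
  by case: (i == l); rewrite ?mulr1 ?mulr0.
by rewrite mderiv_mulC frame_deriv eq_sym (negbTE hc) mulr0.
Qed.

(** The second term comes from (v_k, W v_l) = - (v_l, W' v_k) with W' the adjoint of W, which moves
    the differentiated vector to the left. *)
Lemma form_deriv W a i k l : (frame_form W k l)^`M(coord_index a i) =
  frame_grad W a l *+ (i == k) - frame_grad (symp_adj W) a k *+ (i == l).
Proof.
rewrite frame_form_grad linear_sum /=.
under eq_bigr do rewrite mderivM frame_deriv grad_deriv.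
rewrite big_split /=; congr (_ + _).
  rewrite (bigD1 a) //= eqxx /= big1 ?addr0 => [|b hb].
    by case: (i == k); rewrite ?mul1r ?mul0r.
  by rewrite eq_sym (negbTE hb) mul0r.
case: (i == l); last by rewrite mulr0n oppr0 big1 // => b _; rewrite mulr0n mulr0.
rewrite mulr1n /frame_grad -adj_transpose mxE -sumrN; apply: eq_bigr => b _.
rewrite mulr1n [cst_mx _ _ _]mxE mulrC -mulNr; congr (_ * _).
rewrite -mpolyCN; congr (_%:MP).
have -> : W^T *m J = - (J *m W)^T by rewrite trmx_mul symp_formT mulmxN opprK.
by rewrite !mxE opprK.
Qed.

(** [contract i j] arises from the pairing (v_i, v_j) when coordinates become derivatives; [bracket]
    collects the mixed terms of this second-order operator on a product. *)
Definition bracket (i j : 'I_(2 + 2)) (F G : B) : B :=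
  \sum_a \sum_b J a b *: (F^`M(coord_index a i) * G^`M(coord_index b j)).
Definition contract (i j : 'I_(2 + 2)) (F : B) : B :=
  \sum_a \sum_b J a b *: F^`M(coord_index a i)^`M(coord_index b j).

Lemma bracketMl i j F1 F2 G :
  bracket i j (F1 * F2) G = F1 * bracket i j F2 G + F2 * bracket i j F1 G.
Proof.
rewrite /bracket !mulr_sumr -big_split; apply: eq_bigr => a _.
rewrite !mulr_sumr -big_split; apply: eq_bigr => b _ /=.
rewrite mderivM -!scalerAr -scalerDr; congr (_ *: _); ring.
Qed.

Lemma bracketMr i j F G1 G2 :
  bracket i j F (G1 * G2) = G1 * bracket i j F G2 + G2 * bracket i j F G1.
Proof.
rewrite /bracket !mulr_sumr -big_split; apply: eq_bigr => a _.
rewrite !mulr_sumr -big_split; apply: eq_bigr => b _ /=.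
rewrite mderivM -!scalerAr -scalerDr; congr (_ *: _); ring.
Qed.

Lemma bracketDl i j F1 F2 G : bracket i j (F1 + F2) G = bracket i j F1 G + bracket i j F2 G.
Proof.
rewrite /bracket -big_split; apply: eq_bigr => a _.
rewrite -big_split; apply: eq_bigr => b _ /=.
by rewrite mderivD mulrDl scalerDr.
Qed.

Lemma bracketDr i j F G1 G2 : bracket i j F (G1 + G2) = bracket i j F G1 + bracket i j F G2.
Proof.
rewrite /bracket -big_split; apply: eq_bigr => a _.
rewrite -big_split; apply: eq_bigr => b _ /=.
by rewrite mderivD mulrDr scalerDr.
Qed.

Lemma bracketCl i j c G : bracket i j c%:MP G = 0.
Proof. by rewrite /bracket big1 // => a _; rewrite big1 // => b _; rewrite mderivC mul0r scaler0. Qed.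

Lemma bracketCr i j c F : bracket i j F c%:MP = 0.
Proof. by rewrite /bracket big1 // => a _; rewrite big1 // => b _; rewrite mderivC mulr0 scaler0. Qed.

Lemma contractM i j F G : contract i j (F * G) =
  contract i j F * G + F * contract i j G + bracket i j F G + bracket i j G F.
Proof.
rewrite /contract /bracket mulr_suml mulr_sumr -!big_split; apply: eq_bigr => a _ /=.
rewrite mulr_suml mulr_sumr -!big_split; apply: eq_bigr => b _ /=.
rewrite mderivM mderivD !mderivM -!scalerAl -!scalerAr -!scalerDr; congr (_ *: _); ring.
Qed.

Lemma contractD i j F G : contract i j (F + G) = contract i j F + contract i j G.
Proof.
rewrite /contract -big_split; apply: eq_bigr => a _.
rewrite -big_split; apply: eq_bigr => b _ /=.
by rewrite !mderivD scalerDr.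
Qed.

Lemma contractC i j c : contract i j c%:MP = 0.
Proof. by rewrite /contract big1 // => a _; rewrite big1 // => b _; rewrite mderivC mderiv0 scaler0. Qed.

(** Contracting the open ends of two pairings glues them into a single one, whose word is a
    concatenation. *)
Lemma grad_pairing W W' k l :
  \sum_a \sum_b J a b *: (frame_grad W a k * frame_grad W' b l)
  = frame_form (symp_adj W *m W') k l.
Proof.
have -> : frame_form (symp_adj W *m W') = (frame_grad W)^T *m cst_mx J *m frame_grad W'.
  have hA := adj_transpose W; move: (symp_adj W) hA => A hA.
  rewrite /frame_form /frame_grad trmx_mul -!mulmxA; congr (_ *m _).
  rewrite [RHS]mulmxA [RHS]mulmxA; congr (_ *m frame).
  have -> : (cst_mx (J *m W))^T = cst_mx ((J *m W)^T) by rewrite /cst_mx map_trmx.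
  rewrite -!cst_mxM; congr cst_mx.
  rewrite mulmxA -hA trmx_mul symp_formT.
  rewrite -!mulmxA [J *m (J *m _)]mulmxA symp_form_sqr !(mulNmx, mulmxN) mul1mx.
  by rewrite ?opprK.
rewrite [RHS]mxE exchange_big; apply: eq_bigr => b _.
rewrite [X in _ = X * _]mxE mulr_suml; apply: eq_bigr => a _.
rewrite [(frame_grad W)^T _ _]mxE [cst_mx _ _ _]mxE -mul_mpolyC.
by rewrite mulrA [_%:MP * _]mulrC.
Qed.

Lemma bracket_form i j W W' k l k' l' :
  bracket i j (frame_form W k l) (frame_form W' k' l') =
  frame_form (symp_adj W *m W') l l' *+ ((i == k) && (j == k'))
  - frame_form (symp_adj W *m symp_adj W') l k' *+ ((i == k) && (j == l'))
  - frame_form (W *m W') k l' *+ ((i == l) && (j == k'))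
  + frame_form (W *m symp_adj W') k k' *+ ((i == l) && (j == l')).
Proof.
have e1 := grad_pairing W W' l l'.
have e2 := grad_pairing W (symp_adj W') l k'.
have e3 := grad_pairing (symp_adj W) W' k l'.
have e4 := grad_pairing (symp_adj W) (symp_adj W') k k'.
rewrite symp_adjK in e3; rewrite symp_adjK in e4.
transitivity ((\sum_a \sum_b J a b *: (frame_grad W a l * frame_grad W' b l')) *+ ((i == k) && (j == k'))
  - (\sum_a \sum_b J a b *: (frame_grad W a l * frame_grad (symp_adj W') b k')) *+ ((i == k) && (j == l'))
  - (\sum_a \sum_b J a b *: (frame_grad (symp_adj W) a k * frame_grad W' b l')) *+ ((i == l) && (j == k'))
  + (\sum_a \sum_b J a b *: (frame_grad (symp_adj W) a k * frame_grad (symp_adj W') b k')) *+ ((i == l) && (j == l')));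
  last by congr (_ *+ _ - _ *+ _ - _ *+ _ + _ *+ _).
rewrite /bracket -!sumrMnl -!sumrN -!big_split.
apply: eq_bigr => a _ /=; rewrite -!sumrMnl -!sumrN -!big_split.
apply: eq_bigr => b _ /=; rewrite !form_deriv; move: (J a b) => c.
move: (frame_grad _ _ _) (frame_grad _ _ _) (frame_grad _ _ _) (frame_grad _ _ _) => x y z t.
case: (i == k); case: (i == l); case: (j == k'); case: (j == l') => /=.
all: rewrite ?mulr1n ?mulr0n ?subr0 ?sub0r ?addr0 ?oppr0 ?subr0 ?addr0 ?add0r ?mulr0 ?mul0r ?scaler0 //.
all: rewrite -!mul_mpolyC; move: (c%:MP) => c'; ring.
Qed.

(** Contracting the two vectors of one pairing closes it to a cycle; this is where traces arise. *)
Lemma contract_form i j W k l :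
  contract i j (frame_form W k l) =
  (\tr W *+ ((i == k) && (j == l)) - \tr W *+ ((i == l) && (j == k)))%:MP.
Proof.
have trJ (X : 'M[K]_(2 + 2)) : \sum_a \sum_b J a b * (J *m X) a b = \tr X.
  rewrite -[X in \tr X]mul1mx -[1%:M](opprK) -symp_form_sqr -mulNmx -symp_formT -mulmxA.
  rewrite /mxtrace exchange_big; apply: eq_bigr => a _.
  by rewrite mxE; apply: eq_bigr => b _; rewrite [in RHS]mxE.
rewrite -[in X in _ - X](tr_symp_adj W) -!trJ -!sumrMnl -sumrB raddf_sum /contract.
apply: eq_bigr => a _; rewrite -!sumrMnl -sumrB raddf_sum; apply: eq_bigr => b _.
rewrite form_deriv mderivB !mderivMn !grad_deriv -!mulrnA ![((_ == _) * _)%N]mulnb.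
rewrite ![(j == _) && _]andbC -mul_mpolyC mulrBr !mulrnAr -!mpolyCM.
by rewrite raddfB !raddfMn.
Qed.

End Contractions.

(** * Covariants and the operators that act on them *)

Section FirstFundamental.
Variable K : numClosedFieldType.
Local Notation J := (symp_form K 2).
Local Notation B := {mpoly K[(2 + 2) * (2 + 2)]}.
Variable A : set (mxpair K 2 -> K).
Hypothesis subA : subalgebra A.
Hypothesis traceA : forall w : word, A (trace_word w).

(* Polynomial functions of four generic vectors v_0, ..., v_3, built from the
   pairings (v_k, w v_l) and from the functions in [A]. Contracting v_i with v_j
   preserves this class. *)
Inductive covariant : (mxpair K 2 -> B) -> Prop :=
| covariant_base g : A g -> covariant (fun z => (g z)%:MP)
| covariant_form w k l : covariant (fun z => frame_form (eval_word w z) k l)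
| covariantD F G : covariant F -> covariant G -> covariant (fun z => F z + G z)
| covariantM F G : covariant F -> covariant G -> covariant (fun z => F z * G z).

Lemma covariant_ext F G : covariant F -> F =1 G -> covariant G.
Proof. by move=> h /funext <-. Qed.

Lemma covariantC c : covariant (fun=> c%:MP).
Proof. by apply: (covariant_base (g := cst c)); case: subA. Qed.

Lemma covariantZ c F : covariant F -> covariant (fun z => c *: F z).
Proof.
move=> h; apply: covariant_ext (covariantM (covariantC c) h) _ => z.
by rewrite mul_mpolyC.
Qed.

Lemma covariantN F : covariant F -> covariant (fun z => - F z).
Proof. by move/(covariantZ (-1)) => h; apply: covariant_ext h _ => z; rewrite scaleN1r. Qed.

Lemma covariant_sum I (r : seq I) F : (forall i, covariant (F i)) ->
  covariant (fun z => \sum_(i <- r) F i z).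
Proof.
move=> h; elim: r => [|i r IH].
  by apply: covariant_ext (covariantC 0) _ => z; rewrite big_nil mpolyC0.
by apply: covariant_ext (covariantD (h i) IH) _ => z; rewrite big_cons.
Qed.

Lemma covariant_prod I (r : seq I) F : (forall i, covariant (F i)) ->
  covariant (fun z => \prod_(i <- r) F i z).
Proof.
move=> h; elim: r => [|i r IH].
  by apply: covariant_ext (covariantC 1) _ => z; rewrite big_nil mpolyC1.
by apply: covariant_ext (covariantM (h i) IH) _ => z; rewrite big_cons.
Qed.

Lemma covariantX F m : covariant F -> covariant (fun z => F z ^+ m).
Proof.
move=> h; elim: m => [|m IH].
  by apply: covariant_ext (covariantC 1) _ => z; rewrite expr0 mpolyC1.
by apply: covariant_ext (covariantM h IH) _ => z; rewrite exprS.
Qed.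

Lemma covariantMn F b : covariant F -> covariant (fun z => F z *+ (b : bool)).
Proof.
case: b => h; first exact: h.
by apply: covariant_ext (covariantC 0) _ => z; rewrite mulr0n mpolyC0.
Qed.

Lemma covariant_word u w k l : covariant (fun z => frame_form (eval_word u z *m eval_word w z) k l).
Proof.
by apply: covariant_ext (covariant_form (u ++ w) k l) _ => z; rewrite eval_word_cat.
Qed.

Lemma covariant_bracket i j F G : covariant F -> covariant G ->
  covariant (fun z => bracket i j (F z) (G z)).
Proof.
move=> hF hG; elim: hF => {F} [g _|w k l|F1 F2 _ h1 _ h2|F1 F2 k1 h1 k2 h2].
- by apply: covariant_ext (covariantC 0) _ => z; rewrite bracketCl mpolyC0.
- elim: hG => {G} [g _|w' k' l'|G1 G2 _ h1 _ h2|G1 G2 k1 h1 k2 h2].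
  + by apply: covariant_ext (covariantC 0) _ => z; rewrite bracketCr mpolyC0.
  + have c1 := covariantMn ((i == k) && (j == k')) (covariant_word (star w) w' l l').
    have c2 := covariantMn ((i == k) && (j == l')) (covariant_word (star w) (star w') l k').
    have c3 := covariantMn ((i == l) && (j == k')) (covariant_word w w' k l').
    have c4 := covariantMn ((i == l) && (j == l')) (covariant_word w (star w') k k').
    apply: covariant_ext (covariantD (covariantD (covariantD c1 (covariantN c2)) (covariantN c3)) c4) _.
    by move=> z; rewrite bracket_form !eval_word_star.
  + by apply: covariant_ext (covariantD h1 h2) _ => z; rewrite bracketDr.
  + by apply: covariant_ext (covariantD (covariantM k1 h2) (covariantM k2 h1)) _ => z; rewrite bracketMr.
- by apply: covariant_ext (covariantD h1 h2) _ => z; rewrite bracketDl.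
- by apply: covariant_ext (covariantD (covariantM k1 h2) (covariantM k2 h1)) _ => z; rewrite bracketMl.
Qed.

Lemma covariant_contract i j F : covariant F -> covariant (fun z => contract i j (F z)).
Proof.
elim=> {F} [g _|w k l|F1 F2 _ h1 _ h2|F1 F2 k1 h1 k2 h2].
- by apply: covariant_ext (covariantC 0) _ => z; rewrite contractC mpolyC0.
- have h := covariant_base (traceA w).
  apply: covariant_ext (covariantD (covariantMn ((i == k) && (j == l)) h)
    (covariantN (covariantMn ((i == l) && (j == k)) h))) _ => z.
  by rewrite contract_form raddfB !raddfMn.
- by apply: covariant_ext (covariantD h1 h2) _ => z; rewrite contractD.
- have b1 := covariant_bracket i j k1 k2; have b2 := covariant_bracket i j k2 k1.
  apply: covariant_ext (covariantD (covariantD (covariantD (covariantM h1 k2) (covariantM k1 h2)) b1) b2) _.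
  by move=> z; rewrite contractM.
Qed.

Lemma mcoeff0M (p q : B) : (p * q)@_0%MM = p@_0%MM * q@_0%MM.
Proof. exact: rmorphM. Qed.

Lemma frame_form_coef0 W k l : (frame_form (K := K) W k l)@_0%MM = 0.
Proof.
rewrite frame_form_grad raddf_sum big1 // => b _ /=.
rewrite mcoeff0M mxE mcoeffX; case: eqP => [/mnmP/(_ (coord_index b k))|_]; last by rewrite mul0r.
by rewrite mnmE mnm0E eqxx.
Qed.

(** Pairings have no constant term, so only elements of [A] contribute. *)
Lemma covariant_coef0 F : covariant F -> A (fun z => (F z)@_0%MM).
Proof.
have [Ac AD AM] := subA.
elim=> {F} [g hg|w k l|F1 F2 _ h1 _ h2|F1 F2 k1 h1 k2 h2].
- by rewrite (_ : (fun _ => _) = g) //; apply/funext => z; rewrite mcoeffC eqxx mulr1.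
- by rewrite (_ : (fun _ => _) = cst 0) //; apply/funext => z; rewrite frame_form_coef0.
- by rewrite (_ : (fun _ => _) = (fun z => (F1 z)@_0%MM) \+ (fun z => (F2 z)@_0%MM)); [exact: AD|apply/funext => z; rewrite mcoeffD].
- by rewrite (_ : (fun _ => _) = (fun z => (F1 z)@_0%MM) \* (fun z => (F2 z)@_0%MM)); [exact: AM|apply/funext => z; rewrite mcoeff0M].
Qed.

(* The operator Q(d/dv), the symplectic form being used to identify the space
   with its dual. *)
Definition dual_operator (Q : B) :=
  exists T : B -> B, adjoint Q T /\ forall F, covariant F -> covariant (fun z => T (F z)).

Lemma dual_operatorD Q1 Q2 : dual_operator Q1 -> dual_operator Q2 -> dual_operator (Q1 + Q2).
Proof.
move=> [T1 [h1 k1]] [T2 [h2 k2]]; exists (fun F => T1 F + T2 F); split=> [|F hF].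
  exact: adjointD.
by apply: covariantD; [exact: k1 | exact: k2].
Qed.

Lemma dual_operatorM Q1 Q2 : dual_operator Q1 -> dual_operator Q2 -> dual_operator (Q1 * Q2).
Proof.
move=> [T1 [h1 k1]] [T2 [h2 k2]]; exists (fun F => T2 (T1 F)); split=> [|F hF].
  exact: adjointM.
by apply: k2; apply: k1.
Qed.

Lemma dual_operatorN Q : dual_operator Q -> dual_operator (- Q).
Proof.
move=> [T [h k]]; exists (fun F => -1 *: T F); split=> [|F hF].
  by rewrite -scaleN1r; apply: adjointZ.
by apply: covariantZ; apply: k.
Qed.

Lemma dual_operator1 : dual_operator 1.
Proof. by exists id; split=> // P F; rewrite mul1r. Qed.

Lemma dual_operatorX Q m : dual_operator Q -> dual_operator (Q ^+ m).
Proof.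
move=> h; elim: m => [|m IH]; first exact: dual_operator1.
by rewrite exprS; apply: dual_operatorM.
Qed.

Definition gram : 'M[B]_(2 + 2) := frame_form 1%:M.

Lemma gramE k l : gram k l = \sum_a \sum_b J a b *: (frame K a k * frame K b l).
Proof.
rewrite /gram /frame_form mulmx1 mxE exchange_big; apply: eq_bigr => b _.
rewrite mxE mulr_suml; apply: eq_bigr => a _.
rewrite [(frame K)^T _ _]mxE [cst_mx _ _ _]mxE -mul_mpolyC.
by rewrite mulrA [_%:MP * _]mulrC.
Qed.

Lemma dual_operator_gram k l : dual_operator (gram k l).
Proof.
exists (contract k l); split=> [|F]; last exact: covariant_contract.
rewrite gramE; apply: adjoint_sum => a; apply: adjoint_sum => b.
apply: adjointZ; apply: adjointM => P F; rewrite mxE; exact: apolar_mulX.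
Qed.

Lemma gram_real k l : real_coefs (gram k l).
Proof.
rewrite gramE; apply: real_coefs_sum => a; apply: real_coefs_sum => b.
rewrite -mul_mpolyC; apply: real_coefsM.
  by apply: real_coefsC; rewrite symp_form4E rpredB ?realn.
by rewrite 2!mxE; apply: real_coefsM; apply: real_coefs_mnm.
Qed.

Section SymplecticGramSchmidt.
Variable R : comNzRingType.
Variable Phi : 'M[R]_(2 + 2).
Let o0 : 'I_(2 + 2) := @Ordinal 4 0 isT.
Let o1 : 'I_(2 + 2) := @Ordinal 4 1 isT.
Let o2 : 'I_(2 + 2) := @Ordinal 4 2 isT.
Let o3 : 'I_(2 + 2) := @Ordinal 4 3 isT.

(* A symplectic Gram-Schmidt process without divisions: the columns of [gs_mx]
   turn four vectors with Gram matrix [Phi] into a multiple of a symplectic basis. *)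
Definition gs_beta : R :=
  let z := Phi o0 o1 in
  z * (z * Phi o2 o3 - Phi o0 o3 * Phi o2 o1 + Phi o1 o3 * Phi o2 o0)
  - Phi o0 o2 * (z * Phi o1 o3 - Phi o0 o3 * Phi o1 o1 + Phi o1 o3 * Phi o1 o0)
  + Phi o1 o2 * (z * Phi o0 o3 - Phi o0 o3 * Phi o0 o1 + Phi o1 o3 * Phi o0 o0).

(** With z = (v_0, v_1), [gs_beta] pairs z v_2 with z v_3 after both are projected off v_0 and v_1.
    The columns are scaled so that the hyperbolic pairs (0, 2) and (1, 3) both have pairing z times
    [gs_beta]; the sign is that of the entry (0, 2) of J. *)
Definition gs_scale : R := - (Phi o0 o1 * gs_beta).

Definition gs_mx : 'M[R]_(2 + 2) := \matrix_(i, j)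
  let z := Phi o0 o1 in
  match (j : nat), (i : nat) with
  | 0, 0 => 1
  | 1, 2 => z
  | 1, 1 => - Phi o0 o2
  | 1, 0 => Phi o1 o2
  | 2, 1 => gs_beta
  | 3, 3 => z * z
  | 3, 1 => - (z * Phi o0 o3)
  | 3, 0 => z * Phi o1 o3
  | _, _ => 0
  end.
End SymplecticGramSchmidt.

Lemma sum4 (R : comNzRingType) (F : 'I_(2 + 2) -> R) : \sum_i F i =
  F (@Ordinal 4 0 isT) + F (@Ordinal 4 1 isT) + F (@Ordinal 4 2 isT) + F (@Ordinal 4 3 isT).
Proof.
rewrite !big_ord_recl big_ord0 addr0 !addrA.
by congr (F _ + F _ + F _ + F _); apply: val_inj.
Qed.

Lemma gs_mxP (Phi : 'M[K]_(2 + 2)) : Phi^T = - Phi -> (forall i, Phi i i = 0) ->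
  (gs_mx Phi)^T *m Phi *m gs_mx Phi = gs_scale Phi *: J.
Proof.
move=> hanti hdiag.
have ha i j : Phi i j = - Phi j i.
  by have := congr1 (fun M : 'M[K]_(2 + 2) => M j i) hanti; rewrite !mxE.
apply/matrixP => i j; rewrite mxE sum4.
have e k : ((gs_mx Phi)^T *m Phi) i k = \sum_l gs_mx Phi l i * Phi l k.
  by rewrite mxE; apply: eq_bigr => l _; rewrite mxE.
rewrite !e !sum4 [RHS]mxE symp_form4E /gs_scale /gs_beta !hdiag.
rewrite (ha (@Ordinal 4 1 isT) (@Ordinal 4 0 isT)) (ha (@Ordinal 4 2 isT) (@Ordinal 4 0 isT)).
rewrite (ha (@Ordinal 4 2 isT) (@Ordinal 4 1 isT)) (ha (@Ordinal 4 3 isT) (@Ordinal 4 0 isT)).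
rewrite (ha (@Ordinal 4 3 isT) (@Ordinal 4 1 isT)) (ha (@Ordinal 4 3 isT) (@Ordinal 4 2 isT)).
case: i {e} => [[|[|[|[|//]]]] hi]; case: j => [[|[|[|[|//]]]] hj].
all: rewrite ![gs_mx _ _ _]mxE /= /gs_beta ?hdiag.
all: rewrite ?(ha (@Ordinal 4 1 isT) (@Ordinal 4 0 isT)) ?(ha (@Ordinal 4 2 isT) (@Ordinal 4 0 isT)).
all: rewrite ?(ha (@Ordinal 4 2 isT) (@Ordinal 4 1 isT)) ?(ha (@Ordinal 4 3 isT) (@Ordinal 4 0 isT)).
all: rewrite ?(ha (@Ordinal 4 3 isT) (@Ordinal 4 1 isT)) ?(ha (@Ordinal 4 3 isT) (@Ordinal 4 2 isT)).
all: ring.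
Qed.

End FirstFundamental.

(** * Invariants evaluated in a moving symplectic basis *)

Section FirstFundamentalTheorem.
Variable K : numClosedFieldType.
Local Notation J := (symp_form K 2).
Local Notation B := {mpoly K[(2 + 2) * (2 + 2)]}.
Variable A : set (mxpair K 2 -> K).
Hypothesis subA : subalgebra A.
Hypothesis traceA : forall w : word, A (trace_word w).

Let covmx (M : mxpair K 2 -> 'M[B]_(2 + 2)) := forall k l, covariant A (fun z => M z k l).

Let covmxM M N : covmx M -> covmx N -> covmx (fun z => M z *m N z).
Proof.
move=> hM hN k l.
apply: (covariant_ext (F := fun z => \sum_j M z k j * N z j l)) => [|z]; last by rewrite mxE.
by apply: covariant_sum => // j; apply: covariantM.
Qed.

Let cst_cov (a : B) := covariant A (fun=> a).

Let cst_closed : [/\ forall a, cst_cov a -> cst_cov (- a),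
  forall a b, cst_cov a -> cst_cov b -> cst_cov (a + b) &
  forall a b, cst_cov a -> cst_cov b -> cst_cov (a * b)].
Proof.
split=> [a|a b|a b]; first exact: covariantN.
  exact: covariantD.
exact: covariantM.
Qed.

Let cst_gram k l : cst_cov (gram K k l).
Proof.
apply: covariant_ext (covariant_form A [::] k l) _ => z.
by rewrite /gram eval_wordE mxword_nil.
Qed.

Let covmx_gs : covmx (fun=> gs_mx (gram K)).
Proof.
have [hN hD hM] := cst_closed.
have hb : cst_cov (gs_beta (gram K)).
  rewrite /gs_beta; cbv zeta; by repeat first [apply: (hD) | apply: (hN) | apply: (hM) | apply: (cst_gram)].
have hc c : cst_cov (c%:MP) by apply: covariantC.
have h0 : cst_cov 0 by rewrite -mpolyC0.
have h1 : cst_cov 1 by rewrite -mpolyC1.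
move=> k l.
rewrite -/(cst_cov _) mxE; case: k => [[|[|[|[|//]]]] hk]; case: l => [[|[|[|[|//]]]] hl] //=.
all: by repeat first [apply: (hN) | apply: (hM) | apply: (cst_gram)].
Qed.

(* Up to the factor [gamma], the matrix of [W] in the basis [frame *m gs_mx gram]. *)
Definition moving (W : 'M[K]_(2 + 2)) : 'M[B]_(2 + 2) :=
  - (cst_mx J *m (gs_mx (gram K))^T *m frame_form W *m gs_mx (gram K)).

Let covmx_moving w : covmx (fun z => moving (eval_word w z)).
Proof.
have hJ : covmx (fun=> cst_mx J).
  by move=> k l; apply: covariant_ext (covariantC subA (J k l)) _ => z; rewrite [cst_mx _ _ _]mxE.
have hT : covmx (fun=> (gs_mx (gram K))^T).
  by move=> k l; apply: covariant_ext (covmx_gs l k) _ => z; rewrite [RHS]mxE.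
have hF : covmx (fun z => frame_form (eval_word w z)) by move=> k l; apply: covariant_form.
move=> k l; apply: covariant_ext
  (covariantN subA (covmxM (covmxM (covmxM hJ hT) hF) covmx_gs k l)) _ => z.
by rewrite [RHS]mxE.
Qed.

Definition moving_coords (z : mxpair K 2) : 'I_(ncoords 2) -> B :=
  row_mx (mxvec (moving z.1)) (mxvec (moving z.2)) 0.

Let covariant_coords k : covariant A (fun z => moving_coords z k).
Proof.
rewrite /moving_coords.
case: (splitP k) => k' ek.
  have -> : k = lshift _ k' by apply: val_inj.
  case/mxvec_indexP: k' {ek} => i j.
  apply: covariant_ext (covmx_moving [:: (false, false)] i j) _ => z.
  by rewrite row_mxEl mxvecE eval_wordE mxword_cons mxword_nil mulmx1.
have -> : k = rshift _ k' by apply: val_inj.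
case/mxvec_indexP: k' {ek} => i j.
apply: covariant_ext (covmx_moving [:: (true, false)] i j) _ => z.
by rewrite row_mxEr mxvecE eval_wordE mxword_cons mxword_nil mulmx1.
Qed.

Definition gamma : B := gs_scale (gram K).

(** Each moving coordinate carries one factor [gamma]; completing by powers of [gamma] makes the
    total exponent [msize p] common to all monomials. *)
Definition moving_poly (p : {mpoly K[ncoords 2]}) (z : mxpair K 2) : B :=
  \sum_(m <- msupp p) p@_m *: (gamma ^+ (msize p - mdeg m) * \prod_k moving_coords z k ^+ m k).

Let covariant_gamma : cst_cov gamma.
Proof.
have [hN hD hM] := cst_closed.
rewrite /gamma /gs_scale /gs_beta; cbv zeta.
by repeat first [apply: (hD) | apply: (hN) | apply: (hM) | apply: (cst_gram)].
Qed.

Let covariant_moving_poly p : covariant A (moving_poly p).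
Proof.
apply: covariant_sum => // m; apply: covariantZ => //; apply: covariantM.
  exact: covariantX.
by apply: covariant_prod => // k; apply: covariantX.
Qed.

Let dual_gamma : dual_operator A gamma.
Proof.
rewrite /gamma /gs_scale /gs_beta; cbv zeta.
by repeat first [apply: (dual_operatorD) | apply: (dual_operatorN) | apply: (dual_operatorM) | apply: (dual_operator_gram)].
Qed.

Let real_gamma : real_coefs gamma.
Proof.
have hN (P : B) : real_coefs P -> real_coefs (- P).
  by move=> h m; rewrite mcoeffN rpredN.
rewrite /gamma /gs_scale /gs_beta; cbv zeta.
by repeat first [apply: (real_coefsD) | apply: (hN) | apply: (real_coefsM) | apply: (gram_real)].
Qed.

Section AtPoint.
Variable v : 'I_((2 + 2) * (2 + 2)) -> K.
Let V : 'M[K]_(2 + 2) := map_mx (meval v) (frame K).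
Let Phi := V^T *m J *m V.

Let eval_cst W : map_mx (meval v) (cst_mx W) = W.
Proof. apply/matrixP => i j; rewrite mxE [cst_mx _ _ _]mxE; exact: mevalC. Qed.

Let eval_form W : map_mx (meval v) (frame_form W) = V^T *m (J *m W) *m V.
Proof. by rewrite /frame_form !map_mxM map_trmx eval_cst. Qed.

Let eval_gram : map_mx (meval v) (gram K) = Phi.
Proof. by rewrite /gram eval_form mulmx1. Qed.

Let Phi_entry i j : meval v (gram K i j) = Phi i j.
Proof. by rewrite -eval_gram [RHS]mxE. Qed.

Let eval_beta : meval v (gs_beta (gram K)) = gs_beta Phi.
Proof. by rewrite /gs_beta !(mevalD, mevalN, mevalM, Phi_entry). Qed.

Lemma gamma_eval : meval v gamma = gs_scale Phi.
Proof. by rewrite /gamma /gs_scale !(mevalN, mevalM) eval_beta Phi_entry. Qed.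

Let eval_gs : map_mx (meval v) (gs_mx (gram K)) = gs_mx Phi.
Proof.
apply/matrixP => k l; rewrite [LHS]mxE [gs_mx (gram K) _ _]mxE [RHS]mxE.
case: k => [[|[|[|[|//]]]] hk]; case: l => [[|[|[|[|//]]]] hl] //=.
all: by rewrite ?(mevalD, mevalN, mevalM, Phi_entry, eval_beta, meval1, meval0).
Qed.

Let H := V *m gs_mx Phi.

Let eval_moving W : map_mx (meval v) (moving W) = symp_adj H *m W *m H.
Proof.
rewrite /moving map_mxN 3!map_mxM -map_trmx eval_cst eval_form eval_gs.
by rewrite symp_adjE /H trmx_mul !mulNmx !mulmxA.
Qed.

Let HP : H^T *m J *m H = gs_scale Phi *: J.
Proof.
have anti : Phi^T = - Phi.
  by rewrite /Phi !trmx_mul trmxK symp_formT mulNmx mulmxN mulmxA.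
have diag i : Phi i i = 0.
  have : Phi i i = - Phi i i.
    have := congr1 (fun M : 'M[K]_(2 + 2) => M i i) anti.
    by rewrite [LHS]mxE [X in _ = X -> _]mxE.
  by move/eqP; rewrite -addr_eq0 -mulr2n mulrn_eq0 => /eqP.
by rewrite -(gs_mxP anti diag) /H trmx_mul /Phi !mulmxA.
Qed.

Lemma moving_poly_eval p f z : (forall z, f z = p.@[coords z]) ->
  (forall a z, @symp_group K 2 a -> f (conj_pair a z) = f z) ->
  meval v gamma != 0 ->
  meval v (moving_poly p z) = f z * meval v gamma ^+ msize p.
Proof.
move=> hp hinv; rewrite gamma_eval; set c := gs_scale Phi => c0.
(* [H] multiplies the form by [c]; division by a square root of [c], available in an algebraically
   closed field, makes it symplectic. *)
pose s := sqrtC c; have s2 : s * s = c by rewrite -expr2 sqrtCK.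
have s0 : s != 0 by rewrite sqrtC_eq0.
pose a := s^-1 *: H.
have adjH : symp_adj H *m H = c%:M.
  rewrite symp_adjE !mulNmx -!mulmxA [H^T *m _]mulmxA HP -scalemxAr symp_form_sqr scalerN opprK.
  by rewrite -/c scalemx1.
have adja : symp_adj a *m a = 1%:M.
  rewrite /a symp_adjZ -scalemxAl -scalemxAr scalerA adjH scale_scalar_mx -invfM s2.
  by rewrite mulVf.
have ua : a \in unitmx by case: (mulmx1_unit adja).
have ia : invmx a = symp_adj a by rewrite -[LHS]mul1mx -adja mulmxK.
have ga : @symp_group K 2 a.
  have EZ : (s^-1 *: H)^T = s^-1 *: H^T by apply/matrixP => i j; rewrite !mxE.
  split=> /=; first exact: ua.
  rewrite /a EZ -!scalemxAl -scalemxAr HP !scalerA -invfM s2.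
  by rewrite mulVf // scale1r.
pose y : mxpair K 2 := (c^-1 *: (symp_adj H *m z.1 *m H), c^-1 *: (symp_adj H *m z.2 *m H)).
have hy : conj_pair a y = z.
  have E (X : 'M[K]_(2 + 2)) : a *m (c^-1 *: (symp_adj H *m X *m H)) *m invmx a = X.
    have -> : c^-1 *: (symp_adj H *m X *m H) = invmx a *m X *m a.
      rewrite ia /a symp_adjZ -!scalemxAl -scalemxAr.
      rewrite scalerA -invfM s2.
      by [].
    by rewrite !mulmxA mulmxV // mul1mx -mulmxA mulmxV // mulmx1.
  by rewrite /conj_pair /y !E; case: (z).
rewrite -hy hinv // hp [p.@[_]]mevalE /moving_poly raddf_sum mulr_suml big_seq [RHS]big_seq.
apply: eq_bigr => m hm /=; rewrite mevalZ mevalM -mulrA; congr (_ * _).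
rewrite rmorphXn /= gamma_eval -/c rmorph_prod /=.
have hcoord k : meval v (moving_coords (conj_pair a y) k) = c * coords y k.
  rewrite hy /moving_coords /coords /y; case: (splitP k) => k' ek.
    have -> : k = lshift _ k' by apply: val_inj.
    rewrite !row_mxEl; case/mxvec_indexP: k' {ek} => i j; rewrite !mxvecE /= [in RHS]mxE.
    by rewrite mulrA mulfV // mul1r -eval_moving [RHS]mxE.
  have -> : k = rshift _ k' by apply: val_inj.
  rewrite !row_mxEr; case/mxvec_indexP: k' {ek} => i j; rewrite !mxvecE /= [in RHS]mxE.
  by rewrite mulrA mulfV // mul1r -eval_moving [RHS]mxE.
under eq_bigr do rewrite rmorphXn /= hcoord exprMn.
rewrite big_split /= prodrXr -mdegE mulrA -exprD subnK ?(ltnW (msize_mdeg_lt hm)) //.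
exact: mulrC.
Qed.
End AtPoint.

Let gamma_neq0 : gamma != 0.
Proof.
(* The frame e_0, e_2, e_1, e_3 makes (v_0, v_1) and (v_2, v_3) hyperbolic pairs, and [gamma] takes
   the value -1. *)
pose perm (i : nat) : nat := match i with 0 => 0 | 1 => 2 | 2 => 1 | _ => 3 end.
pose V0 : 'M[K]_(2 + 2) := \matrix_(a, i) ((a : nat) == perm i)%:R.
apply/eqP => g0; have := gamma_eval (fun k => mxvec V0 0 k).
have -> : map_mx (meval (fun k => mxvec V0 0 k)) (frame K) = V0.
  by apply/matrixP => a i; rewrite [LHS]mxE [frame _ _ _]mxE mevalXU mxvecE.
rewrite g0 meval0 => /esym/eqP; apply/negP.
have E i j : (V0^T *m J *m V0) i j = \sum_(b < 2 + 2) (\sum_(a < 2 + 2) ((a : nat) == perm i)%:R * J a b) * ((b : nat) == perm j)%:R.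
  rewrite mxE; apply: eq_bigr => b _; rewrite [V0 _ _]mxE; congr (_ * _).
  by rewrite mxE; apply: eq_bigr => a _; rewrite 2!mxE.
rewrite /gs_scale /gs_beta !E !sum4 !symp_form4E /=.
rewrite ?(mulr0n, mulr1n) !(mul0r, mulr0, mul1r, mulr1, sub0r, subr0, oppr0, addr0, add0r, mulNr, mulrN, opprK).
by rewrite oppr_eq0 oner_eq0.
Qed.

Theorem first_fundamental_theorem f : symp_invariants K 2 f -> A f.
Proof.
have [Ac AD AM] := subA.
case=> -[p hp] hinv; set N := msize p; set Q := gamma ^+ N.
have Q0 : Q != 0 by rewrite expf_neq0.
have realQ : real_coefs Q.
  rewrite /Q; elim: {hp Q Q0} N => [|n IH]; last by rewrite exprS; apply: real_coefsM.
  by rewrite expr0 -mpolyC1; apply: real_coefsC; rewrite rpred1.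
have movingE z : moving_poly p z = f z *: Q.
  (* [moving_poly_eval] requires [gamma] to be nonzero at the point; the extra factor takes care of
     its zeros. *)
  suff /eqP : gamma * (moving_poly p z - f z *: Q) = 0.
    by rewrite mulf_eq0 (negbTE gamma_neq0) subr_eq0 => /eqP.
  apply: mpoly_eq0_eval => v; rewrite mevalM mevalB mevalZ /Q rmorphXn /=.
  have [->|g0] := eqVneq (meval v gamma) 0; first by rewrite mul0r.
  by rewrite (moving_poly_eval z hp hinv g0) subrr mulr0.
have [T [adjT covT]] := dual_operatorX N dual_gamma.
have hA := covariant_coef0 subA (covT _ (covariant_moving_poly p)).
(* Pairing [Q] with [f z *: Q] gives [f z] times [apolar Q Q]; moving [Q] across the pairing gives
   the constant term of a covariant, which lies in [A]. *)
have E z : f z = (apolar Q Q)^-1 * (T (moving_poly p z))@_0%MM.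
  have : f z * apolar Q Q = (T (moving_poly p z))@_0%MM.
    by rewrite -apolar1 -adjT mulr1 movingE apolarZr.
  by move <-; rewrite mulrC mulfK // lt0r_neq0 // apolar_gt0.
rewrite (_ : f = cst (apolar Q Q)^-1 \* (fun z => (T (moving_poly p z))@_0%MM)).
  exact: AM.
by apply/funext => z; rewrite E.
Qed.

End FirstFundamentalTheorem.

Delimit Scope Z_scope with BZ.

(** * Computing with noncommutative polynomials *)

Definition poly := seq (word * Z).

Definition cmp_letter (l m : letter) : comparison :=
  match l, m with
  | (false, false), (false, false) | (true, false), (true, false)
  | (false, true), (false, true) | (true, true), (true, true) => Eq
  | (false, false), _ => Lt
  | _, (false, false) => Gt
  | (true, false), _ => Lt
  | _, (true, false) => Gt
  | (false, true), _ => Lt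
  | _, _ => Gt
  end.

Fixpoint cmp_word (u v : word) : comparison :=
  match u, v with
  | [::], [::] => Eq
  | [::], _ => Lt
  | _, [::] => Gt
  | l :: u', m :: v' =>
      match cmp_letter l m with Eq => cmp_word u' v' | c => c end
  end.

Definition scale (c : Z) (p : poly) : poly := [seq (t.1, Z.mul c t.2) | t <- p].

(** Merging keeps sorted lists sorted, so that equal words meet and cancel. The value is correct for
    unsorted lists as well ([ev_axpy]), so soundness rests on no ordering invariant. *)
Fixpoint axpy (c : Z) (p : poly) {struct p} : poly -> poly :=
  match p with
  | [::] => id
  | (u, a) :: p' =>
      fix merge (q : poly) : poly :=
        match q with
        | [::] => scale c p
        | (v, b) :: q' =>
            match cmp_word u v with
            | Lt => (u, Z.mul c a) :: axpy c p' q
            | Gt => (v, b) :: merge q'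
            | Eq => let s := Z.add (Z.mul c a) b in
                    if Z.eqb s 0 then axpy c p' q' else (u, s) :: axpy c p' q'
            end
        end
  end.

Definition subst (g : word -> poly) (p : poly) : poly :=
  foldr (fun t => axpy t.2 (g t.1)) [::] p.

Definition mono (w : word) : poly := [:: (w, 1%BZ)].

Definition lmul (l : letter) (p : poly) : poly := [seq (l :: t.1, t.2) | t <- p].

Fixpoint eq_poly (p q : poly) : bool :=
  match p, q with
  | [::], [::] => true
  | (u, a) :: p', (v, b) :: q' =>
      if cmp_word u v is Eq then Z.eqb a b && eq_poly p' q' else false
  | _, _ => false
  end.

Inductive trie := Leaf | Node of option poly & trie & trie & trie & trie.

Fixpoint lookup (T : trie) (w : word) : option poly :=
  match T with
  | Leaf => None
  | Node o t1 t2 t3 t4 =>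
      match w with
      | [::] => o
      | (false, false) :: w' => lookup t1 w'
      | (true, false) :: w' => lookup t2 w'
      | (false, true) :: w' => lookup t3 w'
      | (true, true) :: w' => lookup t4 w'
      end
  end.

Fixpoint insert (w : word) (p : poly) (T : trie) : trie :=
  let: (o, t1, t2, t3, t4) :=
    if T is Node o t1 t2 t3 t4 then (o, t1, t2, t3, t4)
    else (None, Leaf, Leaf, Leaf, Leaf) in
  match w with
  | [::] => Node (Some p) t1 t2 t3 t4
  | (false, false) :: w' => Node o (insert w' p t1) t2 t3 t4
  | (true, false) :: w' => Node o t1 (insert w' p t2) t3 t4
  | (false, true) :: w' => Node o t1 t2 (insert w' p t3) t4
  | (true, true) :: w' => Node o t1 t2 t3 (insert w' p t4)
  end.

Fixpoint tmap (f : poly -> poly) (T : trie) : trie :=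
  if T is Node o t1 t2 t3 t4
  then Node (omap f o) (tmap f t1) (tmap f t2) (tmap f t3) (tmap f t4) else Leaf.

Definition trie_of (s : seq (word * poly)) : trie :=
  foldr (fun t => insert t.1 t.2) Leaf s.

(** Two readings of a table: for a rewriting system a missing word is its own image, for a table of
    values it has [value] zero. *)
Definition image (T : trie) (w : word) : poly :=
  if lookup T w is Some p then p else mono w.
Definition value (T : trie) (w : word) : poly :=
  if lookup T w is Some p then p else [::].
Definition reduce (T : trie) : poly -> poly := subst (image T).

(** * Solving linear relations *)

Fixpoint extract (k : word) (p : poly) : option (Z * poly) :=
  if p is (w, a) :: p' then
    match cmp_word k w with
    | Eq => Some (a, p')
    | Lt => None
    | Gt => if extract k p' is Some (c, q) then Some (c, (w, a) :: q) else None
    end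
  else None.

Definition content (p : poly) : Z := foldr (fun t => Z.gcd t.2) 0%BZ p.

Fixpoint find_pivot (first : bool) (g : Z) (p : poly) : option (word * Z * poly) :=
  if p is (w, a) :: p' then
    if Z.eqb (Z.abs a) g then Some (w, a, p') else
    if first then None else
    if find_pivot first g p' is Some (k, c, q) then Some (k, c, (w, a) :: q) else None
  else None.

(** A pivot equal up to sign to the content divides every coefficient, so all rules stay
    integral. *)
Definition solve (first : bool) (p : poly) : option (word * poly) :=
  if find_pivot first (content p) p is Some (k, a, q) then
    if ~~ Z.eqb a 0 && all (fun t => Z.eqb (Z.mul a (Z.div t.2 a)) t.2) q
    then Some (k, [seq (t.1, Z.opp (Z.div t.2 a)) | t <- q]) else None
  else None.

Definition replace (k : word) (r p : poly) : poly :=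
  if extract k p is Some (c, q) then axpy c r q else p.

(* With [first] set, only the least word of a relation may become its pivot. *)
Definition add_relation (first : bool) (v : poly) (T : trie) : trie :=
  if solve first (reduce T v) is Some (k, r) then insert k r (tmap (replace k r) T)
  else T.

Definition free_of (k : word) (p : poly) : bool :=
  all (fun t => if cmp_word k t.1 is Eq then false else true) p.

Definition eliminate (k : word) (a : Z) (r p : poly) : poly :=
  if extract k p is Some (b, _) then
    let g := Z.gcd a b in axpy (Z.opp (Z.div b g)) r (scale (Z.div a g) p)
  else p.

(** Fails as soon as a row is empty, so success certifies independence. That a pivot has disappeared
    elsewhere is tested by [free_of] rather than proved. *)
Fixpoint pivots (n : nat) (rows : seq poly) : option (seq word) :=
  match n, rows with
  | _, [::] => Some [::]
  | n'.+1, ((k, a) :: q) :: rs =>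
      let rs' := map (eliminate k a ((k, a) :: q)) rs in
      if [&& ~~ Z.eqb a 0, free_of k q & all (free_of k) rs']
      then omap (cons k) (pivots n' rs') else None
  | _, _ => None
  end.

(** * The quotient by the Jordan relations *)

Definition letters : word :=
  [:: (false, false); (true, false); (false, true); (true, true)].

Definition extend (B : seq word) : seq word := [seq l :: n | l <- letters, n <- B].

Definition push (M : trie) (l : letter) (p : poly) : poly := reduce M (lmul l p).
Definition nform (M : trie) (w : word) : poly := foldr (push M) (mono [::]) w.

(** The first letter stays unreduced: rules are valid only against a nonempty word, and here that
    word is the first letter. *)
Definition head_form (M : trie) (w : word) : poly :=
  if w is l :: w' then lmul l (nform M w') else mono [::].

(* The involution maps [w] to [signw w] times [rev w]. *)
Definition signw (w : word) : Z := if odd (count snd w) then (-1)%BZ else 1%BZ.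

Definition symmetrized (s : word) : poly := axpy 1 (mono s) [:: (rev s, signw s)].

Definition jordan (s t : word) : poly :=
  flatten [seq [:: (a.1 ++ b.1, Z.mul a.2 b.2); (b.1 ++ a.1, Z.mul a.2 b.2)]
          | a <- symmetrized s, b <- symmetrized t].

(** Here a and b are m + m* and m - m* for m = x, and a', b' the same for m = y. These words
    symmetrize to self-adjoint elements; a single skew letter symmetrizes to 0, and so do the words
    of length 2 in a, a' modulo the Jordan relations of a and a'. *)
Definition short_words : seq word :=
  let a := (false, false) in let a' := (true, false) in
  let b := (false, true) in let b' := (true, true) in
  [:: [:: a]; [:: a']; [:: b; b]; [:: b; b']; [:: b'; b'];
      [:: a; b]; [:: a; b']; [:: a'; b]; [:: a'; b']].

(** If [Bs] starts with degree n, a short word of length k is paired with normal words of length n +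
    1 - k, so that all relations have degree n + 1. *)
Definition relations (Bs : seq (seq word)) : seq poly :=
  flatten [seq [seq jordan s t | t <- nth [::] Bs (size s).-1 & ~~ nilp t]
          | s <- short_words].

(* [bases] lists the normal words of each degree, the highest degree first;
   [table] rewrites the reducible one-letter extensions of normal words, and
   [rtable] holds the normal forms of the words [rcons n x], for the words [n]
   of the last degree but one. *)
Record presentation := Presentation { table : trie; rtable : trie; bases : seq (seq word) }.

Definition rmul (Rt : trie) (x : letter) (p : poly) : poly :=
  subst (fun w => if w is l :: n then lmul l (image Rt (rcons n x)) else mono [:: x]) p.

(** A candidate is a letter followed by a normal word. If its prefix without the last letter is
    reducible, that rule times the last letter reduces it; otherwise only a new Jordan relation
    can. *)
Definition inherit (M Rt : trie) (c : word) : option poly :=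
  if c is l :: m :: n then omap (rmul Rt (last m n)) (lookup M (l :: belast m n))
  else None.

Definition inherit_all (M Rt : trie) (C : seq word) : trie :=
  foldr (fun c T => if inherit M Rt c is Some p then insert c (reduce T p) T else T) M C.

Definition new_rules (M : trie) (rels : seq poly) : trie :=
  foldl (fun E r => add_relation true (subst (fun w => reduce M (head_form M w)) r) E)
    Leaf rels.

Definition merge_rules (E M : trie) (C : seq word) : trie :=
  foldr (fun c T =>
    match lookup E c with
    | Some p => insert c p T
    | None => if lookup M c is Some p then insert c (reduce E p) T else T
    end) M C.

Definition next_rtable (M Rt : trie) (B : seq word) : trie :=
  foldr (fun n T => foldr (fun x =>
    insert (rcons n x)
      (if n is h :: n' then push M h (image Rt (rcons n' x)) else mono [:: x])) T letters)
    Leaf B.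

Definition step (s : presentation) : presentation :=
  let: Presentation M Rt Bs := s in
  let B := head [::] Bs in
  let C := extend B in
  let M1 := inherit_all M Rt C in
  let M2 := merge_rules (new_rules M1 (relations Bs)) M1 C in
  Presentation M2 (next_rtable M2 Rt B)
    ([seq c <- C | if lookup M2 c is None then true else false] :: Bs).

Definition presentation_at (n : nat) : presentation := iter n step (Presentation Leaf Leaf [:: [:: [::]]]).

(** * Traces modulo products of traces *)

Definition rot_relation (M : trie) (c : word) : poly :=
  axpy (-1) (head_form M (rot 1 c)) (mono c).
Definition rev_relation (M : trie) (c : word) : poly :=
  axpy (Z.opp (signw c)) (head_form M (rev c)) (mono c).

Definition trace_table (M : trie) (C : seq word) : trie :=
  foldl (fun E c => add_relation false (rev_relation M c)
                      (add_relation false (rot_relation M c) E)) Leaf C.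

(* [w] is a word in x, x*, y, y*; one has x = (a + b) / 2 and x* = (a - b) / 2,
   where a = x + x* and b = x - x*. *)
Definition xsign (l : letter) : Z := if l.2 then (-1)%BZ else 1%BZ.

(** Without the denominators: the result is the word multiplied by 2 to the power of its length. *)
Definition expand (w : word) : poly :=
  foldr (fun l v => lmul (l.1, false) v ++ scale (xsign l) (lmul (l.1, true) v))
    (mono [::]) w.

Definition xform (M : trie) (w : word) : poly :=
  foldr (fun l v => axpy (xsign l) (push M (l.1, true) v) (push M (l.1, false) v))
    (mono [::]) w.

Definition xrow (M E : trie) (w : word) : poly :=
  if w is l :: w' then
    let v := xform M w' in
    reduce E (axpy (xsign l) (lmul (l.1, true) v) (lmul (l.1, false) v))
  else [::].

Definition has_key (S : trie) (w : word) : bool := if lookup S w is Some _ then true else false.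
Definition keys_in (ks : seq word) (ps : seq poly) : bool :=
  let S := trie_of [seq (k, [::]) | k <- ks] in
  all (all (fun t => has_key S t.1)) ps.

Definition generator_rows (gs : seq word) (M E : trie) (n : nat) : seq poly :=
  [seq xrow M E w | w <- gs & size w == n].

(** The generators of degree [n] give a square triangular system whose unknowns [ks] include every
    word in the reduced traces of that degree, so all these traces are combinations of
    generators. *)
Definition check_degree (gs : seq word) (M E : trie) (n : nat) (B B' : seq word) : bool :=
  let C := extend B in
  let rows := generator_rows gs M E n in
  [&& keys_in B' [seq image M c | c <- C] &
      if pivots (size rows) rows is Some ks
      then keys_in ks rows && keys_in ks [seq image E c | c <- C] else false].

(** The terminal test [nilp B] is the vanishing of the quotient in the last degree. *)
Fixpoint check_degrees (gs : seq word) (M : trie) (Es : seq trie) (n : nat) (Bs : seq (seq word)) : bool :=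
  match Es, Bs with
  | [::], [:: B] => nilp B
  | E :: Es', B :: ((B' :: _) as Bs') =>
      check_degree gs M E n B B' && check_degrees gs M Es' n.+1 Bs'
  | _, _ => false
  end.

(** * Functionals on traces *)

(* A level lists the words of a given length with their nonzero normal forms. *)
Definition next_level (M : trie) (L : seq (word * poly)) : seq (word * poly) :=
  [seq t <- [seq (l :: t.1, push M l t.2) | l <- letters, t <- L] | ~~ nilp t.2].
Definition level_values (E : trie) (L : seq (word * poly)) : seq (word * poly) :=
  [seq t <- [seq (l :: t.1, reduce E (lmul l t.2)) | l <- letters, t <- L] | ~~ nilp t.2].

Fixpoint values (M : trie) (Es : seq trie) (L : seq (word * poly)) : seq (word * poly) :=
  if Es is E :: Es' then level_values E L ++ values M Es' (next_level M L) else [::].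

(* The eight-term relation holds for traces because the Jordan product of two
   self-adjoint matrices u + u* and v + v* is linear in them modulo traces. *)
Definition sum8 (T : trie) (u v w : word) : poly :=
  let add c x y z := axpy c (value T (x ++ y ++ z)) in
  let u' := rev u in let v' := rev v in let w' := rev w in
  let a := signw u in let b := signw v in let c := signw w in
  add 1%BZ u v w (add c u v w' (add b u v' w (add (Z.mul b c) u v' w'
  (add a u' v w (add (Z.mul a c) u' v w' (add (Z.mul a b) u' v' w
  (add (Z.mul a (Z.mul b c)) u' v' w' [::]))))))).

(** Rotation is tested in both directions: a word outside the table has value zero, and the inverse
    rotation detects whether one of its neighbours in the table disagrees. *)
Definition check_word (T : trie) (w : word) : bool :=
  let p := value T w in
  [&& eq_poly (value T (rot 1 w)) p, eq_poly (value T (rotr 1 w)) p,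
      eq_poly (value T (rev w)) (scale (signw w) p) &
      all (fun i => all (fun j =>
          nilp (sum8 T (take i w) (take j (drop i w)) (drop j (drop i w))))
        (iota 1 (size w - i.+1))) (iota 1 (size w).-1)].

Definition functional_row (T : trie) (w : word) : poly := subst (value T) (expand w).

Definition trace_tables (M : trie) (Bs : seq (seq word)) : seq trie :=
  [seq trace_table M (extend B) | B <- Bs].

(** The last degree is dropped by [behead] since normal words of length n serve the traces of length
    n + 1. *)
Definition certificate (gs : seq word) (D : nat) : bool :=
  let: Presentation M _ Bs := presentation_at D in
  let Es := trace_tables M (rev (behead Bs)) in
  let L := values M Es [:: ([::], mono [::])] in
  let T := trie_of L in
  [&& check_degrees gs M Es 1 (rev Bs), all (fun t => check_word T t.1) L &
      if pivots (size gs) [seq functional_row T w | w <- gs] is Some _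
      then true else false].

(** * Soundness of the computations *)

Lemma cmp_wordP (u v : word) : reflect (u = v) (if cmp_word u v is Eq then true else false).
Proof.
elim: u v => [|[[] []] u IH] [|[[] []] v] /=; try by constructor.
all: by case: (IH v) => [->|h]; constructor => // -[].
Qed.

Lemma cmp_word_eq (u v : word) : cmp_word u v = Eq -> u = v.
Proof. by move=> e; apply/cmp_wordP; rewrite e. Qed.

Lemma cmp_word_refl (u : word) : cmp_word u u = Eq.
Proof. by elim: u => [|[[] []] u IH]. Qed.

Definition keys (p : poly) : seq word := [seq t.1 | t <- p].
Arguments keys : simpl never.

Section Evaluation.
Variable K : numFieldType.
Implicit Types (F : word -> K) (p q : poly) (c : Z).

Definition zK c : K := (int_of_Z c)%:~R.

Lemma zKD a b : zK (Z.add a b) = zK a + zK b.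
Proof. by rewrite /zK (rmorphD int_of_Z) rmorphD. Qed.
Lemma zKM a b : zK (Z.mul a b) = zK a * zK b.
Proof. by rewrite /zK (rmorphM int_of_Z) rmorphM. Qed.
Lemma zKN a : zK (Z.opp a) = - zK a.
Proof. by rewrite /zK (rmorphN int_of_Z) rmorphN. Qed.
Lemma zK_eq0 a : (zK a == 0) = Z.eqb a 0.
Proof. by rewrite /zK intr_eq0; apply/eqP/idP; lia. Qed.
Lemma zK1 : zK 1%BZ = 1. Proof. by []. Qed.
Lemma zKN1 : zK (-1)%BZ = -1. Proof. by []. Qed.

Definition ev F p : K := \sum_(t <- p) zK t.2 * F t.1.

Lemma ev_nil F : ev F [::] = 0. Proof. by rewrite /ev big_nil. Qed.
Lemma ev_cons F w a p : ev F ((w, a) :: p) = zK a * F w + ev F p.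
Proof. by rewrite /ev big_cons. Qed.
Lemma ev_cat F p q : ev F (p ++ q) = ev F p + ev F q.
Proof. by rewrite /ev big_cat. Qed.
Lemma ev_mono F w : ev F (mono w) = F w.
Proof. by rewrite ev_cons ev_nil zK1 mul1r addr0. Qed.
Lemma ev_scale F c p : ev F (scale c p) = zK c * ev F p.
Proof.
rewrite /ev big_map mulr_sumr; apply: eq_bigr => t _ /=.
by rewrite zKM mulrA.
Qed.
Lemma ev_lmul F l p : ev F (lmul l p) = ev (fun w => F (l :: w)) p.
Proof. by rewrite /ev big_map. Qed.
Lemma eq_ev F G p : F =1 G -> ev F p = ev G p.
Proof. by move=> h; apply: eq_bigr => t _; rewrite h. Qed.

Lemma ev_axpy F c p q : ev F (axpy c p q) = zK c * ev F p + ev F q.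
Proof.
elim: p q => [|[u a] p IHp] q; first by rewrite ev_nil mulr0 add0r.
elim: q => [|[v b] q IHq]; first by rewrite ev_nil addr0 /= -ev_scale.
rewrite /=; case e: (cmp_word u v).
- rewrite -(cmp_word_eq e); case: Z.eqb_spec => [h0|_]; rewrite ?ev_cons IHp.
    have : zK (Z.add (Z.mul c a) b) = 0 by rewrite h0.
    rewrite zKD zKM => h; rewrite -[LHS]addr0 -(mul0r (F u)) -h; ring.
  by rewrite !zKD !zKM; ring.
- by rewrite [LHS]ev_cons IHp !ev_cons zKM; ring.
- by rewrite [LHS]ev_cons IHq !ev_cons; ring.
Qed.

Lemma ev_subst F g p : ev F (subst g p) = ev (fun w => ev F (g w)) p.
Proof.
elim: p => [|[w a] p IH]; first by rewrite !ev_nil.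
by rewrite [LHS]ev_axpy IH ev_cons.
Qed.

Lemma ev_extract F k p : if extract k p is Some (c, q) then ev F p = zK c * F k + ev F q else true.
Proof.
elim: p => [|[w a] p IH] //=; case e: (cmp_word k w) => //.
  by rewrite (cmp_word_eq e) ev_cons.
by case: (extract k p) IH => [[c q]|] //= IH; rewrite !ev_cons IH; ring.
Qed.

Lemma ev_find_pivot F b g p :
  if find_pivot b g p is Some (k, a, q) then ev F p = zK a * F k + ev F q else true.
Proof.
elim: p => [|[w a] p IH] //=; case: Z.eqb_spec => [_|_]; first by rewrite ev_cons.
case: b IH => //; case: (find_pivot _ g p) => [[[k c] q]|] //= IH.
by rewrite !ev_cons IH; ring.
Qed.

Lemma ev_solve b p : if solve b p is Some (k, r)
  then exists2 a, a != 0 & forall F, ev F p = a * (F k - ev F r) else true.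
Proof.
rewrite /solve; have := fun F => ev_find_pivot F b (content p) p.
case: (find_pivot b _ p) => [[[k a] q]|] // h.
case: ifP => // /andP[a0 /allP hall]; exists (zK a); first by rewrite zK_eq0.
move=> F; rewrite h mulrBr; congr (_ + _).
rewrite /ev big_map mulr_sumr -sumrN [LHS]big_seq [RHS]big_seq; apply: eq_bigr => t ht /=.
rewrite mulrA -zKM -mulNr -zKN; congr (zK _ * _).
by move: (hall _ ht) => /Z.eqb_eq; lia.
Qed.

Lemma ev_replace k r p :
  exists c : K, forall F, ev F p - ev F (replace k r p) = c * (F k - ev F r).
Proof.
rewrite /replace; have := fun F => ev_extract F k p.
case: (extract k p) => [[c q]|] h; last by exists 0 => F; rewrite mul0r subrr.
by exists (zK c) => F; rewrite h ev_axpy; ring.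
Qed.

Lemma eq_polyP p q : eq_poly p q -> p = q.
Proof.
elim: p q => [|[u a] p IH] [|[v b] q] //=.
by case e: (cmp_word u v) => // /andP[/Z.eqb_eq<- /IH<-]; rewrite (cmp_word_eq e).
Qed.

End Evaluation.

Lemma lookup_insert T w p v : lookup (insert w p T) v = if v == w then Some p else lookup T v.
Proof.
elim: w T v => [|[[] []] w IH] [|o t1 t2 t3 t4] [|[[] []] v] //=.
all: by rewrite IH eqseq_cons.
Qed.

Lemma lookup_tmap f T w : lookup (tmap f T) w = omap f (lookup T w).
Proof. by elim: T w => [|o t1 IH1 t2 IH2 t3 IH3 t4 IH4] [|[[] []] w] //=. Qed.

Lemma image_insert T w p v : image (insert w p T) v = if v == w then p else image T v.
Proof. by rewrite /image lookup_insert; case: eqP. Qed.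

Lemma keys_cat p q : keys (p ++ q) = keys p ++ keys q.
Proof. exact: map_cat. Qed.

Lemma keys_scale c p : keys (scale c p) = keys p.
Proof. by rewrite /keys -map_comp. Qed.

Lemma keys_axpy c p q w : w \in keys (axpy c p q) -> (w \in keys p) || (w \in keys q).
Proof.
elim: p q => [|[u a] p IHp] q; first by [].
elim: q => [|[v b] q IHq].
  by rewrite -[axpy _ _ _]/(scale c ((u, a) :: p)) keys_scale => ->.
have kc t r : keys (t :: r) = t.1 :: keys r by [].
rewrite /= !kc /= !inE; case: (cmp_word u v).
- case: ifP => _; first by move/IHp/orP => [] ->; rewrite !orbT.
  by rewrite kc inE /= => /orP[->|/IHp/orP[]->]; rewrite ?orbT.
- by rewrite kc inE /= => /orP[->|/IHp/orP[->|]]; rewrite ?kc ?inE /= ?orbT // => ->; rewrite !orbT.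
- rewrite kc inE /= => /orP[->|/IHq]; first by rewrite orbT.
  by rewrite kc inE /= => /orP[/orP[]|] ->; rewrite ?orbT.
Qed.

Lemma keys_subst g p w : w \in keys (subst g p) -> exists2 v, v \in keys p & w \in keys (g v).
Proof.
elim: p => [|[u a] p IH] //= /keys_axpy/orP[h|/IH[v hv hw]].
  by exists u; rewrite ?inE ?eqxx.
by exists v; rewrite // inE hv orbT.
Qed.

Lemma keys_lmul l p : keys (lmul l p) = [seq l :: w | w <- keys p].
Proof. by rewrite /keys /lmul -!map_comp. Qed.

Lemma mem_extend B l n : (l :: n \in extend B) = (n \in B).
Proof.
apply/allpairsP/idP => [[[l' n'] /= [_ h [_ ->]]] //|h].
by exists (l, n); split => //; case: l => [] [] [].
Qed.

Lemma keys_inP ks ps : keys_in ks ps -> forall p w, p \in ps -> w \in keys p -> w \in ks.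
Proof.
move=> /allP h p w hp /mapP[t ht ->]; have := h _ hp; move=> /allP/(_ _ ht).
rewrite /has_key; elim: ks {h hp} => [|k ks IH] /=.
  by case: t.1 {ht} => [|[[] []]].
by rewrite lookup_insert inE; case: eqP.
Qed.

Arguments axpy : simpl never.


(** * Congruences modulo a linear space of functions *)

Definition linear_closed (K : numFieldType) X (A : (X -> K) -> Prop) :=
  [/\ A (fun=> 0), forall g h, A g -> A h -> A (fun z => g z + h z) &
      forall c g, A g -> A (fun z => c * g z)].

Section Congruence.
Variables (K : numFieldType) (X I : Type) (A : (X -> K) -> Prop).
Hypothesis linA : linear_closed A.
Variable f : I -> X -> word -> K.
Implicit Types (p q : poly) (T : trie).

(* [p] and [q] are congruent when [A] contains the difference of their images
   under every functional [f i]. *)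
Definition cong p q := forall i, A (fun z => ev (f i z) p - ev (f i z) q).

(** Congruences are proved by exhibiting coefficients and checking an identity for an arbitrary
    functional on words. *)
Lemma cong_comb c1 c2 p1 q1 p2 q2 p q : cong p1 q1 -> cong p2 q2 ->
  (forall F : word -> K, ev F p - ev F q = c1 * (ev F p1 - ev F q1) + c2 * (ev F p2 - ev F q2)) ->
  cong p q.
Proof.
case: linA => A0 AD AZ h1 h2 e i; have := AD _ _ (AZ c1 _ (h1 i)) (AZ c2 _ (h2 i)).
by congr A; apply/funext => z; rewrite e.
Qed.

Lemma cong_ev p q : (forall F : word -> K, ev F p = ev F q) -> cong p q.
Proof.
case: linA => A0 _ _ e i; move: A0; congr A; apply/funext => z.
by rewrite e subrr.
Qed.

Lemma cong_refl p : cong p p. Proof. exact: cong_ev. Qed.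

Lemma cong_scale c p1 q1 p q : cong p1 q1 ->
  (forall F : word -> K, ev F p - ev F q = c * (ev F p1 - ev F q1)) -> cong p q.
Proof. by move=> h e; apply: (cong_comb (c1 := c) (c2 := 0) h h) => F; rewrite mul0r addr0. Qed.

Lemma cong_sym p q : cong p q -> cong q p.
Proof. by move=> h; apply: (cong_scale (c := -1) h) => F; ring. Qed.

Lemma cong_trans p q r : cong p q -> cong q r -> cong p r.
Proof. by move=> h1 h2; apply: (cong_comb (c1 := 1) (c2 := 1) h1 h2) => F; ring. Qed.

Lemma cong_axpy c p p' q q' : cong p p' -> cong q q' -> cong (axpy c p q) (axpy c p' q').
Proof.
by move=> h1 h2; apply: (cong_comb (c1 := zK K c) (c2 := 1) h1 h2) => F; rewrite !ev_axpy; ring.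
Qed.

Lemma cong_subst g h p : (forall w, w \in keys p -> cong (g w) (h w)) ->
  cong (subst g p) (subst h p).
Proof.
elim: p => [|[w a] p IH] hp; first exact: cong_refl.
apply: cong_axpy; first by apply: hp; rewrite /keys inE eqxx.
by apply: IH => v hv; apply: hp; rewrite /keys inE [X in _ || X]hv orbT.
Qed.

Lemma cong_subst_mono g p : (forall w, w \in keys p -> cong (mono w) (g w)) -> cong p (subst g p).
Proof.
move=> h; apply: cong_trans (cong_subst h); apply: cong_ev => F.
by rewrite ev_subst; apply: eq_ev => w; rewrite ev_mono.
Qed.

Lemma cong_subst0 g p : (forall w, w \in keys p -> cong (g w) [::]) -> cong (subst g p) [::].
Proof.
move=> h; apply: cong_trans (cong_subst h) _; apply: cong_ev => F.
by rewrite ev_subst ev_nil [LHS]big1 // => t _; rewrite mulr0.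
Qed.

Definition sound T := forall w, cong (mono w) (image T w).

Lemma sound_Leaf : sound Leaf. Proof. move=> w; exact: cong_refl. Qed.

Lemma sound_insert w p T : cong (mono w) p -> sound T -> sound (insert w p T).
Proof. by move=> h hT v; rewrite image_insert; case: eqP => [->|]. Qed.

Lemma sound_reduce T p : sound T -> cong p (reduce T p).
Proof. by move=> h; apply: cong_subst_mono => w _; apply: h. Qed.

Lemma sound_add_relation b v T : cong v [::] -> sound T -> sound (add_relation b v T).
Proof.
move=> hv hT; rewrite /add_relation; have := @ev_solve K b (reduce T v).
case: (solve b _) => [[k r]|] // [a a0 e].
have hk : cong (mono k) r.
  have h := cong_trans (cong_sym (sound_reduce v hT)) hv.
  apply: (cong_scale (c := a^-1) h) => F.
  by rewrite ev_mono ev_nil subr0 e mulKf.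
apply: sound_insert => // w; rewrite /image lookup_tmap.
have := hT w; rewrite /image; case: (lookup T w) => [p|] //= h; apply: cong_trans h _.
have [c ec] := @ev_replace K k r p.
by apply: (cong_scale (c := c) hk) => F; rewrite ec ev_mono.
Qed.

(** Every word of the rows is a pivot, so the triangular system is square and back substitution
    kills each word. *)
Lemma pivots_span n rows ks : pivots n rows = Some ks ->
  (forall r, r \in rows -> cong r [::]) ->
  (forall r w, r \in rows -> w \in keys r -> w \in ks) ->
  forall k, k \in ks -> cong (mono k) [::].
Proof.
have free k p w : free_of k p -> w \in keys p -> w != k.
  move=> /allP h /mapP[t ht ->]; have := h _ ht.
  by case: eqP => // ->; rewrite cmp_word_refl.
elim: n rows ks => [|n IH] [|[|[k a] q] rs] ks //=; try by case=> <-.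
case: ifP => // /and3P[a0 hq /allP hrs]; set row := (k, a) :: q.
case E: (pivots n _) => [ks'|] //= [<-] hn hk.
have hrow : cong row [::] by apply: hn; rewrite inE eqxx.
have keys_elim p w : w \in keys (eliminate k a row p) -> (w \in keys row) || (w \in keys p).
  rewrite /eliminate; case: (extract k p) => [[b q']|] /=; last by move->; rewrite orbT.
  by move/keys_axpy; rewrite keys_scale.
have null_elim p : cong p [::] -> cong (eliminate k a row p) [::].
  move=> hp; rewrite /eliminate; case: (extract k p) => [[b q']|] //=.
  apply: (cong_comb (c1 := zK K (Z.opp (Z.div b (Z.gcd a b))))
    (c2 := zK K (Z.div a (Z.gcd a b))) hrow hp) => F.
  by rewrite ev_axpy ev_scale !ev_nil; ring.
have h : forall k', k' \in ks' -> cong (mono k') [::].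
  apply: IH E _ _ => [r /mapP[p hp ->]|r w hr hw].
    by apply: null_elim; apply: hn; rewrite inE hp orbT.
  have wk := free _ _ _ (hrs _ hr) hw.
  have : w \in k :: ks'.
    case/mapP: hr hw => p hp -> /keys_elim/orP[]; first by apply: hk; rewrite inE eqxx.
    by apply: hk; rewrite inE hp orbT.
  by rewrite inE (negbTE wk).
move=> k'; rewrite inE => /orP[/eqP->|]; last exact: h.
have hq0 : cong q [::].
  have e : cong q (subst mono q) by apply: cong_subst_mono => w _; apply: cong_refl.
  apply: cong_trans e _; apply: cong_subst0 => w hw; apply: h.
  have : w \in k :: ks'.
    apply: (hk row); first by rewrite inE eqxx.
    by rewrite /row /keys /= inE; apply/orP; right.
  by rewrite inE (negbTE (free _ _ _ hq hw)).
apply: (cong_comb (c1 := (zK K a)^-1) (c2 := - (zK K a)^-1) hrow hq0) => F.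
rewrite ev_mono ev_nil ev_cons !subr0 mulrDr mulKf ?zK_eq0 //; ring.
Qed.

End Congruence.

(** The indicator of the first pivot vanishes on all other rows after elimination, so the corrected
    coefficient [mu] of the first row is 0; the other coefficients are rescaled by nonzero factors
    and vanish by induction. *)
Lemma pivots_independent (K : numFieldType) n (rows : seq (K * poly)) ks :
  pivots n [seq t.2 | t <- rows] = Some ks ->
  (forall F : word -> K, \sum_(t <- rows) t.1 * ev F t.2 = 0) ->
  forall t, t \in rows -> t.1 = 0.
Proof.
elim: n rows ks => [|n IH] [|[lam [|[k a] q]] rs] ks //=.
case: ifP => // /and3P[a0 hq /allP hrs]; set row := (k, a) :: q.
case E: (pivots n _) => [ks'|] //= _ h.
have a0' : zK K a != 0 by rewrite zK_eq0.
have elimE p : exists2 c, c.1 != 0 & forall F : word -> K,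
    ev F (eliminate k a row p) = c.1 * ev F p + c.2 * ev F row.
  rewrite /eliminate; case: (extract k p) => [[b q']|] /=; last first.
    by exists (1, 0) => [|F] /=; rewrite ?oner_eq0 //; ring.
  exists (zK K (Z.div a (Z.gcd a b)), zK K (Z.opp (Z.div b (Z.gcd a b)))) => [|F] /=; last first.
    by rewrite ev_axpy ev_scale; ring.
  rewrite zK_eq0; apply/negP => /Z.eqb_eq e0; move/negP: a0; apply; apply/Z.eqb_eq.
  have [d hd] := Z.gcd_divide_l a b.
  have [g0|g0] := Z.eq_dec (Z.gcd a b) 0; first by rewrite hd g0 Z.mul_0_r.
  by rewrite {1}hd Z.div_mul // in e0; rewrite hd e0 Z.mul_0_l.
pose coefs p := projT1 (cid2 (elimE p)).
have coefs0 p : (coefs p).1 != 0 by rewrite /coefs; case: cid2.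
have coefsE p (F : word -> K) : ev F (eliminate k a row p) = (coefs p).1 * ev F p + (coefs p).2 * ev F row.
  by rewrite /coefs; case: cid2.
pose rs' := [seq (t.1 / (coefs t.2).1, eliminate k a row t.2) | t <- rs].
pose mu := lam - \sum_(t <- rs) t.1 / (coefs t.2).1 * (coefs t.2).2.
have hmu (F : word -> K) : mu * ev F row + \sum_(t <- rs') t.1 * ev F t.2 = 0.
  rewrite -[RHS](h F) big_cons /= mulrBl -addrA; congr (_ + _).
  rewrite big_map mulr_suml -sumrN -big_split; apply: eq_bigr => t _ /=.
  rewrite coefsE; have := coefs0 t.2; move: (coefs _).1 (coefs _).2 => c d c0.
  by field.
pose delta (w : word) : K := (w == k)%:R.
have ev_free p : free_of k p -> ev delta p = 0.
  move=> /allP hp; rewrite /ev big_seq big1 // => t ht; have := hp _ ht.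
  by rewrite /delta; case: eqP => [->|]; rewrite ?cmp_word_refl // mulr0.
have mu0 : mu = 0.
  have := hmu delta; rewrite [X in _ + X = _]big_seq big1 ?addr0 => [|t ht].
    rewrite ev_cons (ev_free _ hq) /delta eqxx mulr1 addr0 => /eqP.
    by rewrite mulf_eq0 (negbTE a0') orbF => /eqP.
  have /ev_free -> : free_of k t.2 by move: ht; rewrite /rs' => /mapP[s hs ->]; apply: hrs => /=; apply: map_f; exact: (map_f snd hs).
  by rewrite mulr0.
have {}IH : forall t, t \in rs' -> t.1 = 0.
  apply: (IH rs' ks') => [|F]; last by have := hmu F; rewrite mu0 mul0r add0r.
  by rewrite -E /rs' -!map_comp.
have rs0 t : t \in rs -> t.1 = 0.
  move=> ht; have /IH/eqP : (t.1 / (coefs t.2).1, eliminate k a row t.2) \in rs' by apply/mapP; exists t.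
  by rewrite /= mulf_eq0 invr_eq0 (negbTE (coefs0 _)) orbF => /eqP.
move=> t; rewrite inE => /orP[/eqP->|]; last exact: rs0.
move: mu0; rewrite /mu big_seq big1 => [|s /rs0 ->]; last by rewrite !mul0r.
by rewrite subr0.
Qed.

Arguments insert : simpl never.

(** * Words and traces modulo products of shorter traces *)

Section Quotient.
Variables (K : numFieldType) (X : Type) (A : (X -> K) -> Prop).
Hypothesis linA : linear_closed A.
Variables (tau : word -> X -> K) (N : nat).
Hypothesis tau_cyc : forall u v z, tau (u ++ v) z = tau (v ++ u) z.
Hypothesis tau_rev : forall w z, tau (rev w) z = zK K (signw w) * tau w z.

(* Truncating at degree [N] makes available, by induction, the traces of the
   words shorter than [N]. *)
Definition cut (w : word) z := if (size w <= N)%N then tau w z else 0.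

(** Tests use a nonempty right factor [r], the condition under which the Jordan relations hold
    modulo shorter traces. [congT] concerns the traces themselves; [congT_lmul] passes to it at the
    cost of one letter. *)
Definition congU := cong A (fun (r : {r : word | r != [::]}) z w => cut (w ++ sval r) z).
Definition congT := cong A (fun (_ : unit) z w => cut w z).

Hypothesis jordan_null : forall s t, s != [::] -> t != [::] -> congU (jordan s t) [::].

Local Notation soundU := (sound A (fun (r : {r : word | r != [::]}) z w => cut (w ++ sval r) z)).
Local Notation soundT := (sound A (fun (_ : unit) z w => cut w z)).

Lemma cut_cyc u v z : cut (u ++ v) z = cut (v ++ u) z.
Proof. by rewrite /cut !size_cat addnC tau_cyc. Qed.

Lemma cut_rev w z : cut (rev w) z = zK K (signw w) * cut w z.
Proof. by rewrite /cut size_rev tau_rev; case: ifP; rewrite ?mulr0. Qed.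

(** Cyclicity moves the left factor [l] to the end of the test word, which stays nonempty. *)
Lemma congU_lmul l p q : congU p q -> congU (lmul l p) (lmul l q).
Proof.
move=> h [r r0] /=; have r1 : rcons r l != [::] by case: (r).
have := h (exist (fun r : word => r != [::]) _ r1); congr A; apply/funext => z /=.
by rewrite !ev_lmul; congr (_ - _); apply: eq_ev => w;
  rewrite -cats1 catA cut_cyc.
Qed.

Lemma congT_lmul l p q : congU p q -> congT (lmul l p) (lmul l q).
Proof.
move=> h [] /=; have r1 : [:: l] != [::] by [].
have := h (exist (fun r : word => r != [::]) _ r1); congr A; apply/funext => z /=.
by rewrite !ev_lmul; congr (_ - _); apply: eq_ev => w; rewrite cut_cyc.
Qed.

Lemma congU_rmul Rt u x p : soundU Rt -> congU (mono u) p ->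
  congU (mono (rcons u x)) (rmul Rt x p).
Proof.
move=> hR h; apply: (@cong_trans _ _ _ _ linA _ _ (subst (fun w => mono (rcons w x)) p)).
  move=> [r r0]; have r1 : x :: r != [::] by [].
  have := h (exist (fun r : word => r != [::]) _ r1); congr A; apply/funext => z /=.
  rewrite !ev_mono ev_subst cat_rcons; congr (_ - _); apply: eq_ev => w.
  by rewrite ev_mono cat_rcons.
apply: cong_subst => // -[|l n] _; first exact: cong_refl.
by apply: (congU_lmul l (hR (rcons n x))).
Qed.

Lemma congU_push M l w p : soundU M -> congU (mono w) p -> congU (mono (l :: w)) (push M l p).
Proof.
move=> hM h; apply: cong_trans (congU_lmul l h) _ => //.
exact: sound_reduce.
Qed.

Lemma congU_nform M w : soundU M -> congU (mono w) (nform M w).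
Proof.
move=> hM; elim: w => [|l w IH]; first exact: cong_refl.
exact: congU_push.
Qed.

Lemma congU_head M w : soundU M -> congU (mono w) (head_form M w).
Proof.
case: w => [|l w] hM; first exact: cong_refl.
exact: congU_lmul (congU_nform w hM).
Qed.

Lemma congT_head M w : soundU M -> congT (mono w) (head_form M w).
Proof.
case: w => [|l w] hM; first exact: cong_refl.
exact: congT_lmul (congU_nform w hM).
Qed.

Lemma sound_foldr S (P : trie -> Prop) (g : S -> trie -> trie) C T :
  (forall c T, P T -> P (g c T)) -> P T -> P (foldr g T C).
Proof. by move=> h hT; elim: C => //= c C IH; apply: h. Qed.

Lemma sound_inherit_all M Rt C : soundU M -> soundU Rt -> soundU (inherit_all M Rt C).
Proof.
move=> hM hR; apply: (sound_foldr (P := soundU)) => // -[|l [|m n]] T hT //=.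
case E: (lookup M _) => [p|] //=; apply: sound_insert => //.
apply: cong_trans (sound_reduce linA _ hT) => //.
rewrite (_ : [:: l, m & n] = rcons (l :: belast m n) (last m n)); last by rewrite /= -lastI.
apply: congU_rmul => //; have := hM (l :: belast m n).
by rewrite /image E.
Qed.

Lemma sound_new_rules M rels : soundU M -> (forall r, r \in rels -> congU r [::]) ->
  soundU (new_rules M rels).
Proof.
move=> hM; rewrite /new_rules.
have : soundU Leaf by apply: sound_Leaf.
elim: rels Leaf => [|r rels IH] E hE hr //=; apply: IH => [|r' hr']; last first.
  by apply: hr; rewrite inE hr' orbT.
apply: sound_add_relation => //; apply: (cong_trans linA _ (hr r _)); last by rewrite inE eqxx.
apply: cong_sym => //; apply: cong_subst_mono => // w _.
apply: cong_trans (sound_reduce linA _ hM) => //; exact: congU_head.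
Qed.

Lemma relations_null Bs r : r \in relations Bs -> congU r [::].
Proof.
case/flatten_mapP => s hs /mapP[t]; rewrite mem_filter => /andP[t0 _] ->.
apply: jordan_null; last by case: (t) t0.
by case: s hs => //=; rewrite !inE.
Qed.

Lemma sound_merge_rules E M C : soundU E -> soundU M -> soundU (merge_rules E M C).
Proof.
move=> hE hM; apply: (sound_foldr (P := soundU)) => // c T hT.
case e: (lookup E c) => [p|].
  by apply: sound_insert => //; have := hE c; rewrite /image e.
case e': (lookup M c) => [p|] //; apply: sound_insert => //.
apply: cong_trans (sound_reduce linA _ hE) => //.
by have := hM c; rewrite /image e'.
Qed.

Lemma sound_next_rtable M Rt B : soundU M -> soundU Rt -> soundU (next_rtable M Rt B).
Proof.
move=> hM hR; apply: (sound_foldr (P := soundU)) => [n T hT|]; last exact: sound_Leaf.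
apply: (sound_foldr (P := soundU)) => // x {hT}T hT; apply: sound_insert => //.
case: n => [|h n]; first exact: cong_refl.
by apply: congU_push => //; apply: hR.
Qed.

Lemma sound_presentation_at n : soundU (table (presentation_at n)) /\ soundU (rtable (presentation_at n)).
Proof.
elim: n => [|n [hM hR]]; first by split; apply: sound_Leaf.
rewrite /presentation_at iterS -/(presentation_at n) /step; case: (presentation_at n) hM hR => M Rt Bs /= hM hR.
set C := extend _; have h1 := sound_inherit_all C hM hR.
have h2 : soundU (merge_rules (new_rules (inherit_all M Rt C) (relations Bs)) (inherit_all M Rt C) C).
  apply: sound_merge_rules => //; apply: sound_new_rules => // r; exact: relations_null.
by split=> //; apply: sound_next_rtable.
Qed.

Lemma sound_trace_table M C : soundU M -> soundT (trace_table M C).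
Proof.
move=> hM; rewrite /trace_table.
have rotE c : congT (rot_relation M c) [::].
  have h := congT_head (rot 1 c) hM.
  have h' : congT (mono (rot 1 c)) (mono c).
    move=> []; case: linA => A0 _ _; move: A0; congr A; apply/funext => z.
    by rewrite !ev_mono /rot cut_cyc cat_take_drop subrr.
  apply: (cong_comb linA (c1 := 1) (c2 := -1) h h') => F.
  by rewrite /rot_relation ev_axpy ev_nil zKN1; ring.
have revE c : congT (rev_relation M c) [::].
  have h := congT_head (rev c) hM.
  have h' : congT (mono (rev c)) (scale (signw c) (mono c)).
    move=> []; case: linA => A0 _ _; move: A0; congr A; apply/funext => z.
    by rewrite ev_scale !ev_mono cut_rev subrr.
  have s2 : zK K (signw c) * zK K (signw c) = 1.
    by rewrite /signw; case: odd; rewrite ?zKN1 ?zK1 ?mulrNN mulr1.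
  apply: (cong_comb linA (c1 := zK K (signw c)) (c2 := - zK K (signw c)) h h') => F.
  rewrite /rev_relation ev_axpy ev_nil ev_scale zKN !ev_mono.
  transitivity (F c * (zK K (signw c) * zK K (signw c)) - zK K (signw c) * ev F (head_form M (rev c))).
    by rewrite s2; ring.
  by ring.
have : soundT Leaf by apply: sound_Leaf.
elim: C Leaf => [|c C IH] E hE //=; apply: IH.
exact: (sound_add_relation linA false (revE c) (sound_add_relation linA false (rotE c) hE)).
Qed.

Lemma congU_xform M w : soundU M -> congU (expand w) (xform M w).
Proof.
move=> hM; elim: w => [|l w IH]; first exact: cong_refl.
have h b : congU (lmul (l.1, b) (expand w)) (push M (l.1, b) (xform M w)).
  exact: (cong_trans linA (congU_lmul (l.1, b) IH) (sound_reduce linA _ hM)).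
apply: (cong_comb linA (c1 := 1) (c2 := zK K (xsign l)) (h false) (h true)) => F.
rewrite /= ev_cat ev_scale ev_axpy; ring.
Qed.

Lemma congT_xrow M E w : soundU M -> soundT E -> w != [::] -> congT (expand w) (xrow M E w).
Proof.
case: w => // l w hM hE _; apply: cong_trans (sound_reduce linA _ hE) => //.
have h b : congT (lmul (l.1, b) (expand w)) (lmul (l.1, b) (xform M w)).
  by apply: congT_lmul; apply: congU_xform.
apply: (cong_comb linA (c1 := 1) (c2 := zK K (xsign l)) (h false) (h true)) => F.
rewrite /= ev_cat ev_scale ev_axpy; ring.
Qed.

Variable gs : seq word.
Hypothesis generators_null : forall w, w \in gs -> congT (expand w) [::].

Definition spanned M n (B : seq word) := forall w, size w = n -> {subset keys (nform M w) <= B}.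

Lemma check_degreeP M E n B B' : soundU M -> soundT E -> (0 < n)%N -> check_degree gs M E n B B' ->
  spanned M n.-1 B -> spanned M n B' /\ forall w, size w = n -> congT (mono w) [::].
Proof.
case: n => // n hM hE _; rewrite /check_degree => /andP[/keys_inP hB'].
case e: (pivots _ _) => [ks|] // /andP[/keys_inP hrows /keys_inP hE'] hB.
have hC l v w : size w = n -> v \in keys (nform M w) -> l :: v \in extend B.
  by rewrite mem_extend => /hB; apply.
split=> -[|l w] //= [sw].
  move=> k /keys_subst[v]; rewrite keys_lmul => /mapP[v' hv' ->].
  by apply: hB'; apply: map_f; apply: hC sw hv'.
have hnull : forall k, k \in ks -> congT (mono k) [::].
  apply: (pivots_span linA e) => [r|]; last exact: hrows.
  case/mapP => g; rewrite mem_filter => /andP[/eqP sg hg] ->.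
  apply: cong_trans (generators_null hg) => //; apply: cong_sym => //.
  by apply: congT_xrow => //; case: (g) sg.
apply: (cong_trans linA (congT_head (l :: w) hM)) => /=.
apply: (cong_trans linA (sound_reduce linA _ hE)).
apply: cong_subst0 => // c; rewrite keys_lmul => /mapP[v hv ->].
have hk := hE' _ _ (map_f (image E) (hC l v w sw hv)).
apply: (cong_trans linA (cong_subst_mono linA (g := mono) _)) => [k _|]; first exact: cong_refl.
by apply: cong_subst0 => // k /hk; apply: hnull.
Qed.

Lemma check_degreesP M Cs n Bs : soundU M -> (0 < n)%N ->
  check_degrees gs M (trace_tables M Cs) n Bs -> spanned M n.-1 (head [::] Bs) ->
  spanned M (n.-1 + size Cs) [::] /\
  forall w, (n <= size w < n + size Cs)%N -> congT (mono w) [::].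
Proof.
move=> hM; elim: Cs n Bs => [|C Cs IH] n [|B [|B' Bs]] //= n0.
  rewrite addn0 => /nilP-> h; split=> // w; lia.
move=> /andP[/(check_degreeP hM (sound_trace_table _ hM) n0) h1 h2] /h1[hB' hw].
have [||h3 h4] := IH n.+1 (B' :: Bs) _ h2; rewrite //=; split.
  by move: h3 => /=; rewrite addnS -addSn prednK.
move=> w; have [e _|ne] := eqVneq (size w) n; first exact: hw.
by move=> hs; apply: h4; move: hs ne; clear; lia.
Qed.

(** Lengths up to [m] are covered degree by degree. A longer word has a prefix of length [m],
    congruent to 0 because no normal word of that length exists, and its nonempty rest is the test
    word. *)
Theorem trace_in_span D w : certificate gs D -> size w = N -> w != [::] -> A (tau w).
Proof.
have [hM _] := sound_presentation_at D.
have hb : exists Bs, rev (bases (presentation_at D)) = [:: [::]] :: Bs.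
  elim: D {hM} => [|D [Bs IH]]; first by exists [::].
  rewrite /presentation_at iterS -/(presentation_at D); case: (presentation_at D) IH => M Rt Bs0 /= IH.
  by rewrite rev_cons IH; eexists.
rewrite /certificate; case: (presentation_at D) hM hb => M Rt Bs /= hM [Bs1 hb].
move=> /and3P[+ _ _]; rewrite hb => hc sw w0.
have [] := check_degreesP hM _ hc; first by [].
  by case=> // _ k; rewrite inE.
move: (size (rev _)) => m /= h1 h2.
have [le|gt] := leqP (size w) m.
  have := h2 w; rewrite add1n ltnS le andbT lt0n size_eq0 => /(_ w0) => /(_ tt).
  by congr A; apply/funext => z; rewrite ev_mono ev_nil subr0 /cut sw leqnn.
have hr : drop m w != [::] by rewrite -size_eq0 size_drop subn_eq0 -ltnNge.
have hu : congU (mono (take m w)) [::].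
  apply: (cong_trans linA (congU_nform _ hM)).
  have st : size (take m w) = (0 + m)%N by rewrite size_take gt.
  case: (nform M (take m w)) (h1 _ st) => [_|[k a] p h]; first exact: cong_refl.
  by have := h k; rewrite inE eqxx => /(_ isT).
have := hu (exist (fun r : word => r != [::]) _ hr); congr A; apply/funext => z /=.
by rewrite ev_mono ev_nil subr0 cat_take_drop /cut sw leqnn.
Qed.
End Quotient.

(** The kernel evaluates the certificate in its virtual machine. The 9 is the first degree without
    normal words. *)
Lemma certificate_ok : certificate generator_words 9.
Proof. vm_cast_no_check (isT). Qed.

Lemma size_expand (w k : word) : k \in keys (expand w) -> size k = size w.
Proof.
elim: w k => [|l w IH] k; first by rewrite /keys inE => /eqP->.
by rewrite /= keys_cat keys_scale !keys_lmul mem_cat => /orP[]/mapP[k' /IH <- ->].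
Qed.

Lemma value_trie_of (s : seq (word * poly)) w : w \notin [seq t.1 | t <- s] -> value (trie_of s) w = [::].
Proof.
elim: s => [|t s IH]; first by case: w => [|[[] []]].
rewrite inE negb_or => /andP[h1 h2].
by rewrite /value /= lookup_insert (negbTE h1); apply: IH.
Qed.

(** * Invariant functionals on words, read off from the table of values *)

Section Functional.
Variables (K : numFieldType) (L : seq (word * poly)).
Let T := trie_of L.
Hypothesis checkT : all (fun t => check_word T t.1) L.
Variable F : word -> K.

Let G (w : word) : K := ev F (value T w).

Let ks := [seq t.1 | t <- L].

Let check w : w \in ks -> check_word T w.
Proof. by case/mapP => t ht ->; apply: (allP checkT). Qed.

Let value0 w : w \notin ks -> value T w = [::].
Proof. exact: value_trie_of. Qed.

Let value_rot w : value T (rot 1 w) = value T w.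
Proof.
have [/check|h] := boolP (w \in ks); first by case/and4P => /eq_polyP.
have [/check|h'] := boolP (rot 1 w \in ks); last by rewrite !value0.
by case/and4P => _ /eq_polyP; rewrite rotK.
Qed.

Lemma signw_rev w : signw (rev w) = signw w.
Proof. by rewrite /signw count_rev. Qed.

Lemma signw_sqr w : zK K (signw w) * zK K (signw w) = 1.
Proof. by rewrite /signw; case: odd; rewrite ?zKN1 ?zK1 ?mulrNN mulr1. Qed.

Lemma signw_cat u v : zK K (signw (u ++ v)) = zK K (signw u) * zK K (signw v).
Proof. by rewrite /signw count_cat oddD; do 2 case: odd; rewrite ?zKN1 ?zK1 ?mulrNN ?mulr1 ?mul1r. Qed.

Let G_cyc u v : G (u ++ v) = G (v ++ u).
Proof.
rewrite /G -(rot_size_cat u v).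
elim: {1}(size u) => [|n IH]; first by rewrite rot0.
have [h|h] := ltnP n (size (u ++ v)); last by rewrite rot_oversize // ltnW.
by rewrite (rotS h) value_rot.
Qed.

Let G_rev w : G (rev w) = zK K (signw w) * G w.
Proof.
rewrite /G; have [/check|h] := boolP (w \in ks).
  by case/and4P => _ _ /eq_polyP-> _; rewrite ev_scale.
have [/check|h'] := boolP (rev w \in ks); last by rewrite !value0 // ev_nil mulr0.
case/and4P => _ _ /eq_polyP; rewrite revK signw_rev => -> _.
by rewrite ev_scale mulrA signw_sqr mul1r.
Qed.

Definition eight (H : word -> word -> word -> K) u v w : K :=
  let e x := zK K (signw x) in
  H u v w + e w * H u v (rev w) + e v * H u (rev v) w + e v * e w * H u (rev v) (rev w)
  + e u * H (rev u) v w + e u * e w * H (rev u) v (rev w) + e u * e v * H (rev u) (rev v) w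
  + e u * e v * e w * H (rev u) (rev v) (rev w).

Let H u v w := G (u ++ v ++ w).

Let sum8E u v w : ev F (sum8 T u v w) = eight H u v w.
Proof. rewrite /sum8 !ev_axpy ev_nil !zKM zK1 /eight /H /G; ring. Qed.

Let sign_cases w : zK K (signw w) = 1 \/ zK K (signw w) = -1.
Proof. by rewrite /signw; case: odd; [right | left]. Qed.

Let eight_rev1 u v w : eight H (rev u) v w = zK K (signw u) * eight H u v w.
Proof. by rewrite /eight signw_rev revK; case: (sign_cases u) => ->; ring. Qed.
Let eight_rev2 u v w : eight H u (rev v) w = zK K (signw v) * eight H u v w.
Proof. by rewrite /eight signw_rev revK; case: (sign_cases v) => ->; ring. Qed.
Let eight_rev3 u v w : eight H u v (rev w) = zK K (signw w) * eight H u v w.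
Proof. by rewrite /eight signw_rev revK; case: (sign_cases w) => ->; ring. Qed.

Let eight_key u v w : u != [::] -> v != [::] -> w != [::] -> u ++ v ++ w \in ks ->
  eight H u v w = 0.
Proof.
rewrite -!size_eq0 -!lt0n => u0 v0 w0 /check/and4P[_ _ _ /allP/(_ (size u))].
have hi : size u \in iota 1 (size (u ++ v ++ w)).-1.
  by rewrite mem_iota !size_cat; move: (size u) (size v) (size w) u0 v0 w0 => a b c; lia.
have hj : size v \in iota 1 (size (u ++ v ++ w) - (size u).+1).
  by rewrite mem_iota !size_cat; move: (size u) (size v) (size w) u0 v0 w0 => a b c; lia.
move=> /(_ hi)/allP/(_ _ hj).
rewrite take_size_cat // drop_size_cat // take_size_cat // drop_size_cat //.
by move/nilP => e; rewrite -sum8E e ev_nil.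
Qed.

(** Reversing an argument changes the sum at most by a sign. So if one of the eight words is in the
    table, it may be taken as the first one, where the check applies; if none is, all terms are
    0. *)
Let eight0 u v w : u != [::] -> v != [::] -> w != [::] -> eight H u v w = 0.
Proof.
have r0 (x : word) : x != [::] -> rev x != [::] by rewrite -!size_eq0 size_rev.
have s0 x : zK K (signw x) != 0 by case: (sign_cases x) => ->; rewrite ?oppr_eq0 oner_eq0.
move=> u0 v0 w0; have [[ru rv] rw] := (r0 u u0, r0 v v0, r0 w w0).
have step1 : eight H (rev u) v w = 0 -> eight H u v w = 0.
  by rewrite eight_rev1 => /eqP; rewrite mulf_eq0 (negbTE (s0 _)) => /eqP.
have step2 u' : eight H u' (rev v) w = 0 -> eight H u' v w = 0.
  by rewrite eight_rev2 => /eqP; rewrite mulf_eq0 (negbTE (s0 _)) => /eqP.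
have step3 u' v' : eight H u' v' (rev w) = 0 -> eight H u' v' w = 0.
  by rewrite eight_rev3 => /eqP; rewrite mulf_eq0 (negbTE (s0 _)) => /eqP.
have [h1|/value0 h1] := boolP (u ++ v ++ w \in ks); first exact: eight_key.
have [h2|/value0 h2] := boolP (u ++ v ++ rev w \in ks); first by apply: step3; apply: eight_key.
have [h3|/value0 h3] := boolP (u ++ rev v ++ w \in ks); first by apply: step2; apply: eight_key.
have [h4|/value0 h4] := boolP (u ++ rev v ++ rev w \in ks).
  by apply: step2; apply: step3; apply: eight_key.
have [h5|/value0 h5] := boolP (rev u ++ v ++ w \in ks); first by apply: step1; apply: eight_key.
have [h6|/value0 h6] := boolP (rev u ++ v ++ rev w \in ks).
  by apply: step1; apply: step3; apply: eight_key.
have [h7|/value0 h7] := boolP (rev u ++ rev v ++ w \in ks).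
  by apply: step1; apply: step2; apply: eight_key.
have [h8|/value0 h8] := boolP (rev u ++ rev v ++ rev w \in ks).
  by apply: step1; apply: step2; apply: step3; apply: eight_key.
by rewrite /eight /H /G h1 h2 h3 h4 h5 h6 h7 h8 !ev_nil; ring.
Qed.

(** The change of letters brings [G] back to words in x, y and their adjoints and turns signed
    reversal into [star]. *)
Definition functional (w : word) : K := ev G (expand w).

Lemma ev_expand_cat (g : word -> K) u v :
  ev g (expand (u ++ v)) = ev (fun x => ev (fun y => g (x ++ y)) (expand v)) (expand u).
Proof.
elim: u g => [|l u IH] g; first by rewrite ev_mono.
by rewrite /= !ev_cat !ev_scale !ev_lmul !IH.
Qed.

Lemma ev_exchange (g : word -> word -> K) p q :
  ev (fun x => ev (g x) q) p = ev (fun y => ev (g^~ y) p) q.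
Proof.
rewrite /ev; under eq_bigr do rewrite mulr_sumr.
rewrite exchange_big; apply: eq_bigr => t _; rewrite mulr_sumr; apply: eq_bigr => s _.
by rewrite mulrCA.
Qed.

Lemma ev_lin (f g : word -> K) c p : ev (fun x => f x + c * g x) p = ev f p + c * ev g p.
Proof.
rewrite /ev mulr_sumr -big_split; apply: eq_bigr => t _ /=; ring.
Qed.

Lemma ev_expand_cons (g : word -> K) l w : ev g (expand (l :: w)) =
  ev (fun x => g ((l.1, false) :: x) + zK K (xsign l) * g ((l.1, true) :: x)) (expand w).
Proof. by rewrite /= ev_cat ev_scale !ev_lmul ev_lin. Qed.

Lemma ev_expand_star (g : word -> K) w :
  ev g (expand (star w)) = ev (fun x => zK K (signw x) * g (rev x)) (expand w).
Proof.
elim: w g => [|l w IH] g; first by rewrite !ev_mono /= mul1r.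
rewrite -cat1s star_cat ev_expand_cat IH ev_expand_cons; apply: eq_ev => x.
rewrite (_ : star [:: l] = [:: star_letter l]) // ev_expand_cons ev_mono !rev_cons -!cats1.
have sg b : zK K (signw ((l.1, b) :: x)) = (if b then -1 else 1) * zK K (signw x).
  by rewrite -cat1s signw_cat; case: b.
rewrite !sg (_ : xsign (star_letter l) = Z.opp (xsign l)); last by case: (l) => a [].
by rewrite zKN; ring.
Qed.

Lemma functional_cyc u v : functional (u ++ v) = functional (v ++ u).
Proof.
rewrite /functional !ev_expand_cat ev_exchange; apply: eq_ev => x; apply: eq_ev => y.
exact: G_cyc.
Qed.

Lemma functional_star w : functional (star w) = functional w.
Proof.
rewrite /functional ev_expand_star; apply: eq_ev => x.
by rewrite G_rev mulrA signw_sqr mul1r.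
Qed.

Lemma functional_sym3 u v w : u != [::] -> v != [::] -> w != [::] ->
  functional (u ++ v ++ w) + functional (u ++ v ++ star w) + functional (u ++ star v ++ w)
  + functional (u ++ star v ++ star w) + functional (star u ++ v ++ w)
  + functional (star u ++ v ++ star w) + functional (star u ++ star v ++ w)
  + functional (star u ++ star v ++ star w) = 0.
Proof.
move=> u0 v0 w0.
pose ev3 (f : word -> word -> word -> K) :=
  ev (fun x => ev (fun y => ev (f x y) (expand w)) (expand v)) (expand u).
have ev3E f g : (forall x y t, f x y t = g x y t) -> ev3 f = ev3 g.
  by move=> h; apply: eq_ev => x; apply: eq_ev => y; apply: eq_ev => t.
have ev3D f g : ev3 f + ev3 g = ev3 (fun x y t => f x y t + g x y t).
  have evD (f' g' : word -> K) p : ev f' p + ev g' p = ev (fun x => f' x + g' x) p.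
    by rewrite -[ev g' p]mul1r -ev_lin; apply: eq_ev => x; rewrite mul1r.
  by rewrite evD; apply: eq_ev => x; rewrite evD; apply: eq_ev => y; rewrite evD.
pose tog (b : bool) x := if b then star x else x.
pose sgn (b : bool) x := if b then zK K (signw x) else 1.
pose rv (b : bool) (x : word) := if b then rev x else x.
have evM c (f : word -> K) p : c * ev f p = ev (fun x => c * f x) p.
  by rewrite /ev mulr_sumr; apply: eq_bigr => t _; ring.
have term a b c : functional (tog a u ++ tog b v ++ tog c w) =
    ev3 (fun x y t => sgn a x * (sgn b y * (sgn c t * H (rv a x) (rv b y) (rv c t)))).
  have ev_tog (g : word -> K) d x : ev g (expand (tog d x)) = ev (fun y => sgn d y * g (rv d y)) (expand x).
    by case: d; rewrite /tog ?ev_expand_star //; apply: eq_ev => y; rewrite mul1r.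
  rewrite /functional ev_expand_cat ev_tog; apply: eq_ev => x; rewrite ev_expand_cat ev_tog evM.
  by apply: eq_ev => y; rewrite ev_tog !evM; apply: eq_ev => t.
have := (term false false false, term false false true, term false true false, term false true true,
  (term true false false, term true false true, term true true false, term true true true)).
rewrite /tog /sgn /rv => -[[[[-> ->] ->] ->] [[[-> ->] ->] ->]].
rewrite !ev3D (ev3E _ (eight H)); last by move=> x y t; rewrite /eight; ring.
have ev0 (f : word -> K) x : x != [::] -> (forall k, k != [::] -> f k = 0) -> ev f (expand x) = 0.
  move=> x0 h; rewrite /ev big_seq big1 // => t ht; rewrite h ?mulr0 //.
  by rewrite -size_eq0 (@size_expand x) ?size_eq0 //; apply: map_f.
by apply: (ev0) => // x x0; apply: (ev0) => // y y0; apply: (ev0) => // t t0; apply: eight0.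
Qed.

End Functional.

(** * Generation and minimality *)

Section JordanIdentity.
Variable K : numFieldType.
Implicit Types S T W : 'M[K]_(2 + 2).
Let o0 : 'I_(2 + 2) := @Ordinal 4 0 isT.
Let o1 : 'I_(2 + 2) := @Ordinal 4 1 isT.
Let o2 : 'I_(2 + 2) := @Ordinal 4 2 isT.
Let o3 : 'I_(2 + 2) := @Ordinal 4 3 isT.

Lemma self_adjoint_entries S : symp_adj S = S ->
  [/\ S o0 o2 = 0, S o1 o3 = 0, S o2 o0 = 0 & S o3 o1 = 0] /\
  [/\ S o1 o2 = - S o0 o3, S o3 o0 = - S o2 o1, S o2 o2 = S o0 o0 & S o3 o3 = S o1 o1]
  /\ S o2 o3 = S o1 o0 /\ S o3 o2 = S o0 o1.
Proof.
move=> hS; have E i j : S i j = - \sum_b (\sum_a symp_form K 2 i a * S b a) * symp_form K 2 b j.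
  rewrite -{1}hS symp_adjE [LHS]mxE; congr (- _); rewrite [LHS]mxE; apply: eq_bigr => b _; congr (_ * _).
  by rewrite [LHS]mxE; apply: eq_bigr => a _; rewrite [S^T _ _]mxE.
have z (x : K) : x = - x -> x = 0.
  by move/eqP; rewrite -addr_eq0 -mulr2n mulrn_eq0 => /eqP.
have F i j : S i j = - ((symp_form K 2 i o0 * S o0 o0 + symp_form K 2 i o1 * S o0 o1 + symp_form K 2 i o2 * S o0 o2 + symp_form K 2 i o3 * S o0 o3) * symp_form K 2 o0 j
  + (symp_form K 2 i o0 * S o1 o0 + symp_form K 2 i o1 * S o1 o1 + symp_form K 2 i o2 * S o1 o2 + symp_form K 2 i o3 * S o1 o3) * symp_form K 2 o1 j
  + (symp_form K 2 i o0 * S o2 o0 + symp_form K 2 i o1 * S o2 o1 + symp_form K 2 i o2 * S o2 o2 + symp_form K 2 i o3 * S o2 o3) * symp_form K 2 o2 j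
  + (symp_form K 2 i o0 * S o3 o0 + symp_form K 2 i o1 * S o3 o1 + symp_form K 2 i o2 * S o3 o2 + symp_form K 2 i o3 * S o3 o3) * symp_form K 2 o3 j).
  by rewrite {1}E !sum4.
split; [|split]; last split; try split.
1-4: apply: z.
all: rewrite [LHS]F !symp_form4E /= ?(mulr0n, mulr1n); ring.
Qed.

(** The characteristic polynomial of a self-adjoint S is a square, and S is a root of its square
    root: S^2 - (tr S / 2) S + c = 0. This is the polarization, with the constant found by taking
    traces and the denominators cleared by 4. *)
Lemma jordan_identity S T : symp_adj S = S -> symp_adj T = T ->
  4 *: (S *m T + T *m S) =
  (2 * \tr S) *: T + (2 * \tr T) *: S + (2 * \tr (S *m T) - \tr S * \tr T)%:M.
Proof.
move=> /self_adjoint_entries[[s1 s2 s3 s4] [[s5 s6 s7 s8] [s9 s10]]].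
move=> /self_adjoint_entries[[t1 t2 t3 t4] [[t5 t6 t7 t8] [t9 t10]]].
rewrite /mxtrace !sum4 -/o0 -/o1 -/o2 -/o3.
apply/matrixP => i j; rewrite ![(_ *m _) _ _]mxE !mxE !sum4 -/o0 -/o1 -/o2 -/o3.
have ord i' : [\/ i' = o0, i' = o1, i' = o2 | i' = o3].
  by case: i' => [[|[|[|[|//]]]] h]; [constructor 1|constructor 2|constructor 3|constructor 4]; apply: val_inj.
case: (ord i) => ->; case: (ord j) => ->; rewrite /= ?(s1,s2,s3,s4,s5,s6,s7,s8,s9,s10,t1,t2,t3,t4,t5,t6,t7,t8,t9,t10) ?(mulr0n, mulr1n); ring.
Qed.
End JordanIdentity.

(** * The Jordan identity makes long traces decomposable *)

Section UpperBound.
Variable K : numFieldType.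
Implicit Types (z : mxpair K 2) (w : word).

Lemma jordan_trace (S T W : 'M[K]_(2 + 2)) : symp_adj S = S -> symp_adj T = T ->
  4 * (\tr (S *m T *m W) + \tr (T *m S *m W)) =
  2 * \tr S * \tr (T *m W) + 2 * \tr T * \tr (S *m W)
  + (2 * \tr (S *m T) - \tr S * \tr T) * \tr W.
Proof.
move=> hS hT; have := congr1 (fun M => \tr (M *m W)) (jordan_identity hS hT).
by rewrite -scalemxAl mxtraceZ !mulmxDl !mxtraceD -!scalemxAl !mxtraceZ mul_scalar_mx mxtraceZ.
Qed.

(* The letter [(g, false)] stands for m + m* and [(g, true)] for m - m*,
   where m = x if [g] is [false] and m = y otherwise. *)
Definition split_letter z (l : letter) : 'M[K]_(2 + 2) :=
  let m := if l.1 then z.2 else z.1 in if l.2 then m - symp_adj m else m + symp_adj m.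

Definition split_word z w := mxword (split_letter z) w.
Definition split_trace w z : K := \tr (split_word z w).

Lemma split_word_cat z u v : split_word z (u ++ v) = split_word z u *m split_word z v.
Proof. exact: mxword_cat. Qed.

Lemma split_trace_cyc u v z : split_trace (u ++ v) z = split_trace (v ++ u) z.
Proof. by rewrite /split_trace !split_word_cat mxtrace_mulC. Qed.

Lemma split_word_rev z w :
  split_word z (rev w) = zK K (signw w) *: symp_adj (split_word z w).
Proof.
elim: w => [|l w IH]; first by rewrite /split_word mxword_nil symp_adj1 scale1r.
rewrite -cat1s rev_cat !split_word_cat IH symp_adjM signw_cat mulrC -scalerA.
rewrite -scalemxAl; congr (_ *: _); rewrite scalemxAr; congr (_ *m _).
rewrite (_ : rev [:: l] = [:: l]) // /split_word mxword_cons mxword_nil mulmx1.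
case: l => g [] /=; rewrite /split_letter /=; last first.
  by rewrite symp_adjD symp_adjK addrC scale1r.
rewrite (_ : zK K _ = -1) // symp_adjD symp_adjN symp_adjK scaleN1r opprD opprK.
exact: addrC.
Qed.

Lemma split_trace_rev w z : split_trace (rev w) z = zK K (signw w) * split_trace w z.
Proof. by rewrite /split_trace split_word_rev mxtraceZ tr_symp_adj. Qed.

Lemma ev_expand_trace z w (M : 'M[K]_(2 + 2)) :
  ev (fun x => \tr (M *m split_word z x)) (expand w) = 2 ^+ size w * \tr (M *m eval_word w z).
Proof.
elim: w M => [|l w IH] M.
  by rewrite ev_mono eval_wordE /split_word !mxword_nil mul1r.
rewrite ev_expand_cons ev_lin.
have E b : ev (fun x => \tr (M *m split_word z ((l.1, b) :: x))) (expand w) =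
    2 ^+ size w * \tr (M *m split_letter z (l.1, b) *m eval_word w z).
  by rewrite -IH; apply: eq_ev => x; rewrite /split_word mxword_cons mulmxA.
rewrite !E mulrCA -mulrDr exprSr -mulrA; congr (_ * _).
rewrite [eval_word (l :: w) z]eval_wordE mxword_cons -[mxword _ w]/(eval_word w z) mulmxA.
have <- : \tr (M *m (2 *: eval_letter z l) *m eval_word w z) =
    2 * \tr (M *m eval_letter z l *m eval_word w z) by rewrite -scalemxAr -scalemxAl mxtraceZ.
have -> : 2 *: eval_letter z l =
    split_letter z (l.1, false) + zK K (xsign l) *: split_letter z (l.1, true).
  rewrite /split_letter /eval_letter scaler_nat mulr2n.
  case: l {E} => g []; rewrite /xsign /= ?zKN1 ?zK1 ?scaleN1r ?scale1r.
    by rewrite opprB [RHS]addrC [RHS]addrA subrK.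
  by rewrite [RHS]addrACA addrN addr0.
move: (split_letter _ _) (split_letter _ _) => a b.
by rewrite mulmxDr mulmxDl mxtraceD -scalemxAr -scalemxAl mxtraceZ.
Qed.

Lemma ev_in (f g : word -> K) p : (forall w, w \in keys p -> f w = g w) -> ev f p = ev g p.
Proof.
move=> h; rewrite /ev [LHS]big_seq [RHS]big_seq; apply: eq_bigr => t ht.
by rewrite h //; apply: map_f.
Qed.

Variable A : set (mxpair K 2 -> K).
Hypothesis subA : subalgebra A.

Lemma subalgebra_linear : linear_closed A.
Proof.
case: subA => Acst AD AM; split; first exact: (Acst 0).
  exact: AD.
by move=> c g hg; apply: (AM (cst c) g).
Qed.

(** The Jordan identity for s + s* and t + t*, multiplied by the word [r], has on its right products
    of traces of words shorter than s t r. For the term with the traces of s t and of r this holds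
    because [r] is nonempty. *)
Lemma jordan_null N s t : (forall w, (size w < N)%N -> w != [::] -> A (split_trace w)) ->
  s != [::] -> t != [::] -> congU A split_trace N (jordan s t) [::].
Proof.
move=> hN s0 t0 [r r0] /=.
have [Acst AD AM] := subA.
have evS (f : word -> K) u : ev f (symmetrized u) = f u + zK K (signw u) * f (rev u).
  by rewrite /symmetrized ev_axpy ev_mono mul1r ev_cons ev_nil addr0.
have evJ (f : word -> K) : ev f (jordan s t) =
    ev (fun x => ev (fun y => f (x ++ y) + f (y ++ x)) (symmetrized t)) (symmetrized s).
  rewrite /jordan; elim: (symmetrized s) => [|a p IH]; first by rewrite !ev_nil.
  rewrite /= flatten_cat ev_cat IH {IH}; case: a => x c /=; rewrite ev_cons; congr (_ + _).
  elim: (symmetrized t) => [|[y d] q IH]; first by rewrite !ev_nil mulr0.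
  by rewrite /= !ev_cons IH !zKM; ring.
pose tau := split_trace.
(* If the total length exceeds [N], all terms are truncated to 0. *)
have [le|gt] := leqP (size s + size t + size r) N; last first.
  have := Acst 0; congr A; apply/funext => z; rewrite ev_nil evJ !evS /cut.
  rewrite !size_cat !size_rev.
  by rewrite (addnC (size t) (size s)) leqNgt gt /= !(addr0, mulr0, subr0).
(* The right side of [jordan_trace] after division by 4, with each self-adjoint factor expanded by
   signed reversal. *)
pose g : mxpair K 2 -> K := fun z =>
  tau s z * (tau (t ++ r) z + zK K (signw t) * tau (rev t ++ r) z)
  + tau t z * (tau (s ++ r) z + zK K (signw s) * tau (rev s ++ r) z)
  + (tau (s ++ t) z + zK K (signw t) * tau (s ++ rev t) z - tau s z * tau t z) * tau r z.
have Ag : A g.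
  have lt w : w != [::] -> (size w < size s + size t + size r)%N -> A (tau w).
    by move=> w0 hw; apply: hN => //; apply: leq_trans hw le.
  have pos (w : word) : w != [::] -> (0 < size w)%N by rewrite lt0n size_eq0.
  have AZ c h : A h -> A (fun z => c * h z) by move=> hh; apply: (AM (cst c) h).
  have ne (u v : word) : v != [::] -> u ++ v != [::] by case: u v => [|? ?] [].
  have ps := pos s s0; have pt := pos t t0; have pr := pos r r0.
  have h1 : A (tau s) by apply: lt => //; move: ps pt pr; move: (size s) (size t) (size r) => i j k; clear; lia.
  have h2 : A (tau t) by apply: lt => //; move: ps pt pr; move: (size s) (size t) (size r) => i j k; clear; lia.
  have h3 : A (tau r) by apply: lt => //; move: ps pt pr; move: (size s) (size t) (size r) => i j k; clear; lia.
  have h4 : A (tau (t ++ r)) by apply: lt; [exact: ne|rewrite size_cat; move: ps pt pr; move: (size s) (size t) (size r) => i j k; clear; lia].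
  have h5 : A (tau (rev t ++ r)) by apply: lt; [exact: ne|rewrite size_cat size_rev; move: ps pt pr; move: (size s) (size t) (size r) => i j k; clear; lia].
  have h6 : A (tau (s ++ r)) by apply: lt; [exact: ne|rewrite size_cat; move: ps pt pr; move: (size s) (size t) (size r) => i j k; clear; lia].
  have h7 : A (tau (rev s ++ r)) by apply: lt; [exact: ne|rewrite size_cat size_rev; move: ps pt pr; move: (size s) (size t) (size r) => i j k; clear; lia].
  have h8 : A (tau (s ++ t)) by apply: lt; [exact: ne|rewrite size_cat; move: ps pt pr; move: (size s) (size t) (size r) => i j k; clear; lia].
  have h9 : A (tau (s ++ rev t)).
    by apply: lt; [case: (s) s0|rewrite size_cat size_rev; move: ps pt pr; move: (size s) (size t) (size r) => i j k; clear; lia].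
  have k1 := AM _ _ h1 (AD _ _ h4 (AZ (zK K (signw t)) _ h5)).
  have k2 := AM _ _ h2 (AD _ _ h6 (AZ (zK K (signw s)) _ h7)).
  have k3 := AM _ _ (AD _ _ (AD _ _ h8 (AZ (zK K (signw t)) _ h9)) (AZ (-1) _ (AM _ _ h1 h2))) h3.
  have := AD _ _ (AD _ _ k1 k2) k3; congr A; apply/funext => z.
  by rewrite /g /=; ring.
have := Ag; congr A; apply/funext => z; rewrite ev_nil subr0 evJ !evS /cut.
rewrite !size_cat !size_rev (addnC (size t) (size s)) le /= -/tau.
pose S : 'M[K]_(2 + 2) := split_word z s + symp_adj (split_word z s).
pose T : 'M[K]_(2 + 2) := split_word z t + symp_adj (split_word z t).
have symS : symp_adj S = S by rewrite /S symp_adjD symp_adjK addrC.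
have symT : symp_adj T = T by rewrite /T symp_adjD symp_adjK addrC.
have adjE w : symp_adj (split_word z w) = zK K (signw w) *: split_word z (rev w).
  by rewrite split_word_rev scalerA signw_sqr scale1r.
have trS : \tr S = 2 * tau s z by rewrite /S mxtraceD tr_symp_adj -mulr2n mulr_natl.
have trT : \tr T = 2 * tau t z by rewrite /T mxtraceD tr_symp_adj -mulr2n mulr_natl.
have trST : \tr (S *m T) = 2 * \tr (split_word z s *m T).
  rewrite /S mulmxDl mxtraceD -[X in _ + X]tr_symp_adj symp_adjM symp_adjK symT.
  by rewrite [\tr (T *m _)]mxtrace_mulC -mulr2n mulr_natl.
have lin (P : 'M[K]_(2 + 2)) w (Q : 'M[K]_(2 + 2)) : \tr (P *m (split_word z w + symp_adj (split_word z w)) *m Q) =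
    \tr (P *m split_word z w *m Q) + zK K (signw w) * \tr (P *m split_word z (rev w) *m Q).
  by rewrite adjE mulmxDr mulmxDl mxtraceD -scalemxAr -scalemxAl mxtraceZ.
have lin1 w Q : \tr ((split_word z w + symp_adj (split_word z w)) *m Q) =
    \tr (split_word z w *m Q) + zK K (signw w) * \tr (split_word z (rev w) *m Q).
  by have := lin 1%:M w Q; rewrite !mul1mx.
have tauE u v w : tau (u ++ v) z = \tr (split_word z u *m split_word z v).
  by rewrite /tau /split_trace split_word_cat.
have tauE3 u v w : tau ((u ++ v) ++ w) z = \tr (split_word z u *m split_word z v *m split_word z w).
  by rewrite /tau /split_trace !split_word_cat.
have e := jordan_trace (split_word z r) symS symT; rewrite trS trT trST -/(tau r z) in e.
have hT : \tr (T *m split_word z r) = tau (t ++ r) z + zK K (signw t) * tau (rev t ++ r) z.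
  by rewrite lin1 !tauE.
have hS : \tr (S *m split_word z r) = tau (s ++ r) z + zK K (signw s) * tau (rev s ++ r) z.
  by rewrite lin1 !tauE.
have haT : \tr (split_word z s *m T) = tau (s ++ t) z + zK K (signw t) * tau (s ++ rev t) z.
  by have := lin (split_word z s) t 1%:M; rewrite !mulmx1 !tauE.
have e' : \tr (S *m T *m split_word z r) + \tr (T *m S *m split_word z r) = g z.
  have n4 : (4 : K) != 0 by rewrite pnatr_eq0.
  by apply: (mulfI n4); rewrite e hT hS haT /g; ring.
have tri P w Q : \tr (P *m split_word z w *m Q) = \tr (P *m (split_word z w *m Q)).
  by rewrite mulmxA.
have ST : \tr (S *m T *m split_word z r) =
  (tau ((s ++ t) ++ r) z + zK K (signw t) * tau ((s ++ rev t) ++ r) z)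
  + zK K (signw s) * (tau ((rev s ++ t) ++ r) z + zK K (signw t) * tau ((rev s ++ rev t) ++ r) z).
  by rewrite -mulmxA lin1 !mulmxA !lin !tauE3.
have TS : \tr (T *m S *m split_word z r) =
  (tau ((t ++ s) ++ r) z + zK K (signw t) * tau ((rev t ++ s) ++ r) z)
  + zK K (signw s) * (tau ((t ++ rev s) ++ r) z + zK K (signw t) * tau ((rev t ++ rev s) ++ r) z).
  rewrite lin -[T *m _ *m _]mulmxA lin1 -[T *m split_word z (rev s) *m _]mulmxA lin1 !mulmxA !tauE3.
  by [].
rewrite -e' ST TS; ring.
Qed.

End UpperBound.

(** Strong induction on length: shorter traces already lie in [A], which is what makes the Jordan
    relations congruences modulo [A]. *)
Lemma trace_words_in (K : numFieldType) (gs : seq word) (D : nat) (A : set (mxpair K 2 -> K)) :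
  certificate gs D -> subalgebra A -> (forall w, w \in gs -> A (trace_word w)) ->
  forall w, A (trace_word w).
Proof.
move=> cert subA hgs; have [Acst AD AM] := subA.
have linA := subalgebra_linear subA.
have pow2 n : (2 : K) ^+ n != 0 by rewrite expf_neq0 // pnatr_eq0.
have ev_trace w z : ev (fun x => @split_trace K x z) (expand w) = 2 ^+ size w * trace_word w z.
  rewrite /trace_word -[eval_word w z]mul1mx -ev_expand_trace.
  by apply: eq_ev => x; rewrite mul1mx.
have split_in N w : size w = N -> w != [::] -> A (@split_trace K w).
  elim/ltn_ind: N w => N IH w sw w0.
  apply: (@trace_in_span K _ A linA _ N _ _ _ gs _ D w cert sw w0).
  - by move=> u v z; apply: split_trace_cyc.
  - by move=> u z; apply: split_trace_rev.
  - by move=> s t; apply: (jordan_null subA) => u hu u0; apply: IH hu _ _ u0.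
  - move=> g hg [] /=; have [le|gt] := leqP (size g) N.
      have := AM _ _ (Acst (2 ^+ size g)) (hgs _ hg); congr A; apply/funext => z /=.
      rewrite ev_nil subr0 -ev_trace; apply: ev_in => x /size_expand hx.
      by rewrite /cut hx le.
    have := Acst 0; congr A; apply/funext => z.
    rewrite ev_nil subr0 -[LHS](_ : ev (fun=> 0) (expand g) = 0).
      by apply: ev_in => x /size_expand hx; rewrite /cut hx leqNgt gt.
    by rewrite /ev big1 // => t _; rewrite mulr0.
have ev_in_A (p : poly) : (forall w, w \in keys p -> w != [::]) -> A (fun z => ev (fun x => @split_trace K x z) p).
  elim: p => [|[w a] p IH] hp.
    by have := Acst 0; congr A; apply/funext => z; rewrite ev_nil.
  have h1 := split_in _ w erefl (hp w (mem_head _ _)).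
  have h2 : A (fun z => ev (fun x => @split_trace K x z) p) by apply: IH => u hu; apply: hp; rewrite inE hu orbT.
  have := AD _ _ (AM _ _ (Acst (zK K a)) h1) h2; congr A; apply/funext => z /=.
  by rewrite ev_cons.
move=> [|l w].
  have := Acst (\tr (1%:M : 'M[K]_(2 + 2))); congr A; apply/funext => z.
  by rewrite /trace_word eval_wordE mxword_nil.
have h : A (fun z => ev (fun x => @split_trace K x z) (expand (l :: w))).
  by apply: ev_in_A => u /size_expand; case: u.
have := AM _ _ (Acst (2 ^+ size (l :: w))^-1) h; congr A; apply/funext => z.
by rewrite -[RHS](mulKf (pow2 (size (l :: w)))) -ev_trace.
Qed.

(** * Traces of words are homogeneous invariants *)

Section WordFunctions.
Variable K : numFieldType.
Implicit Types (z : mxpair K 2) (w : word).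

Definition homogeneous_of d (f : mxpair K 2 -> K) :=
  exists2 p : {mpoly K[ncoords 2]}, p \is d.-homog & forall z, f z = p.@[coords z].

Lemma homogD d f g : homogeneous_of d f -> homogeneous_of d g -> homogeneous_of d (fun z => f z + g z).
Proof.
move=> [p hp ep] [q hq eq]; exists (p + q) => [|z]; first exact: rpredD.
by rewrite mevalD ep eq.
Qed.

Lemma homogM d e f g : homogeneous_of d f -> homogeneous_of e g -> homogeneous_of (d + e) (fun z => f z * g z).
Proof.
move=> [p hp ep] [q hq eq]; exists (p * q) => [|z]; first exact: dhomogM.
by rewrite mevalM ep eq.
Qed.

Lemma homogZ d c f : homogeneous_of d f -> homogeneous_of d (fun z => c * f z).
Proof.
move=> [p hp ep]; exists (c *: p) => [|z]; first exact: rpredZ.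
by rewrite mevalZ ep.
Qed.

Lemma homog_sum d I (r : seq I) (f : I -> mxpair K 2 -> K) :
  (forall i, homogeneous_of d (f i)) -> homogeneous_of d (fun z => \sum_(i <- r) f i z).
Proof.
move=> h; elim: r => [|i r [p hp ep]].
  by exists 0 => [|z]; rewrite ?rpred0 // meval0 big_nil.
have [q hq eq] := homogD (h i) (ex_intro2 _ _ p hp ep).
by exists q => // z; rewrite -eq big_cons.
Qed.

Lemma homog_ext d f g : homogeneous_of d f -> f =1 g -> homogeneous_of d g.
Proof. by move=> [p hp ep] e; exists p => // z; rewrite -e. Qed.

Lemma homog_letter l i j : homogeneous_of 1 (fun z => eval_letter z l i j).
Proof.
have hx (b : bool) i' j' : homogeneous_of 1 (fun z => (if b then z.2 else z.1) i' j').
  pose k : 'I_(ncoords 2) := if b then rshift _ (mxvec_index i' j') else lshift _ (mxvec_index i' j').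
  exists 'X_k => [|z]; first by rewrite dhomogX; apply/eqP; apply: mdeg1.
  by rewrite mevalXU /coords /k; clear k; case: b; rewrite ?row_mxEl ?row_mxEr mxvecE.
case: l => b []; last exact: hx.
apply: (@homog_ext _ (fun z => -1 * \sum_c (\sum_a symp_form K 2 i a * (if b then z.2 else z.1) c a) * symp_form K 2 c j)).
  apply: homogZ; apply: homog_sum => c.
  have h : homogeneous_of 1 (fun z => symp_form K 2 c j * \sum_a symp_form K 2 i a * (if b then z.2 else z.1) c a).
    by apply: homogZ; apply: homog_sum => a; apply: homogZ; apply: hx.
  by apply: homog_ext h _ => z; rewrite mulrC.
move=> z; rewrite /eval_letter /= symp_adjE [RHS]mxE mulN1r; congr (- _).
rewrite [RHS]mxE; apply: eq_bigr => c _; congr (_ * _); rewrite [RHS]mxE.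
by apply: eq_bigr => a _; rewrite [_^T _ _]mxE.
Qed.

Lemma homog_word w i j : homogeneous_of (size w) (fun z => eval_word w z i j).
Proof.
elim: w i j => [|l w IH] i j.
  exists (((1%:M : 'M[K]_(2 + 2)) i j) *: 1) => [|z].
    by apply: dhomogZ; apply: dhomog1.
  by rewrite mevalZ meval1 mulr1 eval_wordE mxword_nil.
apply: (@homog_ext _ (fun z => \sum_k eval_letter z l i k * eval_word w z k j)).
  by apply: homog_sum => k; exact: (homogM (homog_letter l i k) (IH k j)).
by move=> z; rewrite [RHS](_ : _ = (eval_letter z l *m eval_word w z) i j) ?eval_wordE ?mxword_cons // [RHS]mxE.
Qed.

Lemma homog_trace w : homogeneous_of (size w) (trace_word w).
Proof. by apply: homog_sum => i; apply: homog_word. Qed.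

Lemma trace_word_homogeneous w : @homogeneous_function K 2 (trace_word w).
Proof. by have [p hp ep] := homog_trace w; exists (size w), p. Qed.

Lemma trace_word_invariant w : symp_invariants K 2 (trace_word w).
Proof.
split; first by have [p _ ep] := homog_trace w; exists p.
move=> a z [ua ga].
have ia : invmx a = symp_adj a.
  have h : symp_adj a *m a = 1%:M.
    by rewrite /symp_adj -!mulmxA [a^T *m _]mulmxA ga mulVmx // symp_form_unit.
  by rewrite -[LHS]mul1mx -h mulmxK.
have adj_conj m : symp_adj (a *m m *m invmx a) = a *m symp_adj m *m invmx a.
  by rewrite {1}ia symp_adjM symp_adjK symp_adjM -ia mulmxA.
have letterE l : eval_letter (conj_pair a z) l = a *m eval_letter z l *m invmx a.
  by case: l => [] [] []; rewrite /eval_letter /= ?adj_conj.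
have wordE : eval_word w (conj_pair a z) = a *m eval_word w z *m invmx a.
  elim: w => [|l w IH]; first by rewrite !eval_wordE !mxword_nil mulmx1 mulmxV.
  rewrite eval_wordE mxword_cons -eval_wordE IH letterE.
  rewrite [in RHS]eval_wordE mxword_cons -eval_wordE.
  by rewrite !mulmxA mulmxKV.
by rewrite /trace_word wordE mxtrace_mulC mulmxA mulVmx // mul1mx.
Qed.

End WordFunctions.

Local Open Scope classical_set_scope.
Local Open Scope ring_scope.

(** A family indexed by linear forms [F] on normal forms takes the place of one separating
    functional; independence of the generator rows is independence of the words against the whole
    family. *)
Lemma trace_functionals (K : numFieldType) (gs : seq word) (D : nat) : certificate gs D ->
  exists Lam : (word -> K) -> word -> K,
    [/\ forall F u v, Lam F (u ++ v) = Lam F (v ++ u),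
        forall F w, Lam F (star w) = Lam F w,
        forall F u v w, u != [::] -> v != [::] -> w != [::] ->
          Lam F (u ++ v ++ w) + Lam F (u ++ v ++ star w) + Lam F (u ++ star v ++ w)
          + Lam F (u ++ star v ++ star w) + Lam F (star u ++ v ++ w)
          + Lam F (star u ++ v ++ star w) + Lam F (star u ++ star v ++ w)
          + Lam F (star u ++ star v ++ star w) = 0 &
        forall c : word -> K, (forall F, \sum_(w <- gs) c w * Lam F w = 0) ->
          forall w, w \in gs -> c w = 0].
Proof.
rewrite /certificate; case: (presentation_at D) => M _ Bs /and3P[_].
move: (values _ _ _) => L hL; case e: (pivots _ _) => [ks|] // _.
exists (fun F w => functional L F w); split.
- by move=> F u v; apply: functional_cyc.
- by move=> F w; apply: functional_star.
- by move=> F u v w; apply: functional_sym3.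
move=> c hc w hw.
pose rows := [seq (c w, functional_row (trie_of L) w) | w <- gs].
apply: (@pivots_independent K (size gs) rows ks _ _ (c w, functional_row (trie_of L) w)).
- by rewrite -e /rows -map_comp.
- move=> F; rewrite -[RHS](hc F) /rows big_map; apply: eq_bigr => u _ /=.
  by rewrite /functional_row ev_subst.
- by apply/mapP; exists w.
Qed.

(** If the trace of [w0] were a polynomial in the others, [trace_sft] would make [Lam F w0] the same
    combination of the other [Lam F w] for every [F], against the independence of the generators. *)
Lemma trace_word_indecomposable (K : numFieldType) (gs : seq word) (D : nat) w0 :
  certificate gs D -> uniq gs -> [::] \notin gs -> w0 \in gs ->
  ~ generated_subalgebra [set @trace_word K 2 w | w in [set` gs] `\ w0] (@trace_word K 2 w0).
Proof.
move=> /(@trace_functionals K)[Lam [Lcyc Lstar Lsym Lind]] ugs gs0 hw0.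
pose val (P : seq (K * seq word)) (z : mxpair K 2) := \sum_(t <- P) t.1 * \prod_(w <- t.2) trace_word w z.
pose lin F (P : seq (K * seq word)) := \sum_(t <- P) t.1 * (if t.2 is [:: w] then Lam F w else 0).
pose const (P : seq (K * seq word)) := \sum_(t <- P) t.1 * (nilp t.2)%:R.
pose wf (P : seq (K * seq word)) := forall t, t \in P -> all (fun w => w != [::]) t.2.
(* The coefficients [c] are chosen before [F]. Closure under products holds because the linear part
   of a product is each constant term times the other linear part. *)
pose B : set (mxpair K 2 -> K) := [set f | exists P, [/\ wf P, f = val P &
  exists c : word -> K, forall F, lin F P = \sum_(w <- gs | w != w0) c w * Lam F w]].
have subB : subalgebra B.
  split.
  - move=> a; exists [:: (a, [::])]; split; first by move=> t; rewrite inE => /eqP->.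
      by apply/funext => z; rewrite /val big_seq1 big_nil mulr1.
    exists (fun=> 0) => F; rewrite /lin big_seq1 mulr0 big1 // => w _; exact: mul0r.
  - move=> f g [P [wP -> [c hc]]] [Q [wQ -> [d hd]]]; exists (P ++ Q); split.
    + by move=> t; rewrite mem_cat => /orP[/wP|/wQ].
    + by apply/funext => z; rewrite /val big_cat.
    + exists (fun w => c w + d w) => F; rewrite /lin big_cat /= -/(lin F P) -/(lin F Q) hc hd -big_split.
      by apply: eq_bigr => w _; rewrite mulrDl.
  - move=> f g [P [wP -> [c hc]]] [Q [wQ -> [d hd]]].
    exists [seq (s.1 * t.1, s.2 ++ t.2) | s <- P, t <- Q]; split.
    + by move=> t /allpairsP[[u v] [/= hu hv ->]] /=; rewrite all_cat wP // wQ.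
    + apply/funext => z; rewrite /val big_allpairs_dep /= big_distrlr /=; apply: eq_bigr => s _.
      by apply: eq_bigr => t _; rewrite big_cat /=; ring.
    + exists (fun w => const P * d w + const Q * c w) => F.
      have -> : lin F [seq (s.1 * t.1, s.2 ++ t.2) | s <- P, t <- Q] = const P * lin F Q + const Q * lin F P.
        rewrite /lin /const big_allpairs_dep /= !big_distrlr /= [X in _ + X]exchange_big -big_split.
        apply: eq_bigr => s _; rewrite /= -big_split; apply: eq_bigr => t _ /=.
        case: s t => [a [|u s]] [b [|v t]] /=; rewrite ?cats0 ?mulr0n ?mulr1n.
        1-3: ring.
        by case: s => [|? ?] /=; ring.
      by rewrite hc hd !mulr_sumr -big_split; apply: eq_bigr => w _ /=; ring.
have genB f : [set @trace_word K 2 w | w in [set` gs] `\ w0] f -> B f.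
  move=> [w /= [hw ne] <-]; exists [:: (1, [:: w])]; split.
  - move=> t; rewrite inE => /eqP-> /=; rewrite andbT.
    by apply: contraNneq gs0 => <-.
  - by apply/funext => z; rewrite /val !big_seq1 mul1r.
  - exists (fun u => (u == w)%:R) => F; rewrite /lin big_seq1 mul1r.
    rewrite big_mkcond (bigD1_seq w) //= (introN eqP ne) eqxx mul1r.
    by rewrite big1 ?addr0 // => u /negbTE->; rewrite mul0r if_same.
move=> /(_ B (conj subB genB)).
move=> [P [wP hP [c hc]]].
pose d w := if w == w0 then -1 else c w.
suff : d w0 = 0 by rewrite /d eqxx => /eqP; rewrite oppr_eq0 oner_eq0.
apply: (Lind) (hw0) => F.
have w0n : w0 != [::] by apply: contraNneq gs0 => <-.
have h : -1 * Lam F w0 + \sum_(w <- gs | w != w0) c w * Lam F w = 0.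
  rewrite -hc -[RHS](@trace_sft K (Lam F) (Lcyc F) (Lstar F) (Lsym F) ((-1, [:: w0]) :: P)) ?big_cons //.
    by move=> t; rewrite inE => /orP[/eqP-> /=|/wP//]; rewrite w0n.
  by move=> z; rewrite big_cons -/(val P z) -hP big_seq1 mulN1r addNr.
rewrite (bigD1_seq w0) //= {1}/d eqxx -[RHS]h; congr (_ + _).
by apply: eq_bigr => w /negbTE hw; rewrite /d hw.
Qed.

Theorem theorem4p1 (R : realType) :
  minimal_homogeneous_generators (@homogeneous_function R[i] 2)
    (symp_invariants R[i] 2)
    [set @trace_word R[i] 2 w | w in [set` generator_words]]
  /\ {in generator_words &, injective (@trace_word R[i] 2)}.
Proof.
have cert := certificate_ok.
have ugs : uniq generator_words by vm_compute.
have gs0 : [::] \notin generator_words by vm_compute.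
(* Abstracting the list keeps later steps from unfolding the 136 words. *)
move: generator_words cert ugs gs0 => gs cert ugs gs0.
have indec w0 := @trace_word_indecomposable R[i] gs 9 w0 cert ugs gs0.
have subG S : subalgebra (@generated_subalgebra R[i] (mxpair R[i] 2) S).
  split; first by move=> c A [[Acst _ _] _]; apply: Acst.
    by move=> f g hf hg A [sA SA]; case: (sA) => _ AD _; exact: AD (hf A (conj sA SA)) (hg A (conj sA SA)).
  by move=> f g hf hg A [sA SA]; case: (sA) => _ _ AM; exact: AM (hf A (conj sA SA)) (hg A (conj sA SA)).
split; last first.
  move=> u v hu hv e; apply/eqP; apply/negP => /negP ne.
  (* Two generators with equal traces would make one of them generated by the others. *)
  apply: (indec v hv) => A [_ SA]; apply: (SA (trace_word v)).
  by exists u; [split; [exact: hu|exact/eqP]|exact: e].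
split.
- by move=> f [w _ <-]; apply: trace_word_invariant.
- by move=> f [w _ <-]; apply: trace_word_homogeneous.
- apply/seteqP; split=> [f|f hf].
    move=> /(_ (symp_invariants R[i] 2)); apply; split; last first.
      by move=> g [w _ <-]; apply: trace_word_invariant.
    split.
    + move=> c; split=> [|a z _]; last exact: erefl.
      by exists (mpolyC _ c) => z; rewrite mevalC.
    + move=> g h [[p hp] ig] [[q hq] ih]; split=> [|a z ha]; last by rewrite /= (ig _ _ ha) (ih _ _ ha).
      by exists (p + q) => z /=; rewrite mevalD hp hq.
    + move=> g h [[p hp] ig] [[q hq] ih]; split=> [|a z ha]; last by rewrite /= (ig _ _ ha) (ih _ _ ha).
      by exists (p * q) => z /=; rewrite mevalM hp hq.
  move=> A [sA SA]; apply: (first_fundamental_theorem sA) hf.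
  by apply: (trace_words_in cert sA) => w hw; apply: (SA (trace_word w)); exists w; [exact: hw|exact: erefl].
- move=> S' [sub nsub] gen; apply: nsub => f [w0 hw0 <-]; apply: contrapT => nS'.
  apply: (indec w0 hw0).
  have : generated_subalgebra S' (@trace_word R[i] 2 w0).
    by rewrite gen; apply: trace_word_invariant.
  move=> h A [sA SA]; apply: (h A); split; first exact: sA.
  move=> g hg; apply: (SA g); have [w hw e] := sub _ hg; exists w; last exact: e.
  split; first exact: hw.
  by move=> e0; apply: nS'; move: hg; rewrite -e e0.
Qed.
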